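(* Let $d \ge 1$, and let $f(z_1,\dots,z_d) = f_1(z_1) = \sum_{n=0}^\infty a_n z_1^n$, where $a_n = O\big(e^{-c\, n^{\frac12 + \varepsilon}}\big)$ for some $\varepsilon > 0$ and $c > 0$. Then $f$ is in the range of the Toeplitz operator $T_{\bar m}^{H^2(B_d)}$ for every non-zero $m \in H^\infty(B_d)$.
   Context: $B_d$ is the open unit ball in $\mathbb{C}^d$, $S_d$ is its boundary, and $\sigma_d$ is normalized Lebesgue measure on $S_d$. $H^\infty(B_d)$ is the space of bounded analytic functions on $B_d$; each such $m$ has radial limits $\sigma_d$-almost everywhere, defining a boundary function $m^\star$ on $S_d$. The Hardy space $H^2(B_d)$ is the closure of the polynomials (in $z_1,\dots,z_d$) in $L^2(\sigma_d)$, its elements being identified with holomorphic functions on $B_d$ in the usual way. Let $P$ be the orthogonal projection from $L^2(\sigma_d)$ onto $H^2(B_d)$. For $m \in H^\infty(B_d)$, the co-analytic Toeplitz operator $T_{\bar m}^{H^2(B_d)} : H^2(B_d) \to H^2(B_d)$ is defined by $T_{\bar m}^{H^2(B_d)} h = P(\overline{m^\star}\, h)$. *)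

(* Defs.v *)
From HB Require Import structures.
From mathcomp Require Import all_boot all_order all_algebra.
From mathcomp Require Import all_classical all_reals all_analysis.
From mathcomp Require Import measurable_realfun complex.
From mathcomp Require mpoly.
Set Implicit Arguments.
Unset Strict Implicit.
Unset Printing Implicit Defensive.
Import Order.TTheory GRing.Theory Num.Theory.
Import numFieldNormedType.Exports.
Local Open Scope classical_set_scope.
Local Open Scope ring_scope.

(* The field R[i] with the topology of its modulus, as a normed space over
   itself; [differentiable] for maps between normed R[i]-modules is therefore
   complex (Frechet) differentiability. *)
HB.instance Definition _ (R : realType) := NormedModule.copy R[i] R[i]^o.

(* Borel sigma-algebra of R[i] = R x R. *)
Section complex_measurable.
Context {R : realType}.

Definition ReIm (z : R[i]) : R * R := (complex.Re z, complex.Im z).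
Definition of_ReIm (p : R * R) : R[i] := Complex p.1 p.2.

Definition complex_measurable : set (set R[i]) :=
  preimage_set_system setT ReIm measurable.

Lemma complex_sigma_algebra : sigma_algebra setT complex_measurable.
Proof. exact/sigma_algebra_preimage/sigma_algebra_measurable. Qed.

Lemma complex_measurable0 : complex_measurable set0.
Proof. by have [] := complex_sigma_algebra. Qed.

Lemma complex_measurableC A : complex_measurable A -> complex_measurable (~` A).
Proof. by rewrite -setTD; have [_ + _] := complex_sigma_algebra; apply. Qed.

Lemma complex_measurable_bigcup (F : (set R[i])^nat) :
  (forall i, complex_measurable (F i)) -> complex_measurable (\bigcup_i F i).
Proof. by have [_ _] := complex_sigma_algebra; apply. Qed.

HB.instance Definition _ := @isMeasurable.Build default_measure_display R[i]
  complex_measurable complex_measurable0 complex_measurableC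
  complex_measurable_bigcup.

Lemma measurable_ReIm : measurable_fun setT ReIm.
Proof. by move=> _ A mA; exists A. Qed.

Lemma measurable_of_ReIm : measurable_fun setT of_ReIm.
Proof.
move=> _ _ [B mB <-]; rewrite !setTI.
by rewrite [X in measurable X](_ : _ = B)//; apply/seteqP; split=> -[].
Qed.

Lemma measurable_Re : measurable_fun setT (@complex.Re R).
Proof. exact: (measurableT_comp measurable_fst measurable_ReIm). Qed.

Lemma measurable_Im : measurable_fun setT (@complex.Im R).
Proof. exact: (measurableT_comp measurable_snd measurable_ReIm). Qed.

End complex_measurable.

(* Borel (product) sigma-algebra of C^n, the analogue for row vectors of the
   library's sigma-algebra on tuples. *)
Section row_measurable.
Context {R : realType} (n : nat).

Definition row_coor (i : 'I_n) (z : 'rV[R[i]]_n) : R[i] := z ord0 i.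

HB.instance Definition _ := @isMeasurable.Build
  (measure_tuple_display default_measure_display) 'rV[R[i]]_n
  (g_sigma_preimage row_coor) (@sigma_algebra0 _ setT _)
  (@sigma_algebraC _ _) (@sigma_algebra_bigcup _ setT _).

Lemma measurable_row_coor i : measurable_fun setT (row_coor i).
Proof.
move=> _ Y mY; rewrite setTI; apply: sub_sigma_algebra => /=.
rewrite -bigcup_seq/=; exists i => /=; first by rewrite mem_index_enum.
by exists Y => //; rewrite setTI.
Qed.

Lemma measurable_row d (T : measurableType d) (f : T -> 'rV[R[i]]_n) :
  (forall i, measurable_fun setT (row_coor i \o f)) -> measurable_fun setT f.
Proof.
move=> mf _ A mA; rewrite setTI.
suff : (g_sigma_preimage row_coor) `<=` [set A | measurable (f @^-1` A)].
  exact.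
apply: smallest_sub.
  split=> [|B mB|F mF]; rewrite /=.
  - by rewrite preimage_set0.
  - by rewrite setTD preimage_setC; exact: measurableC.
  - by rewrite preimage_bigcup; exact: bigcupT_measurable.
move=> B; rewrite -bigcup_seq => -[i _ [C mC <-]] /=.
by rewrite setTI -comp_preimage -[X in measurable X]setTI; exact: mf.
Qed.

End row_measurable.

Lemma sigma_finite_pushforward d d' (T : measurableType d)
    (T' : measurableType d') (R : realType) (mu : set T -> \bar R)
    (f : T -> T') (g : T' -> T) :
  measurable_fun setT g -> cancel f g -> sigma_finite setT mu ->
  sigma_finite setT (pushforward mu f).
Proof.
move=> mg fK [F TF Foo].
exists (fun n => g @^-1` F n); first by rewrite -preimage_bigcup -TF.
move=> n; have [mF muF] := Foo n; split.
  by rewrite -[X in measurable X]setTI; exact: mg.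
rewrite /pushforward -comp_preimage (_ : g \o f = id)//.
by apply/funext => x /=; rewrite fK.
Qed.

Lemma sigma_finite_product d1 d2 (T1 : measurableType d1)
    (T2 : measurableType d2) (R : realType)
    (m1 : {sigma_finite_measure set T1 -> \bar R})
    (m2 : {sigma_finite_measure set T2 -> \bar R}) :
  sigma_finite setT (m1 \x m2)%E.
Proof.
have /sigma_finiteP[F [TF ndF Foo]] := sigma_finiteT m1.
have /sigma_finiteP[G [TG ndG Goo]] := sigma_finiteT m2.
exists (fun n => F n `*` G n).
  rewrite -setXTT TF TG predeqE => -[x y]; split.
    move=> [/= [n _ Fnx] [k _ Gky]]; exists (maxn n k) => //; split.
    - by move: x Fnx; exact/subsetPset/ndF/leq_maxl.
    - by move: y Gky; exact/subsetPset/ndG/leq_maxr.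
  by move=> [n _ []/= ? ?]; split; exists n.
move=> k; have [? ?] := Foo k; have [? ?] := Goo k.
split; first exact: measurableX.
by rewrite product_measure1E// lte_mul_pinfty// ge0_fin_numE.
Qed.

(* Lebesgue measure on C = R x R. *)
Section lebesgue_complex.
Context (R : realType).
Let T : measurableType _ := measurableTypeR R.

Lemma measurable_of_ReIm_TR : measurable_fun [set: T * T] (@of_ReIm R).
Proof. exact: measurable_of_ReIm. Qed.

Lemma measurable_ReIm_TR : measurable_fun setT (@ReIm R : R[i] -> T * T).
Proof. exact: measurable_ReIm. Qed.

Definition lebesgue_C : set R[i] -> \bar R :=
  pushforward (@lebesgue_measure R \x @lebesgue_measure R)%E (@of_ReIm R).

HB.instance Definition _ := Measure.copy lebesgue_C
  (measure_function_pushforward__canonical__measure_function_Measure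
     (@lebesgue_measure R \x @lebesgue_measure R)%E measurable_of_ReIm_TR).

Lemma sigma_finite_lebesgue_C : sigma_finite setT lebesgue_C.
Proof.
apply: (sigma_finite_pushforward measurable_ReIm_TR) => [[]//|].
exact: sigma_finite_product.
Qed.

HB.instance Definition _ := Measure_isSigmaFinite.Build _ _ _ lebesgue_C
  sigma_finite_lebesgue_C.

End lebesgue_complex.

(* Lebesgue measure on C^n, by identifying C^n.+1 with C x C^n. *)
Section lebesgue_Cn.
Context (R : realType).

Definition row_cons n (p : R[i] * 'rV[R[i]]_n) : 'rV[R[i]]_n.+1 :=
  \row_i oapp (p.2 ord0) p.1 (unlift ord0 i).

Definition row_uncons n (z : 'rV[R[i]]_n.+1) : R[i] * 'rV[R[i]]_n :=
  (z ord0 ord0, \row_i z ord0 (lift ord0 i)).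

Lemma row_consK n : cancel (@row_cons n) (@row_uncons n).
Proof.
case=> x v; rewrite /row_uncons /row_cons /= mxE unlift_none/=; congr pair.
by apply/rowP => i; rewrite !mxE liftK.
Qed.

Lemma measurable_row_cons n : measurable_fun setT (@row_cons n).
Proof.
apply: measurable_row => i.
case: (unliftP ord0 i) => [j|] ->.
- rewrite (_ : _ \o _ = row_coor j \o snd); last first.
    by apply/funext => p /=; rewrite /row_coor mxE liftK.
  exact: (measurableT_comp (measurable_row_coor j) measurable_snd).
- rewrite (_ : _ \o _ = fst)//.
  by apply/funext => p /=; rewrite /row_coor mxE unlift_none.
Qed.

Lemma measurable_row_uncons n : measurable_fun setT (@row_uncons n).
Proof.
apply/measurable_fun_pair; first exact: (measurable_row_coor ord0).
apply: measurable_row => i.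
rewrite (_ : _ \o _ = row_coor (lift ord0 i)); first exact: measurable_row_coor.
by apply/funext => z /=; rewrite /row_coor mxE.
Qed.

Section step.
Context n (mu : {sigma_finite_measure set 'rV[R[i]]_n -> \bar R}).

Definition lebesgue_CS : set 'rV[R[i]]_n.+1 -> \bar R :=
  pushforward (@lebesgue_C R \x mu)%E (@row_cons n).

HB.instance Definition _ := Measure.copy lebesgue_CS
  (measure_function_pushforward__canonical__measure_function_Measure
     (@lebesgue_C R \x mu)%E (@measurable_row_cons n)).

Lemma sigma_finite_lebesgue_CS : sigma_finite setT lebesgue_CS.
Proof.
apply: (sigma_finite_pushforward (@measurable_row_uncons n)).
  exact: row_consK.
exact: sigma_finite_product.
Qed.

HB.instance Definition _ := Measure_isSigmaFinite.Build _ _ _ lebesgue_CS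
  sigma_finite_lebesgue_CS.

End step.

Fixpoint lebesgue_Cn n : {sigma_finite_measure set 'rV[R[i]]_n -> \bar R} :=
  if n is n'.+1 return {sigma_finite_measure set 'rV[R[i]]_n -> \bar R}
  then lebesgue_CS (lebesgue_Cn n') else \d_(0 : 'rV[R[i]]_0).

End lebesgue_Cn.

Section ball_sphere.
Context {R : realType} (d : nat).
Implicit Types (z : 'rV[R[i]]_d).

(* Euclidean norm; the normed-module norm of 'rV is the sup norm. *)
Definition enorm z : R := Num.sqrt (\sum_i Normc.normc (z ord0 i) ^+ 2).

Definition unit_ball : set 'rV[R[i]]_d := [set z | enorm z < 1].

Definition unit_sphere : set 'rV[R[i]]_d := [set z | enorm z = 1].

(* Value 0 at 0. *)
Definition direction z : 'rV[R[i]]_d := ((enorm z)^-1)%:C%C *: z.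

Lemma measurable_sqrt : measurable_fun setT (@Num.sqrt R).
Proof. by apply: continuous_measurable_fun; exact: sqrt_continuous. Qed.

Lemma measurable_enorm : measurable_fun setT enorm.
Proof.
apply: (measurableT_comp measurable_sqrt).
apply: measurable_sum => i; apply: measurable_funX.
have mRe : measurable_fun setT (fun z => complex.Re (z ord0 i)).
  exact: (measurableT_comp measurable_Re (measurable_row_coor i)).
have mIm : measurable_fun setT (fun z => complex.Im (z ord0 i)).
  exact: (measurableT_comp measurable_Im (measurable_row_coor i)).
rewrite (_ : (fun _ => _) = (fun z => Num.sqrt (complex.Re (z ord0 i) ^+ 2
    + complex.Im (z ord0 i) ^+ 2))); last first.
  by apply/funext => z; case: (z ord0 i).
apply: (measurableT_comp measurable_sqrt).
by apply: measurable_funD; exact: measurable_funX.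
Qed.

Lemma measurable_unit_ball : measurable unit_ball.
Proof.
rewrite [X in measurable X](_ : _ = enorm @^-1` `]-oo, 1[).
  by rewrite -[X in measurable X]setTI; exact: measurable_enorm.
by apply/seteqP; split => z /=; rewrite in_itv.
Qed.

Lemma measurable_direction : measurable_fun setT direction.
Proof.
apply: measurable_row => i.
have mV : measurable_fun setT (fun z => (enorm z)^-1).
  rewrite (_ : (fun _ => _) = @powR R ^~ (-1) \o enorm); last first.
    by apply/funext => z /=; rewrite powR_inv1 ?sqrtr_ge0.
  exact: measurableT_comp (measurable_powR _) measurable_enorm.
have mRe : measurable_fun setT (fun z => complex.Re (z ord0 i)).
  exact: (measurableT_comp measurable_Re (measurable_row_coor i)).
have mIm : measurable_fun setT (fun z => complex.Im (z ord0 i)).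
  exact: (measurableT_comp measurable_Im (measurable_row_coor i)).
rewrite (_ : _ \o _ = of_ReIm \o
    (fun z => ((enorm z)^-1 * complex.Re (z ord0 i),
               (enorm z)^-1 * complex.Im (z ord0 i)))); last first.
  apply/funext => z /=; rewrite /row_coor mxE /of_ReIm /=.
  by case: (z ord0 i) => x y /=; congr Complex; rewrite mul0r ?subr0 ?addr0.
apply: (measurableT_comp measurable_of_ReIm).
by apply/measurable_fun_pair; exact: measurable_funM.
Qed.

(* Normalized Lebesgue measure on the unit sphere S_d, as a measure on C^d
   carried by S_d: sigma_d(A) is the proportion of the unit ball occupied by the
   cone {z | z / |z| \in A}. *)
Definition sphere_measure (A : set 'rV[R[i]]_d) : \bar R :=
  ((fine (lebesgue_Cn R d unit_ball))^-1%:E *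
   lebesgue_Cn R d (direction @^-1` A `&` unit_ball))%E.

Lemma fine_lebesgue_ball_ge0 : 0 <= (fine (lebesgue_Cn R d unit_ball))^-1.
Proof. by rewrite invr_ge0 fine_ge0. Qed.

HB.instance Definition _ := Measure.copy sphere_measure
  (mscale (NngNum fine_lebesgue_ball_ge0)
     (measure_function_pushforward__canonical__measure_function_Measure
        (mrestr (lebesgue_Cn R d) measurable_unit_ball) measurable_direction)).

End ball_sphere.
Arguments unit_ball {R d}.
Arguments unit_sphere {R d}.

Section hardy_space.
Context {R : realType} {d : nat}.
Local Notation C := R[i].
Local Notation Cd := 'rV[R[i]]_d.
Local Notation sigma := (@sphere_measure R d).
Implicit Types (F m : Cd -> C) (u v g h ms : Cd -> C).

(* Functions on S_d (resp. B_d) are total functions on C^d whose values outside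
   S_d (resp. B_d) are irrelevant; elements of L^2(sigma_d) are represented by
   functions, with no quotient by almost everywhere equality. *)
Definition L2_inner u v : C :=
  let w z := u z * conjc (v z) in
  Complex (\int[sigma]_(z in unit_sphere) complex.Re (w z))
          (\int[sigma]_(z in unit_sphere) complex.Im (w z)).

Definition L2_sqnorm u : \bar R :=
  (\int[sigma]_(z in unit_sphere) (Normc.normc (u z) ^+ 2)%:E)%E.

Definition L2 u : Prop :=
  measurable_fun unit_sphere u /\ (L2_sqnorm u < +oo)%E.

Definition H2 h : Prop :=
  L2 h /\ forall e : R, 0 < e ->
    exists p : mpoly.mpoly d C,
      (L2_sqnorm (fun z => h z - mpoly.meval (z ord0) p)%R < e%:E)%E.

(* h = P u *)
Definition H2_projection u h : Prop :=
  H2 h /\ forall v, H2 v -> L2_inner (u \- h) v = 0.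

Definition holomorphic_on_ball F : Prop :=
  forall z, unit_ball z -> differentiable F z.

Definition Hinfty m : Prop :=
  holomorphic_on_ball m /\
  exists M : R, forall z, unit_ball z -> Normc.normc (m z) <= M.

(* ms is (a version of) the boundary function of m. *)
Definition boundary_function m ms : Prop :=
  measurable_fun unit_sphere ms /\
  {ae sigma, forall z, unit_sphere z ->
    m (r%:C%C *: z) @[r --> (1 : R)^'-] --> ms z}.

(* F on the ball is the holomorphic function identified with h in H^2, a subspace
   of L^2(sigma_d): the dilates F(r .) converge to h in L^2 as r -> 1. *)
Definition H2_holomorphic F h : Prop :=
  [/\ holomorphic_on_ball F, H2 h &
    L2_sqnorm (fun z => F (r%:C%C *: z) - h z) @[r --> (1 : R)^'-] --> 0%E].

(* h = T g, for the co-analytic Toeplitz operator T whose symbol is the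
   conjugate of a bounded analytic function with boundary function ms. *)
Definition coanalytic_toeplitz ms g h : Prop :=
  H2 g /\ H2_projection (fun z => conjc (ms z) * g z) h.

Definition in_toeplitz_range ms F : Prop :=
  exists g h, coanalytic_toeplitz ms g h /\ H2_holomorphic F h.

End hardy_space.

(* Main.v *)
Require Import Defs.
From HB Require Import structures.
From mathcomp Require Import all_boot all_order all_algebra.
From mathcomp Require Import all_classical all_reals all_analysis.
From mathcomp Require Import complex measurable_realfun.
From mathcomp Require Import -(notations) mpoly.
From mathcomp Require cyclic separable.
From mathcomp Require Import ring lra zify.
Set Implicit Arguments.
Unset Strict Implicit.
Unset Printing Implicit Defensive.
Import Order.TTheory GRing.Theory Num.Theory.
Import numFieldNormedType.Exports.
Local Open Scope classical_set_scope.
Local Open Scope ring_scope.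

(*@@P1@@*)
Notation normc := Normc.normc.

Section modulus.
Context {R : realType}.
Implicit Types (x y z : R[i]).

Lemma normc_norm z : `|z| = (normc z)%:C%C. Proof. by []. Qed.

Lemma normc_ge0 z : 0 <= normc z.
Proof. by case: z => a b; exact: sqrtr_ge0. Qed.

Lemma normcM x y : normc (x * y) = normc x * normc y.
Proof. exact: Normc.normcM. Qed.

Lemma normcV x : normc x^-1 = (normc x)^-1.
Proof. exact: Normc.normcV. Qed.

Lemma normc1 : normc (1 : R[i]) = 1. Proof. exact: Normc.normc1. Qed.

Lemma normc0 : normc (0 : R[i]) = 0. Proof. exact: Normc.normc0. Qed.

Lemma normcX x n : normc (x ^+ n) = normc x ^+ n.
Proof. by elim: n => [|n ih]; rewrite ?expr0 ?normc1// !exprS normcM ih. Qed.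

Lemma normcN x : normc (- x) = normc x. Proof. exact: normcN. Qed.

Lemma ler_normcD x y : normc (x + y) <= normc x + normc y.
Proof. exact: le_normcD. Qed.

Lemma ler_normcB x y : normc (x - y) <= normc x + normc y.
Proof. by rewrite -(normcN y) ler_normcD. Qed.

Lemma normc_distC x y : normc (x - y) = normc (y - x).
Proof. by rewrite -normcN opprB. Qed.

Lemma ler_dist_normc x y : normc x - normc y <= normc (x - y).
Proof. by rewrite lerBlDr (le_trans _ (ler_normcD _ _))// subrK. Qed.

Lemma ler_dist_dist_normc x y : `|normc x - normc y| <= normc (x - y).
Proof.
by rewrite ler_norml ler_dist_normc lerNl opprB normc_distC ler_dist_normc.
Qed.

Lemma ler_normc_sum I (r : seq I) (P : pred I) (F : I -> R[i]) :
  normc (\sum_(i <- r | P i) F i) <= \sum_(i <- r | P i) normc (F i).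
Proof.
elim/big_ind2 : _ => [|x1 x2 y1 y2 h1 h2|//]; first by rewrite normc0.
by rewrite (le_trans (ler_normcD _ _))// lerD.
Qed.

Lemma normc_eq0 z : (normc z == 0) = (z == 0).
Proof.
by apply/eqP/eqP => [/Normc.eq0_normc//|->]; rewrite normc0.
Qed.

Lemma normc_gt0 z : (0 < normc z) = (z != 0).
Proof. by rewrite lt_neqAle normc_ge0 andbT eq_sym normc_eq0. Qed.

Lemma normc_real (a : R) : normc a%:C%C = `|a|.
Proof. by rewrite /= expr0n addr0 sqrtr_sqr. Qed.

Lemma normc_nat n : normc (n%:R : R[i]) = n%:R.
Proof.
by rewrite (_ : n%:R = (n%:R)%:C%C) ?normc_real ?normr_nat// rmorph_nat.
Qed.

Lemma normcJ z : normc (conjc z) = normc z.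
Proof. by case: z => a b /=; rewrite sqrrN. Qed.

Lemma sqr_normc z : normc z ^+ 2 = complex.Re z ^+ 2 + complex.Im z ^+ 2.
Proof. by case: z => a b /=; rewrite sqr_sqrtr// addr_ge0 ?sqr_ge0. Qed.

Lemma ler_Re_normc z : `|complex.Re z| <= normc z.
Proof.
rewrite -(@ler_pXn2r _ 2)// ?nnegrE ?normc_ge0//.
by rewrite sqr_normc real_normK ?num_real// lerDl sqr_ge0.
Qed.

Lemma ler_Im_normc z : `|complex.Im z| <= normc z.
Proof.
rewrite -(@ler_pXn2r _ 2)// ?nnegrE ?normc_ge0//.
by rewrite sqr_normc real_normK ?num_real// lerDr sqr_ge0.
Qed.

Lemma ler_normc_ReIm z : normc z <= `|complex.Re z| + `|complex.Im z|.
Proof.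
rewrite -(@ler_pXn2r _ 2)// ?nnegrE ?normc_ge0// ?addr_ge0//.
rewrite sqr_normc sqrrD !real_normK ?num_real//.
by rewrite -addrA lerD2l lerDr mulrn_wge0// mulr_ge0.
Qed.

Lemma ReD x y : complex.Re (x + y) = complex.Re x + complex.Re y.
Proof. by case: x y => [a b] [c d]. Qed.

Lemma ReB x y : complex.Re (x - y) = complex.Re x - complex.Re y.
Proof. by case: x y => [a b] [c d]. Qed.

Lemma ImD x y : complex.Im (x + y) = complex.Im x + complex.Im y.
Proof. by case: x y => [a b] [c d]. Qed.

Lemma ImB x y : complex.Im (x - y) = complex.Im x - complex.Im y.
Proof. by case: x y => [a b] [c d]. Qed.

Lemma Re_sum I (r : seq I) (P : pred I) (F : I -> R[i]) :
  complex.Re (\sum_(i <- r | P i) F i) = \sum_(i <- r | P i) complex.Re (F i).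
Proof. by apply: (big_morph _ ReD). Qed.

Lemma ReZ (a : R) z : complex.Re (a%:C%C * z) = a * complex.Re z.
Proof. by case: z => c d /=; rewrite mul0r subr0. Qed.

Lemma ImZ (a : R) z : complex.Im (a%:C%C * z) = a * complex.Im z.
Proof. by case: z => c d /=; rewrite mul0r addr0. Qed.

Lemma Re_mulJ x y : complex.Re (x * conjc y) =
  complex.Re x * complex.Re y + complex.Im x * complex.Im y.
Proof. by case: x y => [a b] [c d] /=; ring. Qed.

Lemma mulcJ x : x * conjc x = ((normc x) ^+ 2)%:C%C.
Proof.
apply/eqP; rewrite eq_complex sqr_normc; case: x => a b /=.
by apply/andP; split; apply/eqP; ring.
Qed.

Lemma normc1V z : normc z = 1 -> z^-1 = conjc z.
Proof.
move=> z1; have z0 : z != 0 by rewrite -normc_gt0 z1.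
apply: (mulfI z0); rewrite divff// mulcJ z1 expr1n//.
Qed.

Lemma sqr_normcD x y :
  normc (x + y) ^+ 2 = normc x ^+ 2 + 2 * complex.Re (x * conjc y) + normc y ^+ 2.
Proof. by rewrite !sqr_normc ReD ImD Re_mulJ; ring. Qed.

End modulus.

Section unity_roots.
Context {R : realType}.
Local Notation C := R[i].

Lemma prim_root_exists n : (0 < n)%N -> {w : C | n.-primitive_root w}.
Proof.
move=> n0; have n0C : n%:R != 0 :> C by rewrite pnatr_eq0 -lt0n.
pose p : {poly C} := 'X^n - 1.
have [r Dp] := closed_field_poly_normal p.
have sz_p : size p = n.+1 by rewrite size_XnsubC.
have mon_p : p \is monic by rewrite monicXnsubC.
rewrite (monicP mon_p) scale1r in Dp.
apply: sigW; have : has n.-primitive_root r; last first.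
  by case/hasP => z _ hz; exists z.
apply: (@cyclic.has_prim_root _ n r) => //; last first.
- by rewrite -ltnS -sz_p Dp size_prod_XsubC.
- rewrite -separable.separable_prod_XsubC -Dp separable.separable_poly.unlock derivB derivXn derivC subr0.
  rewrite /p -scaler_nat coprimepZr//.
  case: n {n0C p r Dp sz_p mon_p} n0 => // n _.
  rewrite /= exprS; apply/coprimepP => d.
  move=> dvd1 dvd2; have : d %| 1.
    have -> : (1 : {poly C}) = 'X * 'X^n - ('X * 'X^n - 1) by rewrite opprB addrC subrK.
    by rewrite dvdp_sub// dvdp_mull.
  by rewrite dvdp1 => sd; rewrite -size_poly_eq1.
- by apply/allP => z; rewrite unity_rootE -root_prod_XsubC -Dp rootE !hornerE subr_eq0.
Qed.

Lemma normc_unity n (z : C) : (0 < n)%N -> z ^+ n = 1 -> normc z = 1.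
Proof.
move=> n0 /(congr1 (fun z => normc z)); rewrite normcX normc1 => /eqP.
by rewrite pexpr_eq1 ?normc_ge0// => /eqP.
Qed.

Lemma normc_prim_root n (w : C) : n.-primitive_root w -> normc w = 1.
Proof.
by move=> pw; exact: normc_unity (prim_order_gt0 pw) (prim_expr_order pw).
Qed.

Lemma normc_prim_rootX n (w : C) k : n.-primitive_root w -> normc (w ^+ k) = 1.
Proof. by move=> pw; rewrite normcX (normc_prim_root pw) expr1n. Qed.

Lemma sum_prim_root n (w : C) k : n.-primitive_root w ->
  \sum_(j < n) (w ^+ j) ^+ k = if (n %| k)%N then n%:R else 0.
Proof.
move=> pw; case: ifPn => nk.
  rewrite (eq_bigr (fun=> 1)) ?sumr_const ?card_ord// => j _.
  rewrite exprAC -(divnK nk) mulnC exprM (prim_expr_order pw) !expr1n//.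
have wk1 : w ^+ k != 1 by rewrite -(prim_order_dvd pw).
apply: (mulfI (_ : w ^+ k - 1 != 0)); first by rewrite subr_eq0.
rewrite mulr0; under eq_bigr do rewrite exprAC.
by rewrite -subrX1 exprAC (prim_expr_order pw) expr1n subrr.
Qed.

End unity_roots.

(*@@P1b@@*)
Section circle_polynomials.
Context {R : realType}.
Local Notation C := R[i].
Implicit Types (P Q : {poly C}) (z w : C) (M : R).

Lemma horner_prim_root_mean P n w k (s : C) : n.-primitive_root w ->
  (size P <= n)%N -> (k < n)%N ->
  \sum_(j < n) P.[s * w ^+ j] * (w ^+ j) ^- k = n%:R * (P`_k * s ^+ k).
Proof.
move=> pw sP kn; have w0 : w != 0 by rewrite -normc_gt0 (normc_prim_root pw).
under eq_bigr => j _ do rewrite (horner_coef_wide _ sP) mulr_suml.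
rewrite exchange_big/= (bigD1 (Ordinal kn))//= [X in _ + X]big1 ?addr0.
  rewrite (eq_bigr (fun=> P`_k * s ^+ k)) ?sumr_const ?card_ord ?mulr_natl//.
  by move=> j _; rewrite exprMn mulrA mulfK// !expf_neq0.
move=> i ik; have {}ik : nat_of_ord i != k by [].
rewrite (eq_bigr (fun j : 'I_n => P`_i * s ^+ i * (w ^+ j) ^+ (i + (n - k)))).
  rewrite -mulr_sumr (sum_prim_root _ pw) ifN ?mulr0//.
  apply: contra ik => /dvdnP[q hq]; apply/eqP; have := ltn_ord i.
  by case: q hq => [|[|q]]; nia.
move=> j _; rewrite exprMn -!mulrA; congr (_ * (_ * _)).
rewrite exprD; congr (_ * _); apply/eqP.
by rewrite eq_sym -(inj_eq (mulIf (_ : (w ^+ j) ^+ k != 0))) ?expf_neq0//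
  -exprD subnK 1?ltnW// mulVf ?expf_neq0// exprAC (prim_expr_order pw) expr1n.
Qed.

Lemma cauchy_poly P M k : (forall z, normc z = 1 -> normc P.[z] <= M) ->
  normc P`_k <= M.
Proof.
move=> PM; pose n := (maxn (size P) k.+1).
have n0 : (0 < n)%N by rewrite leq_max orbT.
have [w pw] := @prim_root_exists R n n0.
have := @horner_prim_root_mean P n w k 1 pw (leq_maxl _ _) (leq_maxr _ _).
rewrite expr1n mulr1 => /(congr1 (fun z => normc z)); rewrite normcM normc_nat => h.
rewrite -(@ler_pM2l _ n%:R) ?ltr0n// -h.
rewrite (le_trans (ler_normc_sum _ _ _))//.
rewrite mulr_natl -[X in _ *+ X](card_ord n) -sumr_const ler_sum// => j _.
rewrite normcM normcV !normcX (normc_prim_root pw) !expr1n invr1 mulr1.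
by rewrite mul1r PM// (normc_prim_rootX _ pw).
Qed.

Lemma sum_geometric_le (x : R) n : 0 <= x -> x < 1 ->
  \sum_(i < n) x ^+ i <= (1 - x)^-1.
Proof.
move=> x0 x1; rewrite -[leRHS]mul1r ler_pdivlMr ?subr_gt0// mulrC.
by rewrite -opprB mulNr -subrX1 opprB lerBlDr lerDl exprn_ge0.
Qed.

Lemma poly_disc_bound P M z : (forall z, normc z = 1 -> normc P.[z] <= M) ->
  normc z < 1 -> normc P.[z] <= M / (1 - normc z).
Proof.
move=> PM z1; have M0 : 0 <= M by rewrite (le_trans _ (PM 1 normc1))// normc_ge0.
rewrite horner_coef (le_trans (ler_normc_sum _ _ _))//.
apply: (@le_trans _ _ (\sum_(i < size P) M * normc z ^+ i)).
  apply: ler_sum => i _; rewrite normcM normcX ler_wpM2r ?exprn_ge0 ?normc_ge0//.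
  exact: cauchy_poly.
by rewrite -mulr_sumr ler_wpM2l// sum_geometric_le// normc_ge0.
Qed.

Lemma poly_bounded P : exists2 B : R, 0 <= B &
  forall z, normc z <= 1 -> normc P.[z] <= B.
Proof.
exists (\sum_(i < size P) normc P`_i); first by rewrite sumr_ge0// => i _; exact: normc_ge0.
move=> z z1; rewrite horner_coef (le_trans (ler_normc_sum _ _ _))//.
apply: ler_sum => i _; rewrite normcM normcX ler_piMr ?normc_ge0//.
by rewrite exprn_ile1 ?normc_ge0.
Qed.

Lemma poly_lipschitz P : exists2 L : R, 0 <= L &
  forall z w, normc z <= 1 -> normc w <= 1 -> normc (P.[z] - P.[w]) <= L * normc (z - w).
Proof.
elim/poly_ind: P => [|P c [L L0 ih]].
  by exists 0 => // z w _ _; rewrite !horner0 subrr normc0 mul0r.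
have [B B0 PB] := poly_bounded P.
exists (L + B); first exact: addr_ge0.
move=> z w z1 w1; rewrite !hornerE.
have -> : P.[z] * z + c - (P.[w] * w + c) = (P.[z] - P.[w]) * z + P.[w] * (z - w) by ring.
rewrite (le_trans (ler_normcD _ _))// !normcM mulrDl lerD//.
  by rewrite (le_trans _ (ih _ _ z1 w1))// ler_piMr// normc_ge0.
by rewrite ler_wpM2r ?normc_ge0// PB.
Qed.

End circle_polynomials.

(*@@P1c@@*)
Section fejer.
Context {R : realType}.
Local Notation C := R[i].

Definition fejer (n : nat) : {poly C} :=
  n%:R^-1 *: \sum_(m < n) (1 + 2 *: \sum_(k < m) 'X^(k.+1)).

Lemma horner_fejer n z : (fejer n).[z] =
  n%:R^-1 * \sum_(m < n) (1 + 2 * \sum_(k < m) z ^+ k.+1).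
Proof.
rewrite hornerZ horner_sum; congr (_ * _); apply: eq_bigr => m _.
rewrite !hornerE horner_sum; congr (_ + _ * _).
by apply: eq_bigr => k _; rewrite hornerXn.
Qed.

Lemma Re_fejer n z : normc z = 1 ->
  complex.Re (fejer n).[z] = n%:R^-1 * normc (\sum_(k < n) z ^+ k) ^+ 2.
Proof.
move=> z1; rewrite horner_fejer -[n%:R^-1]/(n%:R^-1).
have -> : (n%:R : C)^-1 = (n%:R^-1)%:C%C by rewrite fmorphV rmorph_nat.
rewrite [LHS]ReZ Re_sum; congr (_ * _).
elim: n => [|n ih]; first by rewrite !big_ord0 normc0 expr0n.
rewrite big_ord_recr/= ih [in RHS]big_ord_recr/= sqr_normcD normcX z1 !expr1n.
rewrite ReD [complex.Re 1 + _]addrC addrA; congr (_ + _ + _).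
have -> : (2 : C) = (2 : R)%:C%C by rewrite rmorph_nat.
rewrite ReZ; congr (_ * _).
rewrite Re_sum mulr_suml Re_sum [RHS](reindex_inj rev_ord_inj)/=.
apply: eq_bigr => k _; rewrite Re_mulJ.
have kn := ltn_ord k.
have -> : z ^+ n = z ^+ (n - k.+1) * z ^+ k.+1 by rewrite -exprD subnK.
have : normc (z ^+ (n - k.+1)) ^+ 2 = 1 by rewrite normcX z1 !expr1n.
rewrite sqr_normc; case: (z ^+ (n - k.+1)) (z ^+ k.+1) => [a b] [c d] /= h.
by rewrite -[c in LHS]mul1r -h; ring.
Qed.

Lemma Re_fejer_ge0 n z : normc z = 1 -> 0 <= complex.Re (fejer n).[z].
Proof. by move=> z1; rewrite Re_fejer// mulr_ge0// ?invr_ge0// sqr_ge0. Qed.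

Lemma Re_fejer_far n z : (0 < n)%N -> normc z = 1 -> 
  complex.Re (fejer n).[z] * normc (1 - z) ^+ 2 <= 4 / n%:R.
Proof.
move=> n0 z1; rewrite Re_fejer// -mulrA -exprMn -normcM mulrC.
rewrite [_ * (1 - z)]mulrC -opprB mulNr -subrX1 opprB.
rewrite ler_wpM2r ?invr_ge0//; have : normc (1 - z ^+ n) <= 2.
  by rewrite (le_trans (ler_normcB _ _))// normcX z1 expr1n normc1.
by have := normc_ge0 (1 - z ^+ n); nra.
Qed.

Lemma fejer_disc_bound n z : normc z < 1 ->
  normc (fejer n).[z] <= (1 + normc z) / (1 - normc z).
Proof.
move=> z1; have [->|n0] := posnP n.
  rewrite horner_fejer big_ord0 mulr0 normc0 divr_ge0//.
    by rewrite addr_ge0// normc_ge0.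
  by rewrite subr_ge0 ltW.
rewrite horner_fejer normcM normcV normc_nat mulrC ler_pdivrMr ?ltr0n//.
rewrite (le_trans (ler_normc_sum _ _ _))// mulr_natr.
rewrite (_ : _ *+ n = \sum_(m < n) (1 + normc z) / (1 - normc z)); last first.
  by rewrite sumr_const card_ord.
apply: ler_sum => m _; rewrite (le_trans (ler_normcD _ _))// normc1 normcM normc_nat.
have -> : (1 + normc z) / (1 - normc z) = 1 + 2 * (normc z * (1 - normc z)^-1).
  by field; rewrite subr_eq0 gt_eqF.
rewrite lerD2l ler_wpM2l// (le_trans (ler_normc_sum _ _ _))//.
under eq_bigr do rewrite normcX exprS.
by rewrite -mulr_sumr ler_wpM2l ?normc_ge0// sum_geometric_le ?normc_ge0.
Qed.

Lemma fejer_mean n w z : n.-primitive_root w ->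
  \sum_(j < n) (fejer n).[z * w ^- j] = n%:R.
Proof.
move=> pw; have n0 := prim_order_gt0 pw.
have n0C : (n%:R : C) != 0 by rewrite pnatr_eq0 -lt0n.
under eq_bigr do rewrite horner_fejer.
rewrite -mulr_sumr exchange_big/=.
apply: (mulfI n0C); rewrite mulVKf//.
rewrite (eq_bigr (fun=> n%:R)) ?sumr_const ?card_ord ?mulr_natl// => m _.
rewrite big_split/= sumr_const card_ord -mulr_sumr exchange_big/= big1 ?mulr0 ?addr0// => k _.
have pv : n.-primitive_root w^-1.
  have [u pu] := @prim_root_exists R n n0.
  apply/andP; split => //; apply/forallP => i.
  by rewrite unity_rootE exprVn invr_eq1 -unity_rootE; have /andP[_ /forallP] := pw.
under eq_bigr do rewrite exprMn -exprVn.
rewrite -mulr_sumr (sum_prim_root _ pv) ifN ?mulr0//.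
by rewrite gtnNdvd// (leq_ltn_trans (ltn_ord k)).
Qed.

Lemma fejer_approx (f : C -> R) (B L eta : R) :
  (forall z, normc z = 1 -> 0 <= f z <= B) -> 0 <= L ->
  (forall z w, normc z = 1 -> normc w = 1 -> `|f z - f w| <= L * normc (z - w)) ->
  0 < eta -> exists V : {poly C}, exists K : R,
  [/\ 0 <= K, V.[0] = K%:C%C,
     forall z, normc z = 1 -> `|complex.Re V.[z] - f z| <= eta &
     forall z, normc z < 1 -> normc V.[z] <= K * ((1 + normc z) / (1 - normc z))].
Proof.
move=> f0B L0 fL eta0.
have B0 : 0 <= B by have /andP[] := f0B 1 normc1; exact: le_trans.
pose tau := eta / (2 * (L + 1)).
have tau0 : 0 < tau by rewrite divr_gt0// mulr_gt0// ltr_wpDl.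
pose N := (Num.bound (8 * B / (tau ^+ 2 * eta))).+1.
have hN : 8 * B / (tau ^+ 2 * eta) <= N%:R.
  have X0 : 0 <= 8 * B / (tau ^+ 2 * eta).
    by apply: divr_ge0; apply: mulr_ge0; rewrite ?sqr_ge0//; exact: ltW.
  by rewrite ltW// (lt_le_trans (archi_boundP X0))// ler_nat leqnSn.
have [w pw] := @prim_root_exists R N isT.
have N0 : 0 < N%:R :> R by rewrite ltr0n.
have NC : (N%:R : C)^-1 = (N%:R^-1)%:C%C by rewrite fmorphV rmorph_nat.
have w1 j : normc (w ^+ j) = 1 by rewrite (normc_prim_rootX _ pw).
pose V : {poly C} := N%:R^-1 *: \sum_(j < N) (f (w ^+ j))%:C%C *:
   (fejer N \Po (w ^- j *: 'X)).
have hV z : V.[z] = (N%:R^-1)%:C%C * \sum_(j < N) (f (w ^+ j))%:C%C * (fejer N).[z * w ^- j].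
  rewrite hornerZ horner_sum NC; congr (_ * _); apply: eq_bigr => j _.
  by rewrite hornerZ horner_comp !hornerE [_^-1 * z]mulrC.
exists V, (N%:R^-1 * \sum_(j < N) f (w ^+ j)); split.
- by rewrite mulr_ge0// ?invr_ge0// sumr_ge0// => j _; have /andP[] := f0B _ (w1 j).
- rewrite hV rmorphM/= rmorph_sum/=; congr (_ * _); apply: eq_bigr => j _.
  rewrite mul0r horner_fejer -[RHS]mulr1; congr (_ * _).
  under eq_bigr => m _ do (rewrite big1 ?mulr0 ?addr0; last by move=> k _; rewrite expr0n).
  by rewrite sumr_const card_ord mulVf// pnatr_eq0.
- move=> z z1; rewrite hV ReZ Re_sum.
  pose F j := complex.Re (fejer N).[z * w ^- j].
  have zw j : normc (z * w ^- j) = 1 by rewrite normcM normcV w1 z1 invr1 mulr1.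
  have sF : \sum_(j < N) F j = N%:R.
    by rewrite /F -Re_sum (fejer_mean _ pw) -(rmorph_nat (@real_complex R)).
  have F0 j : 0 <= F j by exact: Re_fejer_ge0.
  have -> : f z = N%:R^-1 * \sum_(j < N) f z * F j.
    by rewrite -mulr_sumr sF mulrC mulfK// gt_eqF.
  rewrite -mulrBr -sumrB normrM ger0_norm ?invr_ge0// mulrC ler_pdivrMr//.
  rewrite (le_trans (ler_norm_sum _ _ _))//.
  have -> : eta * N%:R = \sum_(j < N) (eta / 2 * F j + eta / 2).
    by rewrite big_split/= -mulr_sumr sF sumr_const card_ord -mulr_natr; field.
  apply: ler_sum => j _; rewrite ReZ -mulrBl normrM [X in _ * X <= _]ger0_norm//.
  have [near|far] := leP (normc (z - w ^+ j)) tau.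
    apply: (@le_trans _ _ (eta / 2 * F j)); last by rewrite lerDl divr_ge0// ltW.
    rewrite (ler_wpM2r (F0 j))// distrC (le_trans (fL _ _ z1 (w1 j)))//.
    rewrite (le_trans (ler_wpM2l L0 near))// /tau.
    have L1 : 0 < L + 1 by rewrite ltr_wpDl.
    by rewrite mulrA ler_pdivrMr ?mulr_gt0//; nra.
  apply: (@le_trans _ _ (eta / 2)); last by rewrite lerDr mulr_ge0// divr_ge0// ltW.
  have FF : F j * tau ^+ 2 <= 4 / N%:R.
    rewrite (le_trans _ (Re_fejer_far (ltn0Sn _) (zw j)))//.
    rewrite (ler_wpM2l (F0 j))// ler_pXn2r ?nnegrE ?normc_ge0 ?(ltW tau0)//.
    rewrite ltW// (lt_le_trans far)// -[X in _ <= X]mul1r -[X in _ <= X * _](w1 j) -normcM.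
    rewrite mulrBr mulr1 mulrCA divff ?mulr1 1?normc_distC//.
    by rewrite -normc_gt0 w1.
  apply: (@le_trans _ _ (B * F j)).
    rewrite (ler_wpM2r (F0 j))//.
    have /andP[? ?] := f0B _ z1; have /andP[? ?] := f0B _ (w1 j).
    by rewrite ler_norml; apply/andP; split; lra.
  rewrite -(@ler_pM2r _ (tau ^+ 2)) ?exprn_gt0// -mulrA.
  rewrite (le_trans (ler_wpM2l B0 FF))//.
  have te0 : 0 < tau ^+ 2 * eta by rewrite mulr_gt0// exprn_gt0.
  move: hN; rewrite (ler_pdivrMr _ _ te0) => hN.
  by rewrite mulrA ler_pdivrMr//; nra.
  exact: F0.
- move=> z z1; rewrite hV normcM normc_real ger0_norm ?invr_ge0// -mulrA ler_wpM2l ?invr_ge0//.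
  rewrite (le_trans (ler_normc_sum _ _ _))// mulr_suml ler_sum// => j _.
  have /andP[fj0 _] := f0B _ (w1 j).
  rewrite normcM normc_real ger0_norm// ler_wpM2l//.
  have zw : normc (z * w ^- j) = normc z by rewrite normcM normcV w1 invr1 mulr1.
  by rewrite -zw; apply: fejer_disc_bound; rewrite zw.
Qed.
End fejer.

(*@@P1d@@*)
Section log_integral.
Context {R : realType}.
Local Notation C := R[i].

Lemma ler_dist_ln (d x y : R) : 0 < d -> d <= x -> d <= y ->
  `|ln x - ln y| <= d^-1 * `|x - y|.
Proof.
move=> d0.
wlog xy : x y / y <= x.
  move=> h dx dy; have [/h|/ltW/h] := leP y x; first exact.
  by rewrite distrC [X in _ <= _ * X]distrC; exact.
move=> dx dy; have y0 : 0 < y by exact: lt_le_trans dy.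
have x0 : 0 < x by exact: lt_le_trans dx.
rewrite ger0_norm; last by rewrite subr_ge0 ler_ln.
rewrite ger0_norm ?subr_ge0// -ln_div ?posrE//.
rewrite (_ : x / y = 1 + (x - y) / y); last by field; rewrite gt_eqF.
rewrite (le_trans (le_ln1Dx _))//.
  by rewrite (@lt_le_trans _ _ 0)// divr_ge0 ?subr_ge0// ltW.
by rewrite mulrC ler_wpM2r ?subr_ge0// lef_pV2.
Qed.

Lemma ler_dist_max (x y d : R) : `|Num.max x d - Num.max y d| <= `|x - y|.
Proof.
rewrite !maxEle; case: ifPn => h1; case: ifPn => h2.
- by rewrite subrr normr0.
- rewrite -ltNge in h2. rewrite distrC [leRHS]distrC !ger0_norm; lra.
- rewrite -ltNge in h1. rewrite !ger0_norm; lra.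
- by [].
Qed.

Lemma normc_exp_le (V : C) (n : nat) (s : R) : normc V ^+ 2 <= n.+1%:R ->
  s ^+ 2 = 1 ->
  normc (1 + (s / n.+1%:R)%:C%C * V) ^+ n.+1 <= expR (s * complex.Re V + 2^-1).
Proof.
move=> Vn s1; have n0 : 0 < n.+1%:R :> R by rewrite ltr0n.
have Vn' : normc V ^+ 2 / n.+1%:R <= 1 by rewrite ler_pdivrMr// mul1r.
rewrite -(@ler_pXn2r _ 2)// ?nnegrE ?exprn_ge0 ?normc_ge0 ?expR_ge0//.
rewrite exprAC -(@expRM_natl _ 2).
apply: (@le_trans _ _ (expR (n.+1%:R * (2 * (s / n.+1%:R) * complex.Re V
    + (s / n.+1%:R) ^+ 2 * normc V ^+ 2)))).
  rewrite expRM_natl ler_pXn2r// ?nnegrE ?exprn_ge0 ?normc_ge0 ?expR_ge0//.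
  rewrite (le_trans _ (expR_ge1Dx _))// addrC sqr_normcD normc1 expr1n.
  rewrite conjc1 mulr1 ReZ normcM normc_real exprMn real_normK ?num_real//.
  by rewrite le_eqVlt; apply/orP; left; apply/eqP; ring.
rewrite ler_expR.
have -> : n.+1%:R * (2 * (s / n.+1%:R) * complex.Re V + (s / n.+1%:R) ^+ 2 * normc V ^+ 2)
   = 2 * s * complex.Re V + s ^+ 2 * (normc V ^+ 2 / n.+1%:R).
  by field; rewrite gt_eqF.
by rewrite s1 mul1r mulrDr mulrA divff ?lerD2l// pnatr_eq0.
Qed.

Lemma expR_half_le (x : R) : 0 <= x <= 1 -> expR (x / 2) <= 1 + x.
Proof.
move=> /andP[x0 x1]; have := expR_ge1Dx (- (x / 2)).
have := expR_gt0 (x / 2); set e := expR (x / 2) => e0.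
rewrite expRN -/e => h.
have : (1 - x / 2) * e <= 1 by rewrite -ler_pdivlMr// mul1r.
nra.
Qed.

Lemma expR_N2_le (x : R) : 0 <= x <= 2^-1 -> expR (- (2 * x)) <= 1 - x.
Proof.
move=> /andP[x0 x1]; rewrite expRN -[leRHS]invrK lef_pV2 ?posrE ?expR_gt0//; last first.
  by rewrite invr_gt0; lra.
rewrite (le_trans _ (expR_ge1Dx _))// -[leLHS]mul1r ler_pdivrMr; nra.
Qed.

(* The main one-variable inequality, for polynomials on the unit disc. *)
Lemma poly_log_integral_bound (Phi P : {poly C}) (S Lam : R) :
  0 <= S -> 0 < Lam -> Phi`_0 != 0 ->
  (forall z, normc z = 1 -> normc Phi.[z] <= expR S) ->
  (forall z, normc z = 1 -> normc (P * Phi).[z] <= Lam * expR S) ->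
  forall z, normc z < 1 -> normc P.[z] <=
    Lam * expR 2 / (1 - normc z) * expR (8 * (S + 2 - ln (normc Phi`_0)) / (1 - normc z)).
Proof.
move=> S0 Lam0 Phi0 PhiS PPhi.
have [BP BP0 hBP] := poly_bounded P.
have [LP LP0 hLP] := poly_lipschitz Phi.
have eS0 := expR_gt0 S.
have [d /andP[d0 d1] dP] : exists2 d : R, 0 < d <= 1 & d * BP <= Lam * expR S.
  exists (Num.min 1 (Lam * expR S / (BP + 1))).
    by rewrite lt_min ltr01/= divr_gt0 ?mulr_gt0//= ?ge_min ?lexx// ltr_wpDl.
  rewrite (@le_trans _ _ (Lam * expR S / (BP + 1) * BP))//.
    by rewrite ler_wpM2r// ge_min lexx orbT.
  by rewrite -mulrA ler_piMr ?mulr_ge0 ?ltW// mulrC ltr_pdivrMr ?ltr_wpDl// mul1r ltrDl.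
pose u z := Num.max (normc Phi.[z]) d.
have ud z : d <= u z by rewrite le_max lexx orbT.
have u0 z : 0 < u z by exact: lt_le_trans (ud z).
have uS z : normc z = 1 -> u z <= expR S.
  move=> z1; rewrite ge_max PhiS//= (le_trans d1)// -expR0 ler_expR//.
have uexp z : u z = expR (ln (u z)) by rewrite lnK// posrE.
pose f z := S - ln (u z).
have [V [K [K0 V0 Vf VK]]] : exists V : {poly C}, exists K : R,
  [/\ 0 <= K, V.[0] = K%:C%C,
     forall z, normc z = 1 -> `|complex.Re V.[z] - f z| <= 1 &
     forall z, normc z < 1 -> normc V.[z] <= K * ((1 + normc z) / (1 - normc z))].
  apply: (@fejer_approx _ f (S - ln d) (d^-1 * LP)) => //.
  - move=> z z1; rewrite /f subr_ge0 -{1}[S]expRK ler_ln ?posrE// uS//=.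
    by rewrite lerD2l lerN2 ler_ln ?posrE.
  - by rewrite mulr_ge0// invr_ge0 ltW.
  - move=> z w z1 w1; rewrite /f opprB addrC addrA subrK.
    rewrite (le_trans (ler_dist_ln d0 (ud _) (ud _)))// -mulrA ler_wpM2l ?invr_ge0 ?(ltW d0)//.
    rewrite /u (le_trans (ler_dist_max _ _ _))// (le_trans (ler_dist_dist_normc _ _))//.
    by rewrite normc_distC hLP ?z1 ?w1.
have [BV BV0 hBV] := poly_bounded V.
pose n := Num.bound (BV ^+ 2 + 2 * BV).
have hn : BV ^+ 2 + 2 * BV <= n.+1%:R.
  have X0 : 0 <= BV ^+ 2 + 2 * BV by rewrite addr_ge0 ?sqr_ge0// mulr_ge0.
  by rewrite ltW// (lt_le_trans (archi_boundP X0))// ler_nat leqnSn.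
have n0 : 0 < n.+1%:R :> R by rewrite ltr0n.
have Vn z : normc z <= 1 -> normc V.[z] ^+ 2 <= n.+1%:R.
  move=> z1; rewrite (le_trans _ hn)//; have := hBV _ z1; have := normc_ge0 V.[z]; nra.
have Vn2 z : normc z <= 1 -> normc V.[z] / n.+1%:R <= 2^-1.
  move=> z1; rewrite ler_pdivrMr//; have := hBV _ z1; have := normc_ge0 V.[z]; nra.
pose E (s : R) : {poly C} := (1 + (s / n.+1%:R)%:C%C *: V) ^+ n.+1.
have hE s z : (E s).[z] = (1 + (s / n.+1%:R)%:C%C * V.[z]) ^+ n.+1.
  by rewrite horner_exp !hornerE.
have hN : normc (0 : C) = 0 by exact: normc0.
(* Jensen *)
have KS : K <= 2 * (S + 2 - ln (normc Phi`_0)).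
  have : normc (Phi * E 1)`_0 <= expR (S + 2).
    apply: cauchy_poly => z z1; rewrite hornerM hE normcM normcX.
    rewrite (le_trans (ler_wpM2l (normc_ge0 _) (normc_exp_le (Vn _ _) _)))//.
    - by rewrite z1.
    - by rewrite expr1n.
    rewrite (@le_trans _ _ (u z * expR (1 * complex.Re V.[z] + 2^-1)))//.
      by rewrite ler_wpM2r ?expR_ge0// le_max lexx.
    rewrite uexp -expRD ler_expR mul1r; have := Vf z z1; rewrite ler_distl /f => /andP[_]; lra.
  rewrite -horner_coef0 hornerM horner_coef0 normcM hE V0 -rmorphM -(rmorph1 (@real_complex R)) -rmorphD.
  rewrite normcX normc_real div1r ger0_norm; last first.
    by rewrite addr_ge0// mulr_ge0// invr_ge0.
  have Kn : 0 <= K / n.+1%:R <= 1.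
    rewrite divr_ge0//= (le_trans _ (@le_trans _ _ 2^-1 _ _ (Vn2 0 _) _)) ?hN//; last by lra.
    by rewrite V0 normc_real ger0_norm.
  have : expR (K / 2) <= (1 + n.+1%:R^-1 * K) ^+ n.+1.
    rewrite (_ : K / 2 = n.+1%:R * (K / n.+1%:R / 2)); last by field; rewrite gt_eqF.
    rewrite expRM_natl ler_pXn2r ?nnegrE ?expR_ge0//; first by rewrite [_^-1 * K]mulrC expR_half_le.
    by rewrite addr_ge0// mulr_ge0// invr_ge0.
  move=> h1 h2.
  have : normc Phi`_0 * expR (K / 2) <= expR (S + 2).
    by rewrite (le_trans _ h2)// ler_wpM2l// normc_ge0.
  have Phi0' : 0 < normc Phi`_0 by rewrite normc_gt0.
  rewrite -[normc Phi`_0]lnK ?posrE// -expRD ler_expR lnK ?posrE//; lra.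
move=> z z1; have hz : 0 < 1 - normc z by rewrite subr_gt0.
have : normc (P * E (-1)).[z] <= Lam * expR 2 / (1 - normc z).
  apply: poly_disc_bound => // {hz z1}z z1; rewrite hornerM hE normcM normcX.
  rewrite (le_trans (ler_wpM2l (normc_ge0 _) (normc_exp_le (Vn _ _) _)))//.
  - by rewrite z1.
  - by rewrite sqrrN expr1n.
  have Pu : normc P.[z] * u z <= Lam * expR S.
    have := PPhi z z1; rewrite hornerM normcM /u => PPhiz.
    case: (leP (normc Phi.[z]) d) => [_|_//].
    by rewrite mulrC (le_trans _ dP)// (ler_wpM2l (ltW d0))// hBP// z1.
  have {}Pu : normc P.[z] <= Lam * expR (f z).
    rewrite /f expRB -uexp mulrA ler_pdivlMr//.
  rewrite (le_trans (ler_wpM2r (expR_ge0 _) Pu))// -mulrA -expRD (ler_wpM2l (ltW Lam0))//.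
  rewrite ler_expR mulN1r; have := Vf z z1; rewrite ler_distl => /andP[]; lra.
rewrite hornerM hE normcM normcX mulN1r.
have lowE : expR (- (2 * normc V.[z])) <= normc (1 + (- (n.+1%:R^-1))%:C%C * V.[z]) ^+ n.+1.
  rewrite (_ : - _ = n.+1%:R * - (2 * (normc V.[z] / n.+1%:R))); last first.
    by field; rewrite gt_eqF.
  rewrite expRM_natl ler_pXn2r ?nnegrE ?expR_ge0 ?normc_ge0//.
  rewrite (le_trans (expR_N2_le _))//.
    by rewrite Vn2 ?andbT ?(ltW z1)// divr_ge0// normc_ge0.
  rewrite rmorphN mulNr (le_trans _ (ler_dist_normc _ _))//.
  by rewrite normc1 normcM normc_real ger0_norm ?invr_ge0// mulrC.
move=> h; have {h lowE} : normc P.[z] * expR (- (2 * normc V.[z])) <= Lam * expR 2 / (1 - normc z).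
  by rewrite (le_trans _ h)// ler_wpM2l ?normc_ge0.
rewrite expRN ler_pdivrMr ?expR_gt0// => /le_trans; apply.
rewrite ler_wpM2l ?mulr_ge0 ?expR_ge0 ?invr_ge0 ?(ltW Lam0) ?(ltW hz)// ler_expR.
have {}VK := VK z z1.
have : normc V.[z] <= K * (2 / (1 - normc z)).
  rewrite (le_trans VK)// ler_wpM2l// ler_wpM2r ?invr_ge0 ?ltW//; lra.
rewrite !mulrA !ler_pdivlMr//; nra.
Qed.
End log_integral.

(*@@P1e@@*)
Section binomial_weights.
Context {R : realType}.
Implicit Types (r : R).

Lemma leq_expn_bin N n : (n.+1 ^ N <= N`! * 'C(n + N, N))%N.
Proof.
elim: N => [|N ih]; first by rewrite expn0 bin0.
rewrite factS -mulnA mulnCA addnS -mul_bin_diag/= mulnCA expnS leq_mul//.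
by rewrite ltnS leq_addr.
Qed.

Lemma sum_bin_geometric N D r : 0 <= r -> r < 1 ->
  \sum_(n < D) 'C(n + N, N)%:R * r ^+ n <= (1 - r) ^- N.+1.
Proof.
move=> r0 r1; have r1' : 0 < 1 - r by rewrite subr_gt0.
elim: N => [|N ih].
  under eq_bigr do rewrite bin0 mul1r.
  by rewrite expr1 sum_geometric_le.
rewrite -(@ler_pM2l _ (1 - r))// exprS invfM mulVKf ?gt_eqF//.
rewrite (le_trans _ ih)//; case: D {ih} => [|D]; first by rewrite !big_ord0 mulr0.
suff -> : (1 - r) * \sum_(n < D.+1) 'C(n + N.+1, N.+1)%:R * r ^+ n =
   \sum_(n < D.+1) 'C(n + N, N)%:R * r ^+ n - 'C(D + N.+1, N.+1)%:R * r ^+ D.+1.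
  by rewrite gerBl mulr_ge0// exprn_ge0.
elim: D => [|D ih]; first by rewrite !big_ord1 !binn; ring.
rewrite big_ord_recr/= mulrDr ih [X in _ = X - _]big_ord_recr/=.
have -> : 'C(D.+1 + N.+1, N.+1) = ('C(D + N.+1, N.+1) + 'C(D.+1 + N, N))%N.
  by rewrite addSn binS addnS addSn.
by rewrite natrD !exprS; ring.
Qed.

Lemma bin_geometric_tail (phi : nat -> R[i]) N (C0 r tau : R) : 0 <= C0 -> 0 < r -> r < 1 ->
  (forall n, normc (phi n) <= C0 * 'C(n + N, N)%:R) -> 0 < tau ->
  exists D0, forall i, (D0 <= i)%N -> normc (phi i) * r ^+ i <= tau.
Proof.
move=> C00 r0 r1 phiC tau0; pose s := (1 + r) / 2.
have [s0 s1 rs] : [/\ 0 < s, s < 1 & r < s] by rewrite /s; split; lra.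
pose K := C0 * (1 - s) ^- N.+1.
have K0 : 0 <= K by rewrite mulr_ge0// invr_ge0 exprn_ge0// subr_ge0 ltW.
have rs0 : 0 <= r / s by apply: divr_ge0; exact: ltW.
have : (r / s) ^+ n @[n --> \oo] --> (0 : R).
  by apply: cvg_expr; rewrite ger0_norm// ltr_pdivrMr// mul1r.
have K1 : 0 < tau / (K + 1) by rewrite divr_gt0// ltr_wpDl.
move=> /cvgrPdist_le/(_ _ K1)[D0 _ hD0]; exists D0 => i /hD0/=.
rewrite sub0r normrN ger0_norm ?exprn_ge0// => h.
apply: (@le_trans _ _ (K * (r / s) ^+ i)).
  rewrite expr_div_n [X in _ <= _ * X]mulrC mulrA ler_wpM2r ?exprn_ge0 ?(ltW r0)//.
  rewrite ler_pdivlMr ?exprn_gt0//.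
  rewrite (le_trans (ler_wpM2r (exprn_ge0 _ (ltW s0)) (phiC i)))// -mulrA ler_wpM2l//.
  rewrite (le_trans _ (sum_bin_geometric N i.+1 (ltW s0) s1))//.
  rewrite big_ord_recr/= lerDr sumr_ge0// => j _; rewrite mulr_ge0// exprn_ge0// ltW//.
rewrite (le_trans (ler_wpM2l K0 h))// mulrCA ler_piMr ?(ltW tau0)//.
by rewrite ler_pdivrMr ?ltr_wpDl// mul1r lerDl.
Qed.

End binomial_weights.

Section power_series_quotient.
Context {R : realType}.
Local Notation C := R[i].
Implicit Types (phi : nat -> C) (p : {poly C}).

Definition conv phi p n : C := \sum_(l < n.+1) p`_l * phi (n - l)%N.

Lemma poly_log_integral_bound_series phi p N (C0 Lam r : R) :
  0 <= C0 -> 0 < Lam -> 0 < r -> r < 1 -> phi 0%N != 0 ->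
  (forall n, normc (phi n) <= C0 * 'C(n + N, N)%:R) ->
  (forall n, normc (conv phi p n) <= Lam * (C0 * 'C(n + N, N)%:R)) ->
  forall z, normc z < 1 -> normc p.[r%:C%C * z] <=
    Lam * expR 2 / (1 - normc z) * expR (8 * (ln ((C0 + 1) / (1 - r) ^+ N.+1) + 2
      - ln (normc (phi 0%N))) / (1 - normc z)).
Proof.
move=> C00 Lam0 r0 r1 phi0 phiC qC z z1.
have r1' : 0 < 1 - r by rewrite subr_gt0.
pose T := (C0 + 1) / (1 - r) ^+ N.+1.
have rN1 : 1 <= (1 - r) ^- N.+1.
  by rewrite -exprVn exprn_ege1// invf_ge1// gerBl ltW.
have T1 : 1 <= T by rewrite -[1]mulr1 ler_pM// lerDr.
have eT : expR (ln T) = T by rewrite lnK// posrE (lt_le_trans _ T1).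
pose P := \poly_(i < size p) (p`_i * r%:C%C ^+ i).
have hP w : P.[w] = p.[r%:C%C * w].
  rewrite horner_poly horner_coef; apply: eq_bigr => i _.
  by rewrite exprMn mulrA.
have cP k : P`_k = p`_k * r%:C%C ^+ k.
  by rewrite coef_poly; case: ltnP => // /(nth_default 0) ->; rewrite mul0r.
rewrite -hP -/T.
(* tail of the truncation *)
pose A := \sum_(l < size P) normc P`_l.
have A0 : 0 <= A by apply: sumr_ge0 => l _; exact: normc_ge0.
pose tau := Lam / ((size P)%:R * A + 1).
have tau0 : 0 < tau by rewrite divr_gt0// ltr_wpDl// mulr_ge0.
have [D0 hD0] : exists D0, forall i, (D0 <= i)%N -> normc (phi i) * r ^+ i <= tau.
  exact: (@bin_geometric_tail _ _ N C0).
pose D := (D0 + size P).+1.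
pose Phi := \poly_(i < D) (phi i * r%:C%C ^+ i).
have cPhi i : Phi`_i = if (i < D)%N then phi i * r%:C%C ^+ i else 0 by rewrite coef_poly.
have hr i : normc (r%:C%C ^+ i) = r ^+ i by rewrite normcX normc_real ger0_norm// ltW.
have hPhi w : normc w = 1 -> normc Phi.[w] <= expR (ln T).
  move=> w1; rewrite eT horner_poly (le_trans (ler_normc_sum _ _ _))//.
  apply: (@le_trans _ _ (\sum_(i < D) C0 * ('C(i + N, N)%:R * r ^+ i))).
    apply: ler_sum => i _; rewrite !normcM hr normcX w1 expr1n mulr1 mulrA.
    by rewrite ler_wpM2r ?exprn_ge0 ?(ltW r0).
  rewrite -mulr_sumr (le_trans (ler_wpM2l C00 (sum_bin_geometric N D (ltW r0) r1)))//.
  by rewrite ler_wpM2r ?lerDl// (le_trans _ rN1).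
have cPPhi n : (n < D)%N -> (P * Phi)`_n = conv phi p n * r%:C%C ^+ n.
  move=> nD; rewrite coefM mulr_suml; apply: eq_bigr => l _.
  rewrite cP cPhi (leq_ltn_trans (leq_subr _ _) nD) mulrACA -exprD subnKC//.
  by rewrite -ltnS.
have tPPhi n : (D <= n)%N -> normc (P * Phi)`_n <= A * tau.
  move=> Dn; rewrite coefM (le_trans (ler_normc_sum _ _ _))//.
  apply: (@le_trans _ _ (\sum_(l < n.+1) normc P`_l * tau)).
    apply: ler_sum => l _; rewrite normcM.
    have [lP|lP] := leqP (size P) l.
      by rewrite nth_default// normc0 !mul0r.
    rewrite ler_wpM2l ?normc_ge0// cPhi; case: ifPn; last by rewrite normc0 (ltW tau0).
    move=> _; rewrite normcM hr hD0//; rewrite /D in Dn; lia.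
  rewrite -mulr_suml ler_wpM2r ?(ltW tau0)// /A.
  have sPn : (size P <= n.+1)%N by rewrite /D in Dn; lia.
  rewrite -(subnKC sPn) big_split_ord/= [X in _ + X]big1 ?addr0// => i _.
  by rewrite nth_default ?normc0// leq_addr.
have hPPhi w : normc w = 1 -> normc (P * Phi).[w] <= Lam * expR (ln T).
  move=> w1; rewrite eT.
  have sz : (size (P * Phi)%R <= D + size P)%N.
    rewrite (leq_trans (size_polyMleq _ _))// (leq_trans (leq_pred _))//.
    by rewrite addnC leq_add2r size_poly.
  rewrite (horner_coef_wide _ sz) big_split_ord/= (le_trans (ler_normcD _ _))//.
  have -> : Lam * T = Lam * C0 * (1 - r) ^- N.+1 + Lam * (1 - r) ^- N.+1.
    by rewrite /T; ring.
  apply: lerD.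
    rewrite (le_trans (ler_normc_sum _ _ _))//.
    apply: (@le_trans _ _ (\sum_(i < D) Lam * C0 * ('C(i + N, N)%:R * r ^+ i))).
      apply: ler_sum => i _; rewrite normcM normcX w1 expr1n mulr1 cPPhi// normcM hr.
      by rewrite mulrA ler_wpM2r ?exprn_ge0 ?(ltW r0)// -mulrA.
    rewrite -mulr_sumr ler_wpM2l ?mulr_ge0 ?(ltW Lam0)//.
    exact: (sum_bin_geometric N D (ltW r0) r1).
  rewrite (le_trans (ler_normc_sum _ _ _))//.
  apply: (@le_trans _ _ (\sum_(i < size P) A * tau)).
    apply: ler_sum => i _; rewrite normcM normcX w1 expr1n mulr1 tPPhi// leq_addr//.
  rewrite sumr_const card_ord -mulr_natl mulrA.
  rewrite (@le_trans _ _ Lam)//; last by rewrite ler_peMr ?(ltW Lam0).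
  rewrite /tau mulrCA ler_piMr ?(ltW Lam0)//.
  by rewrite ler_pdivrMr ?ltr_wpDl// ?mulr_ge0// mul1r lerDl.
have := poly_log_integral_bound (ln_ge0 T1) Lam0 _ hPhi hPPhi z1.
by rewrite cPhi/= expr0 mulr1; apply.
Qed.

End power_series_quotient.

(*@@P1f@@*)
Section quotient_coefficients.
Context {R : realType}.
Local Notation C := R[i].
Implicit Types (phi : nat -> C) (p : {poly C}).

Lemma quotient_coef_bound0 phi N (C0 : R) : 0 <= C0 -> phi 0%N != 0 ->
  (forall n, normc (phi n) <= C0 * 'C(n + N, N)%:R) ->
  exists A B : R, [/\ 0 <= A, 0 <= B & forall p (Lam : R), 0 < Lam ->
  (forall n, normc (conv phi p n) <= Lam * (C0 * 'C(n + N, N)%:R)) ->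
  forall n, normc p`_n <= Lam * expR (Num.sqrt (n + 4)%:R * (A + B * ln (Num.sqrt (n + 4)%:R)))].
Proof.
move=> C00 phi0 phiC.
pose A := 2 + 8 * (ln (C0 + 1) + 2 + `|ln (normc (phi 0%N))|) + 4.
have lC : 0 <= ln (C0 + 1) by rewrite ln_ge0// lerDr.
exists A, (8 * N.+1%:R + 1); split.
- by rewrite /A; have := normr_ge0 (ln (normc (phi 0%N))); lra.
- by rewrite addr_ge0// mulr_ge0.
move=> p Lam Lam0 pC n.
pose t : R := Num.sqrt (n + 4)%:R; rewrite -/t.
have t2 : t ^+ 2 = n%:R + 4 by rewrite sqr_sqrtr// natrD.
have tge2 : 2 <= t.
  rewrite -(@ler_pXn2r _ 2) ?nnegrE ?sqrtr_ge0// t2 (_ : 2 ^+ 2 = 4); last by ring.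
  by rewrite lerDr.
have t0 : 0 < t by lra.
pose r := 1 - t^-1.
have tV : t^-1 <= 2^-1 by rewrite lef_pV2 ?posrE.
have tV0 : 0 < t^-1 by rewrite invr_gt0.
have r0 : 0 < r by rewrite /r; lra.
have r1 : r < 1 by rewrite /r; lra.
have rV : 1 - r = t^-1 by rewrite /r; lra.
have lt0 : 0 <= ln t by rewrite ln_ge0//; lra.
have Pr : normc p`_n * r ^+ (2 * n) <= Lam * expR (t * (A - 4 + (8 * N.+1%:R + 1) * ln t)).
  pose P := \poly_(i < size p) (p`_i * (r%:C%C ^+ 2) ^+ i).
  have -> : normc p`_n * r ^+ (2 * n) = normc P`_n.
    rewrite coef_poly; case: ltnP => [_|/(nth_default 0)->]; last by rewrite normc0 mul0r.
    by rewrite normcM !normcX normc_real ger0_norm ?(ltW r0)// exprM.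
  apply: cauchy_poly => z z1.
  have -> : P.[z] = p.[r%:C%C * (r%:C%C * z)].
    rewrite horner_poly horner_coef; apply: eq_bigr => i _.
    by rewrite [r%:C%C * (_ * z)]mulrA -expr2 [in RHS]exprMn mulrA.
  have rz : normc (r%:C%C * z) = r by rewrite normcM z1 normc_real ger0_norm ?(ltW r0)// mulr1.
  have := poly_log_integral_bound_series C00 Lam0 r0 r1 phi0 phiC pC.
  move=> /(_ (r%:C%C * z)); rewrite rz => /(_ r1) /le_trans; apply.
  rewrite rV exprVn !invrK -!mulrA ler_wpM2l ?(ltW Lam0)//.
  have e1 : t = expR (ln t) by rewrite lnK ?posrE.
  rewrite {1}e1 -!expRD ler_expR lnM ?posrE ?exprn_gt0 ?ltr_wpDl// lnXn//.
  have := ler_norm (- ln (normc (phi 0%N))); rewrite normrN.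
  set L := `|_|; set l0 := ln (normc _); set lt := ln t; set c := ln (C0 + 1) => hL.
  rewrite -[lt *+ _]mulr_natl.
  rewrite /A -/L -/c; set M : R := N.+1%:R.
  have [M0 lt0' l0L] : [/\ 0 <= M, 0 <= lt & - l0 <= L] by [].
  have -> : 2 + (lt + 8 * ((c + M * lt + 2 - l0) * t)) =
    2 + lt + t * (8 * (c + M * lt + 2 - l0)) by ring.
  rewrite (@le_trans _ _ (t * (2 + lt) + t * (8 * (c + M * lt + 2 + L))))//.
    apply: lerD; first by rewrite ler_peMl; lra.
    by rewrite ler_wpM2l ?(ltW t0)//; lra.
  by rewrite -mulrDr ler_wpM2l ?(ltW t0)//; lra.
have rn : expR (- (4 * t)) <= r ^+ (2 * n).
  apply: (@le_trans _ _ (expR (- (2 * t^-1)) ^+ (2 * n))).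
    rewrite -expRM_natl ler_expR mulrN lerN2 natrM.
    have : n%:R <= t ^+ 2 by rewrite t2 lerDl.
    move=> h; rewrite (_ : 2 * n%:R * (2 * t^-1) = 4 * (n%:R / t)); last by ring.
    by rewrite ler_wpM2l// ler_pdivrMr// -expr2.
  rewrite lerXn2r ?nnegrE ?expR_ge0 ?(ltW r0)// /r expR_N2_le//.
  by rewrite tV (ltW tV0).
have : normc p`_n * expR (- (4 * t)) <= Lam * expR (t * (A - 4 + (8 * N.+1%:R + 1) * ln t)).
  by rewrite (le_trans _ Pr)// ler_wpM2l// normc_ge0.
rewrite expRN ler_pdivrMr ?expR_gt0// -mulrA -expRD => /le_trans; apply.
by rewrite ler_wpM2l ?(ltW Lam0)// ler_expR; lra.
Qed.

(** shifting *)
Lemma quotient_coef_bound phi N (C0 : R) : 0 <= C0 -> (exists j, phi j != 0) ->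
  (forall n, normc (phi n) <= C0 * n.+1%:R ^+ N) ->
  exists A B : R, [/\ 0 <= A, 0 <= B & forall p (Lam : R), 0 < Lam ->
  (forall n, normc (conv phi p n) <= Lam * n.+1%:R ^+ N) ->
  forall n, normc p`_n <= Lam * expR (Num.sqrt (n + 4)%:R * (A + B * ln (Num.sqrt (n + 4)%:R)))].
Proof.
move=> C00 phi0 phiC.
case: (ex_minnP phi0) => j phij minj.
have phi_lt i : (i < j)%N -> phi i = 0.
  by move=> ij; apply/eqP; apply: contraTT ij => /minj; rewrite -leqNgt.
pose phi' i := phi (i + j)%N.
pose K : R := (j.+1 ^ N * N`!)%:R.
have K1 : 1 <= K by rewrite ler1n muln_gt0 expn_gt0/= fact_gt0.
have hK n : (n + j).+1%:R ^+ N <= K * 'C(n + N, N)%:R.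
  rewrite -natrX -natrM ler_nat -mulnA (@leq_trans (j.+1 ^ N * n.+1 ^ N))//.
    by rewrite -expnMn; case: (N) => // N'; rewrite leq_exp2r//; nia.
  by rewrite leq_mul2l leq_expn_bin orbT.
have K0 : 0 <= K by exact: le_trans K1.
have [] := @quotient_coef_bound0 phi' N ((C0 + 1) * K).
- by rewrite mulr_ge0// addr_ge0.
- by [].
- move=> n; rewrite (le_trans (phiC _))// -mulrA ler_pM ?lerDl ?exprn_ge0//.
move=> A [B [A0 B0 h]]; exists A, B; split => // p Lam Lam0 pC; apply: h => // n.
have -> : conv phi' p n = conv phi p (n + j).
  rewrite /conv -addSn big_split_ord/= [X in _ = _ + X]big1 ?addr0.
    by apply: eq_bigr => l _; rewrite /phi' addnBAC// -ltnS.
  by move=> i _; rewrite phi_lt ?mulr0//; have := ltn_ord i; lia.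
rewrite (le_trans (pC _))// ler_wpM2l ?(ltW Lam0)// (le_trans (hK n))//.
by rewrite ler_wpM2r// ler_peMl// lerDr.
Qed.

End quotient_coefficients.

(*@@P1g@@*)
Section decay.
Context {R : realType}.
Local Notation C := R[i].

Lemma sum_inv_square D : \sum_(n < D) (n%:R + 4) ^- 2 <= (1 : R).
Proof.
rewrite (@le_trans _ _ (3^-1 - (D%:R + 3)^-1))//; last first.
  have : 0 <= (D%:R + 3 : R)^-1 by rewrite invr_ge0.
  lra.
elim: D => [|D ih]; first by rewrite big_ord0 add0r subrr.
rewrite big_ord_recr/= (le_trans (lerD ih (lexx _)))//.
have D0 : 0 <= D%:R :> R by [].
rewrite -addrA lerD2l -subr_ge0 -[D.+1]addn1 natrD.
have -> : - (D%:R + 1 + 3)^-1 - (- (D%:R + 3)^-1 + (D%:R + 4) ^- 2) =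
   ((D%:R + 4) ^+ 2 * (D%:R + 3) : R)^-1.
  by field; apply/andP; split; apply: lt0r_neq0; lra.
by rewrite invr_ge0 mulr_ge0// ?sqr_ge0; lra.
Qed.

Lemma decay_beats_sqrt_log (eps c A B : R) : 0 < eps -> 0 < c -> 0 <= A -> 0 <= B ->
  exists n1, forall n, (n1 <= n)%N ->
    expR (- c * n%:R `^ (2^-1 + eps)) *
      expR (Num.sqrt (n + 4)%:R * (A + B * ln (Num.sqrt (n + 4)%:R))) <= (n%:R + 4) ^- 2.
Proof.
move=> e0 c0 A0 B0.
pose kap : R := 5^-1 `^ (2^-1 + eps).
have kap0 : 0 < kap by rewrite powR_gt0.
have ck0 : 0 < c * kap by rewrite mulr_gt0.
pose Y := (A + (B + 4) / eps) / (c * kap) + 1.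
have Y1 : 1 <= Y.
  rewrite lerDr divr_ge0 ?(ltW ck0)// addr_ge0// divr_ge0 ?(ltW e0)// addr_ge0//.
pose n1 := (Num.bound ((Y `^ eps^-1) ^+ 2)).+1.
exists n1 => n n1n.
set t := Num.sqrt _.
have t2 : t ^+ 2 = n%:R + 4 by rewrite sqr_sqrtr// natrD.
have tge1 : 1 <= t.
  rewrite -(@ler_pXn2r _ 2) ?nnegrE ?sqrtr_ge0// t2 expr1n.
  by have : 0 <= n%:R :> R by []; lra.
have t0 : 0 < t by lra.
have tY : Y `^ eps^-1 <= t.
  rewrite -(@ler_pXn2r _ 2) ?nnegrE ?sqrtr_ge0 ?powR_ge0// t2.
  rewrite (@le_trans _ _ n%:R) ?lerDl// ltW// (lt_le_trans (archi_boundP _)) ?sqr_ge0//.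
  by rewrite ler_nat (leq_trans _ n1n).
pose y := t `^ eps.
have yY : Y <= y.
  rewrite -[Y]powRr1 ?(le_trans _ Y1)// -(mulVf (lt0r_neq0 e0)) powRrM.
  by rewrite ge0_ler_powR ?nnegrE ?powR_ge0 ?sqrtr_ge0 ?(ltW e0).
have y1 : 1 <= y by exact: le_trans yY.
have lnt : ln t <= y / eps.
  rewrite ler_pdivlMr// mulrC -ln_powR -/y ltW// ln_sublinear//; lra.
have lnt0 : 0 <= ln t by exact: ln_ge0.
have hn : kap * (t * y ^+ 2) <= n%:R `^ (2^-1 + eps).
  have -> : t * y ^+ 2 = (t ^+ 2) `^ (2^-1 + eps).
    rewrite -[t ^+ 2]powR_mulrn ?(ltW t0)// -powRrM mulrDr divff// powRD ?(lt0r_neq0 t0) ?implybT//.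
    by rewrite powRr1 ?(ltW t0)// [_ * eps]mulrC powRrM powR_mulrn ?powR_ge0//.
  rewrite -powRM// ?sqr_ge0// ge0_ler_powR ?nnegrE ?mulr_ge0 ?(ltW t0)//.
    by rewrite addr_ge0// ltW.
  rewrite t2; have : 1 <= n%:R :> R by rewrite ler1n (leq_trans _ n1n).
  lra.
have -> : (n%:R + 4) ^- 2 = expR (- (4 * ln t)).
  rewrite expRN -t2 -exprM (_ : 4 * ln t = ln t *+ 4) ?mulr_natl// -lnXn// lnK//.
  by rewrite posrE exprn_gt0.
rewrite -expRD ler_expR.
have h1 : c * (kap * (t * y ^+ 2)) <= c * n%:R `^ (2^-1 + eps) by rewrite ler_wpM2l// ltW.
have h2 : A + (B + 4) * ln t <= c * kap * y ^+ 2.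
  have : c * kap * Y <= c * kap * y by rewrite ler_wpM2l// ltW.
  rewrite {1}/Y mulrDr mulrCA divff ?gt_eqF// !mulr1 => hY.
  rewrite expr2 mulrA (@le_trans _ _ ((A + (B + 4) / eps) * y))//; last first.
    by rewrite ler_wpM2r ?(le_trans ler01 y1)// (le_trans _ hY)// lerDl ltW.
  rewrite [leRHS]mulrDl lerD//; first by rewrite ler_peMr.
  by rewrite -mulrA ler_wpM2l ?addr_ge0// mulrC.
have h3 : t * (A + B * ln t) + 4 * ln t <= t * (c * kap * y ^+ 2).
  rewrite (le_trans _ (ler_wpM2l (ltW t0) h2))//.
  rewrite (_ : t * (A + (B + 4) * ln t) = t * (A + B * ln t) + t * (4 * ln t)); last by ring.
  rewrite lerD2l.
  by rewrite ler_peMl// mulr_ge0.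
rewrite mulNr; move: h1 h3; set X := c * n%:R `^ _.
rewrite (_ : c * (kap * (t * y ^+ 2)) = t * (c * kap * y ^+ 2)); last by ring.
by lra.
Qed.

Lemma sum_decay_bounded (a : nat -> C) (eps c A B : R) :
  0 < eps -> 0 < c -> 0 <= A -> 0 <= B ->
  (fun n => normc (a n)) =O_\oo (fun n => expR (- c * n%:R `^ (2^-1 + eps))) ->
  exists2 M : R, 0 <= M & forall D, \sum_(n < D) normc (a n) *
     expR (Num.sqrt (n + 4)%:R * (A + B * ln (Num.sqrt (n + 4)%:R))) <= M.
Proof.
move=> e0 c0 A0 B0 /eqO_exP[k k0 [n0 _ hk]].
have [n1 hn1] := decay_beats_sqrt_log e0 c0 A0 B0.
pose w n := expR (Num.sqrt (n + 4)%:R * (A + B * ln (Num.sqrt (n + 4)%:R))) : R.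
pose b n := normc (a n) * w n.
have b0 n : 0 <= b n by rewrite mulr_ge0 ?normc_ge0 ?expR_ge0.
pose n2 := maxn n0 n1.
have hb n : (n2 <= n)%N -> b n <= k * (n%:R + 4) ^- 2.
  rewrite geq_max => /andP[/hk/= h0 /hn1 h1].
  move: h0; rewrite !ger0_norm ?normc_ge0 ?expR_ge0// => h0.
  rewrite /b (le_trans (ler_wpM2r (expR_ge0 _) h0))// -mulrA ler_wpM2l ?(ltW k0)//.
exists (\sum_(n < n2) b n + k).
  by rewrite addr_ge0 ?sumr_ge0// ltW.
move=> D; rewrite (@le_trans _ _ (\sum_(n < n2 + D) b n))//.
  by rewrite addnC big_split_ord/= lerDl sumr_ge0.
rewrite big_split_ord/= lerD2l.
rewrite (@le_trans _ _ (\sum_(n < D) k * (n%:R + 4) ^- 2))//.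
  apply: ler_sum => n _; rewrite (le_trans (hb _ (leq_addr _ _)))// ler_wpM2l ?(ltW k0)//.
  rewrite lef_pV2 ?posrE ?exprn_gt0 ?ltr_wpDl// ler_pXn2r ?nnegrE// lerD2r ler_nat leq_addl//.
by rewrite -mulr_sumr ler_piMr ?(ltW k0)// sum_inv_square.
Qed.

End decay.

(*@@P2a@@*)
Section complex_calculus.
Context {R : realType}.
Local Notation C := R[i].
Implicit Types (g G : R -> C) (x : R).

Lemma complexReM (x y : C) :
  complex.Re (x * y) = complex.Re x * complex.Re y - complex.Im x * complex.Im y.
Proof. by case: x y => [a b] [c d]. Qed.

Lemma complexImM (x y : C) :
  complex.Im (x * y) = complex.Re x * complex.Im y + complex.Im x * complex.Re y.
Proof. by case: x y => [a b] [c d]. Qed.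

Definition cder G x (l : C) : Prop :=
  is_derive x 1 (fun t => complex.Re (G t)) (complex.Re l) /\
  is_derive x 1 (fun t => complex.Im (G t)) (complex.Im l).

Lemma cderE G x l l' : cder G x l -> l = l' -> cder G x l'.
Proof. by move=> + <-. Qed.

Lemma cder_cst (a : C) x : cder (fun=> a) x 0.
Proof. by split; exact: is_derive_cst. Qed.

Lemma cderD G1 G2 x l1 l2 : cder G1 x l1 -> cder G2 x l2 ->
  cder (fun t => G1 t + G2 t) x (l1 + l2).
Proof.
move=> [r1 i1] [r2 i2]; split; rewrite ?ReD ?ImD.
- by under eq_fun do rewrite ReD; exact: is_deriveD.
- by under eq_fun do rewrite ImD; exact: is_deriveD.
Qed.

Lemma cderM G1 G2 x l1 l2 : cder G1 x l1 -> cder G2 x l2 ->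
  cder (fun t => G1 t * G2 t) x (l1 * G2 x + G1 x * l2).
Proof.
move=> [r1 i1] [r2 i2]; split.
- under eq_fun do rewrite complexReM.
  refine (is_derive_eq (is_deriveB (is_deriveM r1 r2) (is_deriveM i1 i2)) _).
  rewrite /GRing.scale/=.
  by case: (G1 x) (G2 x) l1 l2 {r1 i1 r2 i2} => [? ?] [? ?] [? ?] [? ?] /=; ring.
- under eq_fun do rewrite complexImM.
  refine (is_derive_eq (is_deriveD (is_deriveM r1 i2) (is_deriveM i1 r2)) _).
  rewrite /GRing.scale/=.
  by case: (G1 x) (G2 x) l1 l2 {r1 i1 r2 i2} => [? ?] [? ?] [? ?] [? ?] /=; ring.
Qed.

Lemma cderZ (a : C) G x l : cder G x l -> cder (fun t => a * G t) x (a * l).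
Proof. by move=> h; have := cderM (cder_cst a x) h; rewrite mul0r add0r. Qed.

Lemma cderB G1 G2 x l1 l2 : cder G1 x l1 -> cder G2 x l2 ->
  cder (fun t => G1 t - G2 t) x (l1 - l2).
Proof.
move=> h1 h2; rewrite -mulN1r; have := cderD h1 (cderZ (-1) h2).
by under eq_fun do rewrite mulN1r.
Qed.

Lemma cder_sum n (G : nat -> R -> C) x (l : nat -> C) :
  (forall i, cder (G i) x (l i)) ->
  cder (fun t => \sum_(i < n) G i t) x (\sum_(i < n) l i).
Proof.
move=> h; elim: n => [|n ih].
  by rewrite big_ord0; under eq_fun do rewrite big_ord0; exact: cder_cst.
by rewrite big_ord_recr/=; under eq_fun do rewrite big_ord_recr/=; exact: cderD.
Qed.

Lemma cder_real (f : R -> R) x l : is_derive x 1 f l -> cder (fun t => (f t)%:C%C) x l%:C%C.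
Proof. by move=> h; split => //=; exact: is_derive_cst. Qed.

Lemma increment_le (P g : R -> R) a b e : a <= b ->
  (forall x, a <= x <= b -> is_derive x 1 P (g x)) ->
  (forall x, a <= x <= b -> `|g x| <= e) -> `|P b - P a| <= e * (b - a).
Proof.
move=> ab dP ge; have [] := @MVT_segment R P g a b ab.
- by move=> x; rewrite in_itv/= => /andP[/ltW ax /ltW xb]; apply: dP; rewrite ax.
- apply: continuous_in_subspaceT => x; rewrite inE/= in_itv/= => /dP[dPx _].
  by apply: differentiable_continuous; exact/derivable1_diffP.
move=> c; rewrite in_itv/= => /ge gc ->.
by rewrite normrM [`|b - a|]ger0_norm ?subr_ge0// ler_wpM2r ?subr_ge0.
Qed.

Lemma cincrement_le G g a b e : a <= b ->
  (forall x, a <= x <= b -> cder G x (g x)) ->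
  (forall x, a <= x <= b -> normc (g x) <= e) -> normc (G b - G a) <= 2 * e * (b - a).
Proof.
move=> ab dG ge; rewrite (le_trans (ler_normc_ReIm _))// ReB ImB -mulrA mulrDl mul1r.
apply: lerD.
- apply: (@increment_le (fun t => complex.Re (G t)) (fun t => complex.Re (g t)) a b e ab).
    by move=> x /dG[].
  by move=> x /ge; exact/le_trans/ler_Re_normc.
- apply: (@increment_le (fun t => complex.Im (G t)) (fun t => complex.Im (g t)) a b e ab).
    by move=> x /dG[].
  by move=> x /ge; exact/le_trans/ler_Im_normc.
Qed.

Definition pcont g x : Prop := forall e : R, 0 < e ->
  exists2 d : R, 0 < d & forall y, `|y - x| < d -> normc (g y - g x) <= e.

Definition ccont (F : C -> C) (u : C) : Prop := forall e : R, 0 < e ->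
  exists2 d : R, 0 < d & forall w, normc (w - u) < d -> normc (F w - F u) <= e.

Definition cdiff_at (F : C -> C) (u l : C) : Prop := forall e : R, 0 < e ->
  exists2 d : R, 0 < d & forall w, normc (w - u) < d ->
    normc (F w - F u - l * (w - u)) <= e * normc (w - u).

Lemma cdiff_ccont F u l : cdiff_at F u l -> ccont F u.
Proof.
move=> h e e0; have [d d0 hd] := h 1 ltr01.
have k0 : 0 < 1 + normc l by rewrite ltr_wpDr// normc_ge0.
exists (Num.min d (e / (1 + normc l))); first by rewrite lt_min d0 divr_gt0.
move=> w; rewrite lt_min ltr_pdivlMr// => /andP[/hd wd we].
have -> : F w - F u = (F w - F u - l * (w - u)) + l * (w - u) by rewrite subrK.
rewrite (le_trans (ler_normcD _ _))// normcM (le_trans (lerD wd (lexx _)))//.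
by rewrite -mulrDl mulrC ltW.
Qed.

Lemma pcont_cst (a : C) x : pcont (fun=> a) x.
Proof. by move=> e e0; exists 1 => // y _; rewrite subrr normc0 ltW. Qed.

Lemma pcontM g1 g2 x : pcont g1 x -> pcont g2 x -> pcont (fun t => g1 t * g2 t) x.
Proof.
move=> c1 c2 e e0.
have k0 : 0 < normc (g1 x) + normc (g2 x) + 1.
  by rewrite ltr_wpDl// addr_ge0// normc_ge0.
pose e' := Num.min 1 (e / (normc (g1 x) + normc (g2 x) + 1)).
have e'0 : 0 < e' by rewrite lt_min ltr01 divr_gt0.
have [e'1 e'2] : e' <= 1 /\ e' * (normc (g1 x) + normc (g2 x) + 1) <= e.
  by rewrite -ler_pdivlMr// /e' !ge_min !lexx orbT.
have [d1 d10 h1] := c1 _ e'0; have [d2 d20 h2] := c2 _ e'0.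
exists (Num.min d1 d2); first by rewrite lt_min d10.
move=> y; rewrite lt_min => /andP[/h1 {}h1 /h2 {}h2].
have -> : g1 y * g2 y - g1 x * g2 x = (g1 y - g1 x) * (g2 y - g2 x)
   + ((g1 y - g1 x) * g2 x + g1 x * (g2 y - g2 x)) by ring.
rewrite (le_trans (ler_normcD _ _))// (le_trans (lerD (lexx _) (ler_normcD _ _)))//.
rewrite !normcM (le_trans _ e'2)//.
move: h1 h2 (normc_ge0 (g1 x)) (normc_ge0 (g2 x)).
move: (normc_ge0 (g1 y - g1 x)) (normc_ge0 (g2 y - g2 x)).
set a := normc (g1 y - g1 x); set b := normc (g2 y - g2 x).
set u := normc (g1 x); set v := normc (g2 x) => a0 b0 ha hb u0 v0.
have : a * b <= e' * 1 by rewrite ler_pM// (le_trans hb).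
have : a * v <= e' * v by rewrite ler_wpM2r.
have : u * b <= u * e' by rewrite ler_wpM2l.
lra.
Qed.

Lemma pcont_Re g x : pcont g x -> {for x, continuous (fun t => complex.Re (g t))}.
Proof.
move=> gc; apply/cvgrPdist_le => e e0; have [d d0 hd] := gc e e0.
exists d => //= y; rewrite /ball_/= distrC => hy; rewrite (le_trans _ (hd _ hy))//.
by rewrite distrC -ReB ler_Re_normc.
Qed.

Lemma pcont_Im g x : pcont g x -> {for x, continuous (fun t => complex.Im (g t))}.
Proof.
move=> gc; apply/cvgrPdist_le => e e0; have [d d0 hd] := gc e e0.
exists d => //= y; rewrite /ball_/= distrC => hy; rewrite (le_trans _ (hd _ hy))//.
by rewrite distrC -ImB ler_Im_normc.
Qed.

Lemma cder_pcont G x l : cder G x l -> pcont G x.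
Proof.
move=> [[/derivable1_diffP/differentiable_continuous/cvgrPdist_le rG _]].
move=> [/derivable1_diffP/differentiable_continuous/cvgrPdist_le iG _] e e0.
have e2 : 0 < e / 2 by rewrite divr_gt0.
have [d1/= d10 h1] := rG _ e2; have [d2/= d20 h2] := iG _ e2.
exists (Num.min d1 d2); first by rewrite lt_min d10.
move=> y; rewrite lt_min ![`|y - x|]distrC => /andP[/h1 {}h1 /h2 {}h2].
rewrite normc_distC (le_trans (ler_normc_ReIm _))// ReB ImB (le_trans (lerD h1 h2))//.
by rewrite -splitr.
Qed.

(* primitive on ]-1, 2[, a neighbourhood of [0, 1] *)
Definition prim (g : R -> R) (x : R) : R :=
  (\int[@lebesgue_measure R]_(t in `[-1, x]) g t)%R.

Lemma prim_derive (g : R -> R) x : (forall y, {for y, continuous g}) -> 0 <= x <= 1 ->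
  is_derive x 1 (prim g) (g x).
Proof.
move=> cg /andP[x0 x1]; have [] := @continuous_FTC1_closed R g (-1) x 2.
- by lra.
- apply: continuous_compact_integrable; first exact: segment_compact.
  by apply: continuous_subspaceT => y; exact: cg.
- by lra.
- exact: cg.
by move=> dP <-; rewrite derive1E; exact: derivableP.
Qed.

Definition cprim g x : C :=
  Complex (prim (fun t => complex.Re (g t)) x) (prim (fun t => complex.Im (g t)) x).

Lemma cprim_cder g x : (forall y, pcont g y) -> 0 <= x <= 1 -> cder (cprim g) x (g x).
Proof.
move=> cg x01; split => /=; apply: prim_derive => // y.
- exact: pcont_Re.
- exact: pcont_Im.
Qed.

End complex_calculus.

(*@@P2b@@*)
Section bisection.
Context {R : realType}.
Local Notation C := R[i].
Implicit Types (mu : R -> R -> R -> C).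

Lemma nested_intervals (x : nat -> R) :
  (forall n, x n <= x n.+1) ->
  (forall n, x n.+1 + 2^-1 ^+ n.+1 <= x n + 2^-1 ^+ n) ->
  exists x0, forall n, x n <= x0 <= x n + 2^-1 ^+ n.
Proof.
move=> xi xd.
have xi' : {homo x : m n / (m <= n)%N >-> m <= n}.
  by apply: homo_leq => //; exact: le_trans.
have xd' : {homo (fun n => - (x n + 2^-1 ^+ n)) : m n / (m <= n)%N >-> m <= n}.
  by apply: homo_leq => [//|y u v|n]; [exact: le_trans|rewrite lerN2].
have h n m : x n <= x m + 2^-1 ^+ m.
  have [nm|mn] := leqP n m.
    by rewrite (le_trans (xi' _ _ nm))// lerDl exprn_ge0.
  have := xd' _ _ (ltnW mn); rewrite lerN2; apply: le_trans.
  by rewrite lerDl exprn_ge0.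
exists (sup (range x)) => n; apply/andP; split.
  apply: ub_le_sup; last by exists n.
  by exists (x 0%N + 2^-1 ^+ 0) => _ [m _ <-].
by apply: ge_sup; [exists (x 0%N), 0%N|move=> _ [m _ <-]].
Qed.

Lemma bisection_vanish mu :
  (forall x y h, 0 < h -> mu x y h = mu x y (h / 2) + mu (x + h / 2) y (h / 2)
     + mu x (y + h / 2) (h / 2) + mu (x + h / 2) (y + h / 2) (h / 2)) ->
  (forall x0 y0, 0 <= x0 <= 1 -> 0 <= y0 <= 1 -> forall e, 0 < e ->
     exists2 d, 0 < d & forall x y h, 0 <= x -> x + h <= 1 -> 0 <= y -> y + h <= 1 ->
       x <= x0 <= x + h -> y <= y0 <= y + h -> 0 < h < d ->
       normc (mu x y h) <= e * h ^+ 2) ->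
  mu 0 0 1 = 0.
Proof.
move=> muD mu_loc; apply/eqP; rewrite -normc_eq0 eq_le normc_ge0 andbT leNgt.
apply/negP => K0; set K := normc (mu 0 0 1) in K0.
pose good (h : R) (p q : R * R) := normc (mu p.1 p.2 h) <= 4 * normc (mu q.1 q.2 (h / 2)).
pose q1 (h : R) (p : R * R) := (p.1 + h / 2, p.2).
pose q2 (h : R) (p : R * R) := (p.1, p.2 + h / 2).
pose q3 (h : R) (p : R * R) := (p.1 + h / 2, p.2 + h / 2).
pose step h p := if good h p p then p else if good h p (q1 h p) then q1 h p else
  if good h p (q2 h p) then q2 h p else q3 h p.
have step_good h p : 0 < h -> good h p (step h p).
  move=> h0; rewrite /step.
  case: ifPn => // g0; case: ifPn => // g1; case: ifPn => // g2.
  move: g0 g1 g2; rewrite /good/= muD// -!ltNge => g0 g1 g2.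
  set a := mu _ _ _ in g0 g1 g2 *; set b := mu _ _ _ in g0 g1 g2 *.
  set c := mu _ _ _ in g0 g1 g2 *; set e := mu _ _ _ in g0 g1 g2 *.
  have := ler_normcD (a + b + c) e; have := ler_normcD (a + b) c; have := ler_normcD a b.
  lra.
have step_le h p : 0 < h -> [/\ p.1 <= (step h p).1, p.2 <= (step h p).2,
    (step h p).1 + h / 2 <= p.1 + h & (step h p).2 + h / 2 <= p.2 + h].
  by move=> h0; rewrite /step; case: ifPn => _; [|case: ifPn => _; [|case: ifPn => _]]; split => /=; lra.
pose s := fix s n := if n is m.+1 then step (2^-1 ^+ m) (s m) else (0, 0).
have h0 n : 0 < 2^-1 ^+ n :> R by rewrite exprn_gt0.
have hS n : 2^-1 ^+ n.+1 = 2^-1 ^+ n / 2 :> R by rewrite exprSr.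
have [x0 hx0] : exists x0, forall n, (s n).1 <= x0 <= (s n).1 + 2^-1 ^+ n.
  apply: (@nested_intervals (fun n => (s n).1)) => n;
    by case: (step_le _ (s n) (h0 n)); rewrite ?hS.
have [y0 hy0] : exists y0, forall n, (s n).2 <= y0 <= (s n).2 + 2^-1 ^+ n.
  apply: (@nested_intervals (fun n => (s n).2)) => n;
    by case: (step_le _ (s n) (h0 n)); rewrite ?hS.
have sb n : [/\ 0 <= (s n).1, (s n).1 + 2^-1 ^+ n <= 1, 0 <= (s n).2 & (s n).2 + 2^-1 ^+ n <= 1].
  elim: n => [|n [? ? ? ?]]; first by rewrite /= add0r lexx.
  have [/= ? ? ? ?] := step_le _ (s n) (h0 n); rewrite hS; split.
  - by apply: le_trans (_ : (s n).1 <= _).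
  - by apply: le_trans (_ : _ <= (s n).1 + 2^-1 ^+ n) _.
  - by apply: le_trans (_ : (s n).2 <= _).
  - by apply: le_trans (_ : _ <= (s n).2 + 2^-1 ^+ n) _.
have sK n : K * (2^-1 ^+ n) ^+ 2 <= normc (mu (s n).1 (s n).2 (2^-1 ^+ n)).
  elim: n => [|n ih]; first by rewrite /= !expr1n mulr1.
  have := step_good _ (s n) (h0 n); rewrite /good hS -/(s n.+1) => hg.
  have : K * (2^-1 ^+ n) ^+ 2 <= 4 * normc (mu (s n.+1).1 (s n.+1).2 (2^-1 ^+ n / 2)).
    exact: le_trans hg.
  by rewrite expr_div_n; lra.
have [] := mu_loc x0 y0 _ _ (K / 2) _.
- have := hx0 0%N; have [] := sb 0%N; rewrite /= expr0; lra.
- have := hy0 0%N; have [] := sb 0%N; rewrite /= expr0; lra.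
- by rewrite divr_gt0.
move=> d d0 hd.
have [n hn] : exists n, 2^-1 ^+ n < d.
  have : (2^-1 : R) ^+ n @[n --> \oo] --> (0 : R) by apply: cvg_expr; rewrite ger0_norm//; lra.
  move=> /cvgrPdist_lt/(_ _ d0)[n _ hn]; exists n; have := hn n (leqnn n).
  by rewrite /= sub0r normrN ger0_norm// exprn_ge0.
have [? ? ? ?] := sb n.
have H : normc (mu (s n).1 (s n).2 (2^-1 ^+ n)) <= K / 2 * (2^-1 ^+ n) ^+ 2.
  by apply: hd => //; rewrite h0 hn.
have := le_trans (sK n) H; rewrite ler_pM2r ?exprn_gt0//; lra.
Qed.

End bisection.

(*@@P2c@@*)
Section trig_paths.
Context {R : realType}.
Local Notation C := R[i].

Lemma is_derive_linear (k x : R) : is_derive x 1 (fun t : R => k * t) k.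
Proof.
have := is_deriveM (is_derive_cst k x 1) (is_derive_id x (1 : R)).
by move=> h; apply: (is_derive_eq h); rewrite /GRing.scale/= mulr1 mulr0 addr0.
Qed.

Lemma is_derive_cosM (k x : R) : is_derive x 1 (fun t => cos (k * t)) (- k * sin (k * x)).
Proof.
have := @is_derive1_comp R cos (fun t => k * t) x _ _ (is_derive_cos _) (is_derive_linear k x).
by move=> h; apply: (is_derive_eq h); ring.
Qed.

Lemma is_derive_sinM (k x : R) : is_derive x 1 (fun t => sin (k * t)) (k * cos (k * x)).
Proof.
have := @is_derive1_comp R sin (fun t => k * t) x _ _ (is_derive_sin _) (is_derive_linear k x).
by move=> h; apply: (is_derive_eq h); ring.
Qed.

Definition cis (t : R) : C := Complex (cos t) (sin t).

Lemma normc_cis t : normc (cis t) = 1.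
Proof. by rewrite /= cos2Dsin2 sqrtr1. Qed.

Lemma cis0 : cis 0 = 1. Proof. by rewrite /cis cos0 sin0. Qed.

Lemma cis2pi : cis (2 * pi) = 1.
Proof. by rewrite /cis mulr_natl cos2pi sin2pi. Qed.

Lemma cder_cis (k x : R) :
  cder (fun t => cis (k * t)) x (Complex 0 k * cis (k * x)).
Proof.
split => /=; rewrite !mul0r ?sub0r ?add0r.
- by rewrite -mulNr; exact: is_derive_cosM.
- exact: is_derive_sinM.
Qed.

Lemma pcont_comp (F : C -> C) (g : R -> C) x :
  pcont g x -> ccont F (g x) -> pcont (fun t => F (g t)) x.
Proof.
move=> gc Fc e e0; have [d d0 hd] := Fc e e0.
have d2 : 0 < d / 2 by rewrite divr_gt0.
have [d' d'0 hd'] := gc _ d2.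
exists d' => // y /hd' h; apply: hd; rewrite (le_lt_trans h)//; lra.
Qed.

Lemma cdiff_quotient (F : C -> C) (z u l : C) : u != z -> cdiff_at F u l ->
  exists k, cdiff_at (fun w => F w / (w - z)) u k.
Proof.
move=> uz Fl; set v := u - z; have v0 : v != 0 by rewrite subr_eq0.
have nv : 0 < normc v by rewrite normc_gt0.
exists (l / v - F u / v ^+ 2) => e e0.
pose K := normc (F u) + normc l + 1.
have K0 : 0 < K by rewrite ltr_wpDl// addr_ge0// normc_ge0.
pose e1 := e * normc v / 8.
have e10 : 0 < e1 by rewrite !mulr_gt0.
have [d1 d10 h1] := Fl e1 e10.
pose d2 := Num.min (normc v / 2) (e * normc v ^+ 3 / (8 * K * (1 + normc v))).
have d20 : 0 < d2.
  by rewrite lt_min !divr_gt0//= ?mulr_gt0 ?exprn_gt0// ltr_wpDr// ltW.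
exists (Num.min d1 d2); first by rewrite lt_min d10.
move=> w; rewrite lt_min => /andP[/h1 {}h1].
rewrite lt_min ltr_pdivlMr// => /andP[h2 h3].
have wz : w - z = (w - u) + v by rewrite /v addrA subrK.
have nw : normc v / 2 <= normc (w - z).
  rewrite wz addrC -[w - u]opprK (le_trans _ (ler_dist_normc _ _))// normcN; lra.
have nw0 : 0 < normc (w - z) by rewrite (lt_le_trans _ nw)// divr_gt0.
have w0 : w - z != 0 by rewrite -normc_gt0.
set h := w - u in h1 h2 h3 wz *.
have -> : F w / (w - z) - F u / v - (l / v - F u / v ^+ 2) * h =
  (F w - F u - l * h) / (w - z) + h ^+ 2 * (F u / v ^+ 2 - l / v) / (w - z).
  move: w0; rewrite wz => w0; field; exact/andP.
rewrite (le_trans (ler_normcD _ _))// !normcM !normcV.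
have -> : e * normc h = e / 2 * normc h + e / 2 * normc h by rewrite -mulrDl -splitr.
have h0 := normc_ge0 h.
apply: lerD; rewrite ler_pdivrMr//.
  rewrite (le_trans h1)// [leRHS]mulrAC ler_wpM2r//.
  rewrite /e1; have : e * (normc v / 2) <= e * normc (w - z) by rewrite ler_wpM2l// ltW.
  have : 0 < e * normc v by rewrite mulr_gt0.
  lra.
have hb : normc (F u / v ^+ 2 - l / v) * normc v ^+ 2 <= K * (1 + normc v).
  rewrite -normcX -normcM mulrBl divfK ?expf_neq0// -mulrA (_ : v^-1 * v ^+ 2 = v); last first.
    by field.
  rewrite (le_trans (ler_normcB _ _))// normcM /K.
  have := normc_ge0 (F u); have := normc_ge0 l; have := ltW nv; nra.
set X := normc (F u / v ^+ 2 - l / v) in hb *.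
have hX : normc h * X <= e / 2 * normc (w - z).
  rewrite -(@ler_pM2r _ (normc v ^+ 2)) ?exprn_gt0// -[leLHS]mulrA.
  rewrite (le_trans (ler_wpM2l h0 hb))//.
  have : e / 2 * (normc v / 2) * normc v ^+ 2 <= e / 2 * normc (w - z) * normc v ^+ 2.
    by rewrite ler_wpM2r ?sqr_ge0// ler_wpM2l// ltW// divr_gt0.
  apply: le_trans; rewrite (_ : e / 2 * (normc v / 2) * normc v ^+ 2 =
    2 * (e * normc v ^+ 3 / 8)); last by field.
  have : 0 < e * normc v ^+ 3 by rewrite mulr_gt0 ?exprn_gt0.
  have : 8 * (normc h * (K * (1 + normc v))) < e * normc v ^+ 3.
    move: h3; rewrite ltr_pdivlMr ?mulr_gt0// ?ltr_wpDr ?(ltW nv)// => h3.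
    by apply: le_lt_trans h3; rewrite le_eqVlt; apply/orP; left; apply/eqP; ring.
  lra.
by rewrite -mulrA mulrC [leRHS]mulrAC ler_wpM2r.
Qed.

End trig_paths.

(*@@P2d@@*)
Section cauchy_formula.
Context {R : realType}.
Local Notation C := R[i].

Definition quad_prim (A B u0 u : C) : C := A * u + B / 2 * ((u - u0) * (u - u0)).

(* increments of a primitive of H(w) w' along a short path w *)
Lemma edge_estimate (H : C -> C) (w dw : R -> C) (T : R -> C) (A B u0 : C)
    (a b e D L : R) : a <= b -> 0 <= e ->
  (forall x, a <= x <= b -> cder w x (dw x)) ->
  (forall x, a <= x <= b -> cder T x (H (w x) * dw x)) ->
  (forall x, a <= x <= b -> normc (w x - u0) <= D) ->
  (forall x, a <= x <= b -> normc (dw x) <= L) ->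
  (forall x, a <= x <= b ->
     normc (H (w x) - A - B * (w x - u0)) <= e * normc (w x - u0)) ->
  normc (T b - T a - (quad_prim A B u0 (w b) - quad_prim A B u0 (w a))) <= 2 * (e * D * L) * (b - a).
Proof.
move=> ab e0 hw hT hD hL hH; set pol := quad_prim A B u0.
rewrite (_ : T b - T a - (pol (w b) - pol (w a)) =
   (T b - pol (w b)) - (T a - pol (w a))); last by ring.
apply: (@cincrement_le _ (fun x => T x - pol (w x))
  (fun x => (H (w x) - A - B * (w x - u0)) * dw x)) => // x xab.
  have hwu : cder (fun x => w x - u0) x (dw x).
    by apply: cderE (cderB (hw x xab) (cder_cst u0 x)) _; rewrite subr0.
  apply: cderE (cderB (hT x xab) (cderD (cderZ A (hw x xab))
    (cderZ (B / 2) (cderM hwu hwu)))) _.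
  by field.
rewrite normcM ler_pM ?normc_ge0 ?hL// (le_trans (hH x xab))//.
by rewrite ler_wpM2l ?hD.
Qed.

Lemma clipschitz (w dw : R -> C) (L a b : R) :
  (forall x, cder w x (dw x)) -> (forall x, normc (dw x) <= L) ->
  normc (w b - w a) <= 2 * L * `|b - a|.
Proof.
move=> hw hL; wlog ab : a b / a <= b.
  by move=> h; case: (leP a b) => [/h//|/ltW/h]; rewrite normc_distC distrC.
by rewrite ger0_norm ?subr_ge0//; apply: (cincrement_le ab) => x _; [exact: hw|exact: hL].
Qed.

Context (F : C -> C) (rho r : R) (z : C).
Hypothesis Fdiff : forall u, normc u < rho -> exists l, cdiff_at F u l.
Hypothesis rrho : r < rho.
Hypothesis zr : normc z < r.

Definition tau : C := Complex 0 (2 * pi).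
Definition zeta (y : R) : C := r%:C%C * cis (2 * pi * y).

Let r0 : 0 < r. Proof. exact: le_lt_trans (normc_ge0 z) zr. Qed.

Lemma normc_zeta y : normc (zeta y) = r.
Proof. by rewrite normcM normc_cis mulr1 normc_real ger0_norm// ltW. Qed.

Lemma normc_tau : normc tau = 2 * pi.
Proof. by rewrite /= expr0n add0r sqrtr_sqr ger0_norm// mulr_ge0// pi_ge0. Qed.

Lemma zeta_neq y : zeta y - z != 0.
Proof.
rewrite subr_eq0; apply/eqP => h; move: zr; rewrite -h normc_zeta ltxx//.
Qed.

Lemma cder_zeta y : cder zeta y (tau * zeta y).
Proof.
apply: cderE (cderZ r%:C%C (cder_cis (2 * pi) y)) _.
by rewrite /zeta mulrCA.
Qed.

Lemma zeta01 : zeta 1 = zeta 0.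
Proof. by rewrite /zeta mulr1 mulr0 cis0 cis2pi. Qed.

Section homotopy.
Variable l1 : R.
Hypothesis l1_01 : 0 < l1 < 1.

Let lam (x : R) : R := ((1 + l1) - (1 - l1) * cos (pi * x)) / 2.
Let dlam (x : R) : R := (1 - l1) / 2 * (pi * sin (pi * x)).

Let lam_bound x : l1 <= lam x <= 1.
Proof.
have /andP[? ?] := l1_01; have c1 := cos_geN1 (pi * x); have c2 := cos_le1 (pi * x).
rewrite /lam; apply/andP; split; nra.
Qed.

Let is_derive_lam (x : R) : is_derive x 1 lam (dlam x).
Proof.
have h := is_deriveM (is_derive_cst ((1 - l1) / 2) x 1) (is_derive_cosM pi x).
have := is_deriveB (is_derive_cst ((1 + l1) / 2) x 1) h.
rewrite (_ : _ - _ = lam); last first.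
  by apply/funext => t; rewrite /lam/= !fctE; field.
by move=> h'; apply: (is_derive_eq h'); rewrite /dlam /GRing.scale/=; ring.
Qed.

Let psi x y := z + (lam x)%:C%C * (zeta y - z).
Let dpsix x y := (dlam x)%:C%C * (zeta y - z).
Let dpsiy x y := (lam x)%:C%C * (tau * zeta y).
Let L := 2 * pi * r.

Let L0 : 0 < L. Proof. by rewrite !mulr_gt0// pi_gt0. Qed.

Let psix x y : cder (psi^~ y) x (dpsix x y).
Proof.
have h : cder (fun=> zeta y - z) x 0 by exact: cder_cst.
apply: cderE (cderD (cder_cst z x) (cderM (cder_real (is_derive_lam x)) h)) _.
by rewrite mulr0 addr0 add0r.
Qed.

Let psiy x y : cder (psi x) y (dpsiy x y).
Proof.
have h := cderB (cder_zeta y) (cder_cst z y).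
apply: cderE (cderD (cder_cst z y) (cderZ (lam x)%:C%C h)) _.
by rewrite add0r subr0.
Qed.

Let lam_ge0 x : 0 <= lam x.
Proof. by have /andP[? ?] := l1_01; have /andP[? ?] := lam_bound x; lra. Qed.

Let dpsix_le x y : normc (dpsix x y) <= L.
Proof.
have [/andP[? ?] pi0 s1 s2] : [/\ 0 < l1 < 1, 0 < pi :> R, -1 <= sin (pi * x) & sin (pi * x) <= 1].
  by split; rewrite ?pi_gt0// ?sin_geN1 ?sin_le1.
have dl : `|dlam x| <= pi.
  rewrite /dlam normrM [`|pi * _|]normrM [`|pi|]gtr0_norm// ger0_norm; last by rewrite divr_ge0//; lra.
  have : `|sin (pi * x)| <= 1 by rewrite ler_norml s1.
  move=> hs; have := normr_ge0 (sin (pi * x)); move: hs; set s := `|_| => hs hs0.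
  have : pi * s <= pi by rewrite ler_piMr// ltW.
  have : 0 <= pi * s by rewrite mulr_ge0// ltW.
  by move=> ? ?; nra.
rewrite normcM normc_real (le_trans (ler_wpM2l (normr_ge0 _) (ler_normcB _ _)))//.
rewrite normc_zeta /L (@le_trans _ _ (pi * (r + normc z)))//.
  by rewrite ler_wpM2r// addr_ge0 ?normc_ge0// ltW.
by rewrite [2 * _]mulrC -mulrA ler_wpM2l ?(ltW pi0)//; have := zr; lra.
Qed.

Let dpsiy_le x y : normc (dpsiy x y) <= L.
Proof.
rewrite normcM [normc (tau * _)]normcM normc_real normc_zeta normc_tau /L ger0_norm//.
by rewrite ler_piMl ?(ltW L0)//; have /andP[] := lam_bound x.
Qed.

Let psi_in x y : normc (psi x y) < rho.
Proof.
rewrite /psi (_ : _ + _ = (1 - lam x)%:C%C * z + (lam x)%:C%C * zeta y); last first.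
  by rewrite rmorphB/= rmorph1; ring.
have /andP[? l_1] := lam_bound x.
rewrite (le_lt_trans (ler_normcD _ _))// [normc (_ * z)]normcM [normc (_ * zeta y)]normcM
  !normc_real normc_zeta.
rewrite !ger0_norm ?subr_ge0// (le_lt_trans _ rrho)//.
have := lam_ge0 x; have := zr; nra.
Qed.

Let psi_neq x y : psi x y != z.
Proof.
rewrite -subr_eq0 /psi addrAC subrr add0r mulf_neq0 ?zeta_neq//.
rewrite (fmorph_eq0 (@real_complex R)) gt_eqF//.
by have /andP[? ?] := l1_01; have /andP[? ?] := lam_bound x; lra.
Qed.

Let H u := F u / (u - z).

Let Hdiff x y : exists k, cdiff_at H (psi x y) k.
Proof. by have [l hl] := Fdiff (psi_in x y); exact: cdiff_quotient hl. Qed.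

Let Hcont x y : ccont H (psi x y).
Proof. by have [k hk] := Hdiff x y; exact: cdiff_ccont hk. Qed.

Let gx y x := H (psi x y) * dpsix x y.
Let gy x y := H (psi x y) * dpsiy x y.

Let gx_cont y x : pcont (gx y) x.
Proof.
apply: pcontM; first exact: pcont_comp (cder_pcont (psix x y)) (Hcont x y).
apply: pcontM; last exact: pcont_cst.
have h := is_deriveM (is_derive_cst ((1 - l1) / 2 * pi) x 1) (is_derive_sinM pi x).
have := cder_pcont (cder_real h); congr (pcont _ _).
by apply/funext => t; rewrite /dlam mulrA.
Qed.

Let gy_cont x y : pcont (gy x) y.
Proof.
apply: pcontM; first exact: pcont_comp (cder_pcont (psiy x y)) (Hcont x y).
apply: pcontM; first exact: pcont_cst.
by apply: pcontM; [exact: pcont_cst|exact: cder_pcont (cder_zeta y)].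
Qed.

Let P y := cprim (gx y).
Let Q x := cprim (gy x).
Let mu x y h := (P y (x + h) - P y x) + (Q (x + h) (y + h) - Q (x + h) y)
  - (P (y + h) (x + h) - P (y + h) x) - (Q x (y + h) - Q x y).

Let mu_local x0 y0 : 0 <= x0 <= 1 -> 0 <= y0 <= 1 -> forall e, 0 < e ->
  exists2 d, 0 < d & forall x y h, 0 <= x -> x + h <= 1 -> 0 <= y -> y + h <= 1 ->
    x <= x0 <= x + h -> y <= y0 <= y + h -> 0 < h < d ->
    normc (mu x y h) <= e * h ^+ 2.
Proof.
move=> x001 y001 e e0.
have [B hB] := Hdiff x0 y0; set u0 := psi x0 y0 in hB.
pose e' := e / (32 * L ^+ 2).
have e'0 : 0 < e' by apply: divr_gt0 => //; apply: mulr_gt0 => //; exact: exprn_gt0.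
have [d' d'0 hd'] := hB _ e'0.
have L40 : 0 < 4 * L by exact: mulr_gt0.
exists (d' / (4 * L)); first exact: divr_gt0.
move=> x y h x_ge0 xh1 y_ge0 yh1 hx hy /andP[h0].
rewrite ltr_pdivlMr// => hd.
have near x' y' : x <= x' <= x + h -> y <= y' <= y + h -> normc (psi x' y' - u0) <= 4 * L * h.
  move=> /andP[x1 x2] /andP[y1 y2]; move: hx hy => /andP[x3 x4] /andP[y3 y4].
  have -> : psi x' y' - u0 = (psi x' y' - psi x0 y') + (psi x0 y' - u0) by rewrite addrA subrK.
  have hx' : `|x' - x0| <= h by rewrite ler_norml; apply/andP; split; lra.
  have hy' : `|y' - y0| <= h by rewrite ler_norml; apply/andP; split; lra.
  rewrite (le_trans (ler_normcD _ _))//.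
  rewrite (le_trans (lerD (clipschitz x0 x' (psix^~ y') (dpsix_le^~ y'))
    (clipschitz y0 y' (psiy x0) (dpsiy_le x0))))//.
  have -> : 4 * L * h = 2 * L * h + 2 * L * h by ring.
  by rewrite lerD// ler_wpM2l// mulr_ge0// ltW.
have near2 x' y' : x <= x' <= x + h -> y <= y' <= y + h ->
   normc (H (psi x' y') - H u0 - B * (psi x' y' - u0)) <= e' * normc (psi x' y' - u0).
  move=> x'h y'h; apply: hd'; rewrite (le_lt_trans (near _ _ x'h y'h))//; lra.
have xle : x <= x + h by rewrite lerDl ltW.
have yle : y <= y + h by rewrite lerDl ltW.
pose pol := quad_prim (H u0) B u0.
have edge_x y' : y <= y' <= y + h ->
   normc (P y' (x + h) - P y' x - (pol (psi (x + h) y') - pol (psi x y')))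
     <= 2 * (e' * (4 * L * h) * L) * h.
  move=> hy'; have -> : 2 * (e' * (4 * L * h) * L) * h = 2 * (e' * (4 * L * h) * L) * (x + h - x).
    by rewrite addrAC subrr add0r.
  apply: (edge_estimate (H := H) (w := psi^~ y') (dw := dpsix^~ y')) => //.
  - exact: ltW.
  - move=> t ht; apply: cprim_cder; first exact: gx_cont.
    by move: ht => /andP[? ?]; apply/andP; split; lra.
  - by move=> t ht; exact: near.
  - by move=> t ht; exact: near2.
have edge_y x' : x <= x' <= x + h ->
   normc (Q x' (y + h) - Q x' y - (pol (psi x' (y + h)) - pol (psi x' y)))
     <= 2 * (e' * (4 * L * h) * L) * h.
  move=> hx'; have -> : 2 * (e' * (4 * L * h) * L) * h = 2 * (e' * (4 * L * h) * L) * (y + h - y).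
    by rewrite addrAC subrr add0r.
  apply: (edge_estimate (H := H) (w := psi x') (dw := dpsiy x')) => //.
  - exact: ltW.
  - move=> t ht; apply: cprim_cder; first exact: gy_cont.
    by move: ht => /andP[? ?]; apply/andP; split; lra.
  - by move=> t ht; exact: near.
  - by move=> t ht; exact: near2.
have -> : mu x y h =
   (P y (x + h) - P y x - (pol (psi (x + h) y) - pol (psi x y)))
 + (Q (x + h) (y + h) - Q (x + h) y - (pol (psi (x + h) (y + h)) - pol (psi (x + h) y)))
 - (P (y + h) (x + h) - P (y + h) x - (pol (psi (x + h) (y + h)) - pol (psi x (y + h))))
 - (Q x (y + h) - Q x y - (pol (psi x (y + h)) - pol (psi x y))).
  by rewrite /mu; ring.
have hxl : x <= x <= x + h by rewrite lexx.
have hxr : x <= x + h <= x + h by rewrite lexx andbT.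
have hyl : y <= y <= y + h by rewrite lexx.
have hyr : y <= y + h <= y + h by rewrite lexx andbT.
rewrite (le_trans (ler_normcB _ _))//.
rewrite (le_trans (lerD (le_trans (ler_normcB _ _) (lerD (ler_normcD _ _) (lexx _))) (lexx _)))//.
rewrite (le_trans (lerD (lerD (lerD (edge_x _ hyl) (edge_y _ hxr)) (edge_x _ hyr)) (edge_y _ hxl)))//.
rewrite le_eqVlt; apply/orP; left; apply/eqP; rewrite /e'; field.
by rewrite gt_eqF.
Qed.

Lemma homotopy_eq : Q 1 1 - Q 1 0 = Q 0 1 - Q 0 0.
Proof.
have := @bisection_vanish R mu _ mu_local.
rewrite /mu !add0r => mu0; apply/eqP; rewrite -subr_eq0; apply/eqP.
have P01 : P 1 = P 0.
  by rewrite /P; congr cprim; apply/funext => x; rewrite /gx /psi /dpsix zeta01.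
rewrite -[RHS]mu0.
  by rewrite P01; ring.
move=> x y h h0.
have ex : x + h / 2 + h / 2 = x + h by rewrite -addrA -splitr.
have ey : y + h / 2 + h / 2 = y + h by rewrite -addrA -splitr.
by rewrite ex ey; ring.
Qed.


Definition kern (y : R) : C := tau * zeta y / (zeta y - z).

Lemma homotopy_cprim :
  cprim (fun y => F (zeta y) * kern y) 1 - cprim (fun y => F (zeta y) * kern y) 0 =
  cprim (fun y => F (z + l1%:C%C * (zeta y - z)) * kern y) 1
  - cprim (fun y => F (z + l1%:C%C * (zeta y - z)) * kern y) 0.
Proof.
have l10 : l1%:C%C != 0 :> C.
  by have /andP[h _] := l1_01; rewrite (fmorph_eq0 (@real_complex R)) gt_eqF.
have lam1 : lam 1 = 1.
  by rewrite /lam mulr1 cospi; field.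
have lam0 : lam 0 = l1 by rewrite /lam mulr0 cos0; field.
have h1 : gy 1 = (fun y => F (zeta y) * kern y).
  apply/funext => y; rewrite /gy /dpsiy /H /psi lam1 rmorph1 !mul1r /kern.
  by rewrite (addrC z) subrK mulrAC !mulrA.
have h0 : gy 0 = (fun y => F (z + l1%:C%C * (zeta y - z)) * kern y).
  apply/funext => y; rewrite /gy /dpsiy /H /psi lam0 /kern.
  by field; rewrite zeta_neq/= addrAC subrr add0r; apply: mulf_neq0; [exact: l10|exact: zeta_neq].
by have := homotopy_eq; rewrite /Q h1 h0.
Qed.

End homotopy.

Lemma pcont_bounded (g : R -> C) : (forall x, pcont g x) ->
  exists2 M : R, 0 <= M & forall x, 0 <= x <= 1 -> normc (g x) <= M.
Proof.
move=> cg; have [] := @EVT_max R (fun x => normc (g x)) 0 1 ler01.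
  apply: continuous_subspaceT => x; apply/cvgrPdist_le => e e0.
  have [d d0 hd] := cg x e e0; exists d => //= y; rewrite /ball_/= distrC => /hd h.
  by rewrite distrC (le_trans (ler_dist_dist_normc _ _)).
move=> c _ hc; exists (normc (g c)); first exact: normc_ge0.
by move=> x x01; apply: hc; rewrite in_itv.
Qed.

Let Fin u : normc u <= r -> ccont F u.
Proof.
by move=> ur; have [l hl] := Fdiff (le_lt_trans ur rrho); exact: cdiff_ccont hl.
Qed.

Let zeta_cont y : pcont zeta y. Proof. exact: cder_pcont (cder_zeta y). Qed.

Definition zinv (y : R) : C := (r^-1)%:C%C * cis (- (2 * pi) * y).

Lemma zetaK y : zeta y * zinv y = 1.
Proof.
rewrite /zeta /zinv mulrACA -rmorphM/= divff ?gt_eqF// mul1r /cis mulNr.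
apply/eqP; rewrite eq_complex/= cosN sinN; have := cos2Dsin2 (2 * pi * y).
move: (cos _) (sin _) => c s cs; rewrite -cs; apply/andP; split; apply/eqP; ring.
Qed.

Lemma zinvE y : zinv y = (zeta y)^-1.
Proof.
have z0 : zeta y != 0 by rewrite -normc_gt0 normc_zeta.
by apply: (mulfI z0); rewrite zetaK divff.
Qed.

Lemma cder_zinv y : cder zinv y (- tau * zinv y).
Proof.
apply: cderE (cderZ (r^-1)%:C%C (cder_cis (- (2 * pi)) y)) _.
rewrite /zinv mulrCA; congr (_ * _).
by apply/eqP; rewrite eq_complex/= oppr0 !eqxx.
Qed.

Lemma cder_zinvX n y : cder (fun t => (z * zinv t) ^+ n) y (- n%:R * tau * (z * zinv y) ^+ n).
Proof.
elim: n => [|n ih].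
  by rewrite mulr0n oppr0 !mul0r; under eq_fun do rewrite expr0; exact: cder_cst.
under eq_fun do rewrite exprS.
apply: cderE (cderM (cderZ z (cder_zinv y)) ih) _.
by rewrite exprS -[n.+1]addn1 natrD; ring.
Qed.

Let q := normc z / r.
Let q01 : 0 <= q < 1.
Proof. by rewrite divr_ge0 ?normc_ge0 ?ltW//= ltr_pdivrMr// mul1r. Qed.

Let zinv_q y : normc (z * zinv y) = q.
Proof. by rewrite normcM zinvE normcV normc_zeta. Qed.

Lemma kern_expand n y : kern y - \sum_(k < n) tau * (z * zinv y) ^+ k = (z * zinv y) ^+ n * kern y.
Proof.
have z0 : zeta y != 0 by rewrite -normc_gt0 normc_zeta.
have h1 : 1 - z * zinv y != 0.
  by rewrite zinvE -(divff z0) -mulrBl mulf_neq0 ?invr_eq0// zeta_neq.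
have hk : kern y * (1 - z * zinv y) = tau.
  by rewrite /kern zinvE; field; rewrite z0 zeta_neq.
apply: (mulIf h1); rewrite -mulr_sumr mulrBl hk -[_ * kern y * _]mulrA hk -mulrA [_ * (1 - _)]mulrC.
by rewrite -[1 - z * _]opprB mulNr -subrX1; ring.
Qed.

Lemma kern_cont y : pcont kern y.
Proof.
have [k hk] : exists k, cdiff_at (fun u => tau * u) (zeta y) k.
  exists tau => e e0; exists 1 => // w _.
  by rewrite -mulrBr -mulrBr subrr mulr0 normc0 mulr_ge0 ?normc_ge0// ltW.
have [|k' hk'] := @cdiff_quotient R _ z _ _ _ hk; first by rewrite -subr_eq0 zeta_neq.
exact: (@pcont_comp R (fun u => tau * u / (u - z))) (zeta_cont y) (cdiff_ccont hk').
Qed.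

Definition cint (g : R -> C) : C := cprim g 1 - cprim g 0.

End cauchy_formula.

Lemma geometric_squeeze {R : realType} (x K q : R) : 0 <= q < 1 ->
  (forall n, x <= K * q ^+ n) -> x <= 0.
Proof.
move=> /andP[q0 q1] hX; rewrite leNgt; apply/negP => x0.
have K0 : 0 < `|K| + 1 by rewrite ltr_wpDl.
have : q ^+ n @[n --> \oo] --> (0 : R) by apply: cvg_expr; rewrite ger0_norm.
move=> /cvgrPdist_lt/(_ _ (divr_gt0 x0 K0))[n _ hn]; have := hn n (leqnn n).
rewrite /= sub0r normrN ger0_norm ?exprn_ge0// ltr_pdivlMr// => h.
have := hX n; have := ler_norm K; have : 0 <= q ^+ n by rewrite exprn_ge0.
nra.
Qed.

Section cauchy_expansion.
Context {R : realType}.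
Local Notation C := R[i].
Context (F : C -> C) (rho r : R) (z : C).
Hypothesis Fdiff : forall u, normc u < rho -> exists l, cdiff_at F u l.
Hypothesis rrho : r < rho.
Hypothesis zr : normc z < r.

Local Notation zeta := (zeta r).
Local Notation kern := (kern r z).
Local Notation zinv := (zinv r).

Let r0 : 0 < r. Proof. exact: le_lt_trans (normc_ge0 z) zr. Qed.

Let q := normc z / r.
Let q01 : 0 <= q < 1.
Proof. by rewrite divr_ge0 ?normc_ge0 ?ltW//= ltr_pdivrMr// mul1r. Qed.

Let zinv_q y : normc (z * zinv y) = q.
Proof. by rewrite normcM (zinvE zr) normcV (normc_zeta zr). Qed.

Let kern_bounded : exists2 K : R, 0 <= K & forall y, 0 <= y <= 1 -> normc (kern y) <= K.
Proof. by apply: pcont_bounded => y; exact: (kern_cont zr). Qed.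

Let zinv01 : zinv 1 = zinv 0.
Proof. by rewrite !(zinvE zr) zeta01. Qed.

Lemma cint_kern : cint kern = tau.
Proof.
have [K K0 hK] := kern_bounded.
apply/eqP; rewrite -subr_eq0 -normc_eq0 eq_le normc_ge0 andbT.
apply: (@geometric_squeeze _ _ (2 * (q * K)) q) => // n.
pose G t := cprim kern t - (tau * t%:C%C
   - \sum_(k < n) (k.+1%:R)^-1 * (z * zinv t) ^+ k.+1).
have -> : cint kern - tau = G 1 - G 0.
  by rewrite /G /cint zinv01 rmorph1 rmorph0; ring.
have := @cincrement_le _ G (fun y => (z * zinv y) ^+ n.+1 * kern y) 0 1 (q ^+ n.+1 * K) ler01.
rewrite subr0 mulr1 exprS (_ : 2 * (q * K) * q ^+ n = 2 * (q * q ^+ n * K)); last by ring.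
apply => y y01.
  have h1 := cprim_cder (kern_cont zr) y01.
  have h2 := cderZ tau (cder_real (is_derive_id y (1 : R))).
  have h3 := cder_sum (G := fun k t => (k.+1%:R)^-1 * (z * zinv t) ^+ k.+1) n
      (fun k => cderZ (k.+1%:R)^-1 (cder_zinvX r z k.+1 y)).
  apply: cderE (cderB h1 (cderB h2 h3)) _.
  rewrite -(kern_expand zr) big_ord_recl/= expr0 mulr1.
  congr (_ - _); congr (_ + _); rewrite -sumrN; apply: eq_bigr => k _.
  by rewrite /bump/= add1n !mulNr mulrN opprK !mulrA mulVf ?mul1r.
rewrite normcM normcX zinv_q -exprS ler_wpM2l ?hK// exprn_ge0//.
by have /andP[] := q01.
Qed.

Let Fin u : normc u <= r -> ccont F u.
Proof.
by move=> ur; have [l hl] := Fdiff (le_lt_trans ur rrho); exact: cdiff_ccont hl.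
Qed.

Let Fzeta_cont y : pcont (fun y => F (zeta y)) y.
Proof.
apply: pcont_comp; first exact: cder_pcont (cder_zeta r y).
by apply: Fin; rewrite (normc_zeta zr).
Qed.

Lemma cauchy_formula : cint (fun y => F (zeta y) * kern y) = F z * tau.
Proof.
have [K K0 hK] := kern_bounded.
rewrite -cint_kern; apply/eqP; rewrite -subr_eq0 -normc_eq0 eq_le normc_ge0 andbT.
apply/ler_addgt0Pl => e e0; rewrite addr0.
pose e' := e / (2 * (K + 1)).
have K1 : 0 < K + 1 by rewrite ltr_wpDl.
have e'0 : 0 < e' by rewrite divr_gt0// mulr_gt0.
have [d d0 hd] := Fin (ltW zr) e'0.
pose l1 := Num.min 2^-1 (d / (4 * r)).
have l10 : 0 < l1 by rewrite lt_min invr_gt0 ltr0n/= divr_gt0// mulr_gt0.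
have l1_01 : 0 < l1 < 1 by rewrite l10 gt_min invf_lt1// ltr1n.
have l1d : l1 * (2 * r) < d.
  have : l1 <= d / (4 * r) by rewrite ge_min lexx orbT.
  by rewrite ler_pdivlMr ?mulr_gt0// => h; have := mulr_gt0 l10 r0; lra.
pose p y := z + l1%:C%C * (zeta y - z).
have pz y : normc (p y - z) < d.
  rewrite /p addrC addKr normcM normc_real gtr0_norm// (le_lt_trans _ l1d)//.
  rewrite ler_wpM2l ?(ltW l10)// (le_trans (ler_normcB _ _))// (normc_zeta zr).
  by have := zr; lra.
have p_in y : normc (p y) <= r.
  rewrite /p (_ : _ + _ = (1 - l1)%:C%C * z + l1%:C%C * zeta y); last first.
    by rewrite rmorphB/= rmorph1; ring.
  rewrite (le_trans (ler_normcD _ _))// [normc (_ * z)]normcM [normc (_ * zeta y)]normcM.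
  rewrite !normc_real (normc_zeta zr); have /andP[? ?] := l1_01.
  by rewrite !ger0_norm ?subr_ge0 ?ltW//; have := zr; nra.
have pcont_p y : pcont (fun y => F (p y)) y.
  apply: pcont_comp; last exact: Fin.
  have h := cderB (cder_zeta r y) (cder_cst z y).
  exact: cder_pcont (cderD (cder_cst z y) (cderZ l1%:C%C h)).
rewrite /cint (homotopy_cprim Fdiff rrho zr l1_01).
pose G t := cprim (fun y => F (p y) * kern y) t - F z * cprim kern t.
rewrite (_ : _ - _ = G 1 - G 0); last by rewrite /G; ring.
apply: le_trans (@cincrement_le _ G (fun y => (F (p y) - F z) * kern y) 0 1 (e' * K) ler01 _ _) _.
- move=> y y01; rewrite mulrBl.
  apply: cderB; last exact: cderZ (cprim_cder (kern_cont zr) y01).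
  apply: cprim_cder => // t; apply: pcontM => //; exact: (kern_cont zr).
- move=> y y01; rewrite normcM ler_pM ?normc_ge0 ?hK//.
  exact: hd.
rewrite subr0 mulr1 /e' (_ : 2 * _ = e * (K / (K + 1))); last by field; rewrite gt_eqF.
by rewrite ler_piMr ?(ltW e0)// ler_pdivrMr// mul1r lerDl.
Qed.

Lemma cauchy_expansion : exists2 K : R, 0 <= K & forall n,
  normc (F z - \sum_(k < n) cint (fun y => F (zeta y) * zinv y ^+ k) * z ^+ k) <= K * q ^+ n.
Proof.
have [K K0 hK] := kern_bounded.
have [M M0 hM] := pcont_bounded Fzeta_cont.
exists (2 * (M * K) / (2 * pi)).
  by rewrite divr_ge0 ?mulr_ge0 ?pi_ge0.
have zinv_cont k y : pcont (fun y => zinv y ^+ k) y.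
  elim: k => [|k ih]; first by under eq_fun do rewrite expr0; exact: pcont_cst.
  by under eq_fun do rewrite exprS; apply: pcontM => //; exact: cder_pcont (cder_zinv r y).
move=> n.
pose c k := fun y => F (zeta y) * zinv y ^+ k.
have cc k t : pcont (c k) t by apply: pcontM.
pose G t := cprim (fun y => F (zeta y) * kern y) t - \sum_(k < n) (tau * z ^+ k) * cprim (c k) t.
have tpos : 0 < 2 * pi :> R by rewrite mulr_gt0// pi_gt0.
rewrite mulrAC ler_pdivlMr// mulrC -normc_tau -normcM.
have -> : tau * (F z - \sum_(k < n) cint (fun y => F (zeta y) * zinv y ^+ k) * z ^+ k) = G 1 - G 0.
  rewrite mulrBr mulrC -cauchy_formula /G /cint.
  rewrite [RHS](_ : _ = cprim (fun y => F (zeta y) * kern y) 1 - cprim (fun y => F (zeta y) * kern y) 0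
    - (\sum_(k < n) (tau * z ^+ k) * cprim (c k) 1 - \sum_(k < n) (tau * z ^+ k) * cprim (c k) 0)); last by ring.
  congr (_ - _); rewrite -sumrB mulr_sumr; apply: eq_bigr => k _.
  by rewrite -/(c k); ring.
have := @cincrement_le _ G (fun y => F (zeta y) * ((z * zinv y) ^+ n * kern y)) 0 1 (M * (q ^+ n * K)) ler01.
rewrite subr0 mulr1 (_ : 2 * (M * K) * q ^+ n = 2 * (M * (q ^+ n * K))); last by ring.
apply => y y01.
  rewrite -(kern_expand zr) mulrBr; apply: cderB.
    by apply: cprim_cder => // t; apply: pcontM => //; exact: (kern_cont zr).
  apply: cderE (cder_sum (G := fun k t => (tau * z ^+ k) * cprim (c k) t) n
      (fun k => cderZ (tau * z ^+ k) (cprim_cder (cc k) y01))) _.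
  rewrite mulr_sumr; apply: eq_bigr => k _; rewrite /c [in RHS]exprMn; move: (z ^+ k) (zinv y ^+ k) => a b; ring.
rewrite normcM ler_pM ?normc_ge0 ?hM// normcM normcX zinv_q ler_wpM2l ?hK// exprn_ge0//.
by have /andP[] := q01.
Qed.

End cauchy_expansion.

(*@@P3a@@*)
Section power_series.
Context {R : realType}.
Local Notation C := R[i].
Implicit Types (a b : nat -> C) (F : C -> C) (rad M s : R).

Definition psum a n z : C := \sum_(k < n) a k * z ^+ k.

Definition has_ps a rad F := forall z, normc z < rad -> forall e : R, 0 < e ->
  exists N, forall n, (N <= n)%N -> normc (F z - psum a n z) <= e.

Lemma has_psW a rad rad' F : rad' <= rad -> has_ps a rad F -> has_ps a rad' F.
Proof. by move=> le h z zr; apply: h; exact: lt_le_trans le. Qed.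

Lemma holomorphic_has_ps_small F (rho r : R) :
  (forall u, normc u < rho -> exists l, cdiff_at F u l) -> r < rho ->
  exists a, has_ps a r F.
Proof.
move=> hF rrho.
exists (fun k => cint (fun y => F (zeta r y) * zinv r y ^+ k)) => z zr e e0.
have [K K0 hK] := cauchy_expansion hF rrho zr.
have r0 : 0 < r by exact: le_lt_trans (normc_ge0 z) zr.
have q0 : 0 <= normc z / r by rewrite divr_ge0 ?normc_ge0 ?ltW.
have : (normc z / r) ^+ n @[n --> \oo] --> (0 : R).
  by apply: cvg_expr; rewrite ger0_norm// ltr_pdivrMr// mul1r.
have K1 : 0 < K + 1 by rewrite ltr_wpDl.
move=> /cvgrPdist_le/(_ _ (divr_gt0 e0 K1))[N _ hN]; exists N => n /hN.
rewrite /= sub0r normrN ger0_norm ?exprn_ge0// ler_pdivlMr// => h.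
rewrite (le_trans (hK n))//; have : 0 <= (normc z / r) ^+ n by rewrite exprn_ge0.
by move: h; set x := _ ^+ n => h x0; nra.
Qed.

Lemma has_ps_coef_bounded a rad F s : has_ps a rad F -> 0 < s -> s < rad ->
  exists2 T : R, 0 <= T & forall k, normc (a k) * s ^+ k <= T.
Proof.
move=> hF s0 srad; have ns : normc (s%:C%C : C) = s by rewrite normc_real gtr0_norm.
have [|N hN] := hF s%:C%C _ 1 ltr01; first by rewrite ns.
exists (2 + \sum_(k < N) normc (a k) * s ^+ k).
  by rewrite addr_ge0// sumr_ge0// => k _; rewrite mulr_ge0 ?normc_ge0 ?exprn_ge0 ?ltW.
move=> k; have [Nk|kN] := leqP N k.
  rewrite -[leLHS]addr0 lerD//; last first.
    by rewrite sumr_ge0// => j _; rewrite mulr_ge0 ?normc_ge0 ?exprn_ge0 ?ltW.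
  have -> : normc (a k) * s ^+ k = normc (psum a k.+1 s%:C%C - psum a k s%:C%C).
    by rewrite /psum big_ord_recr/= addrAC subrr add0r normcM normcX ns.
  rewrite (_ : _ - _ = (F s%:C%C - psum a k s%:C%C) - (F s%:C%C - psum a k.+1 s%:C%C)); last by ring.
  rewrite (le_trans (ler_normcB _ _))// (_ : 2 = 1 + 1 :> R)// lerD ?hN//.
  exact: leqW.
rewrite (bigD1 (Ordinal kN))//= addrCA lerDl addr_ge0// sumr_ge0// => j _.
by rewrite mulr_ge0 ?normc_ge0 ?exprn_ge0 ?ltW.
Qed.

Lemma psum_tail a (s T : R) z n m : 0 < s -> (forall k, normc (a k) * s ^+ k <= T) ->
  normc z < s -> (n <= m)%N ->
  normc (psum a m z - psum a n z) <= T * ((normc z / s) ^+ n / (1 - normc z / s)).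
Proof.
move=> s0 hT zs nm; have q0 : 0 <= normc z / s by rewrite divr_ge0 ?normc_ge0 ?ltW.
have q1 : normc z / s < 1 by rewrite ltr_pdivrMr// mul1r.
have T0 : 0 <= T by apply: le_trans (hT 0%N); rewrite mulr_ge0 ?normc_ge0.
rewrite -(subnKC nm) /psum big_split_ord/= addrAC subrr add0r.
rewrite (le_trans (ler_normc_sum _ _ _))//.
apply: (@le_trans _ _ (\sum_(i < m - n) T * ((normc z / s) ^+ n * (normc z / s) ^+ i))).
  apply: ler_sum => i _; rewrite normcM normcX -exprD expr_div_n mulrA ler_pdivlMr ?exprn_gt0//.
  by rewrite mulrAC ler_wpM2r ?exprn_ge0 ?normc_ge0.
rewrite -mulr_sumr -mulr_sumr; apply: ler_wpM2l => //.
by rewrite ler_wpM2l ?exprn_ge0// sum_geometric_le.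
Qed.

Lemma has_ps_tail a rad F (s T : R) z n : has_ps a rad F -> 0 < s ->
  (forall k, normc (a k) * s ^+ k <= T) -> normc z < s -> normc z < rad ->
  normc (F z - psum a n z) <= T * ((normc z / s) ^+ n / (1 - normc z / s)).
Proof.
move=> hF s0 hT zs zr; apply/ler_addgt0Pl => e e0.
have [N hN] := hF z zr e e0.
rewrite -(subrK (psum a (maxn N n) z) (F z)) -addrA (le_trans (ler_normcD _ _))//.
by rewrite lerD ?hN ?leq_maxl// psum_tail// leq_maxr.
Qed.

Lemma has_ps_cauchy a rad F s M k : has_ps a rad F -> 0 < s -> s < rad ->
  (forall z, normc z = s -> normc (F z) <= M) -> normc (a k) * s ^+ k <= M.
Proof.
move=> hF s0 srad hM; pose s' := (s + rad) / 2.
have [ss' s'rad] : s < s' /\ s' < rad by rewrite /s'; split; lra.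
have s'0 : 0 < s' by exact: lt_trans ss'.
have [T T0 hT] := has_ps_coef_bounded hF s'0 s'rad.
have q0 : 0 <= s / s' by rewrite divr_ge0 ?ltW.
have q1 : s / s' < 1 by rewrite ltr_pdivrMr// mul1r.
rewrite -subr_le0; apply: (@geometric_squeeze _ _ (T / (1 - s / s')) (s / s')); first by rewrite q0.
move=> n; rewrite lerBlDl; set n' := maxn n k.+1.
have -> : normc (a k) * s ^+ k = normc (\poly_(i < n') (a i * s%:C%C ^+ i))`_k.
  by rewrite coef_poly leq_maxr normcM normcX normc_real gtr0_norm.
apply: cauchy_poly => z z1.
have nz : normc (s%:C%C * z) = s by rewrite normcM z1 mulr1 normc_real gtr0_norm.
have -> : (\poly_(i < n') (a i * s%:C%C ^+ i)).[z] = psum a n' (s%:C%C * z).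
  by rewrite horner_poly; apply: eq_bigr => i _; rewrite exprMn mulrA.
have -> : psum a n' (s%:C%C * z) =
  F (s%:C%C * z) - (F (s%:C%C * z) - psum a n' (s%:C%C * z)) by ring.
rewrite (le_trans (ler_normcB _ _))// lerD ?hM//.
have := has_ps_tail n' hF s'0 hT; move=> /(_ (s%:C%C * z)); rewrite nz => /(_ ss' srad) h.
rewrite (le_trans h)// -mulrA [_^-1 * _]mulrC; apply: ler_wpM2l => //.
rewrite ler_wpM2r ?invr_ge0 ?subr_ge0 ?(ltW q1)//.
by rewrite ler_wiXn2l ?(ltW q1)// leq_maxl.
Qed.

Lemma has_ps_unique a b rad F : has_ps a rad F -> has_ps b rad F -> 0 < rad -> a = b.
Proof.
move=> ha hb rad0; apply/funext => k; apply/eqP; rewrite -subr_eq0.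
have hab : has_ps (fun k => a k - b k) rad (fun=> 0).
  move=> z zr e e0; have e2 : 0 < e / 2 by rewrite divr_gt0.
  have [N hN] := ha z zr _ e2; have [N' hN'] := hb z zr _ e2.
  exists (maxn N N') => n; rewrite geq_max => /andP[/hN {}hN /hN' {}hN'].
  have -> : 0 - psum (fun k => a k - b k) n z = (F z - psum a n z) - (F z - psum b n z).
    rewrite /psum; under eq_bigr do rewrite mulrBl.
    by rewrite sumrB; ring.
  by rewrite (le_trans (ler_normcB _ _))// [e]splitr lerD.
have s0 : 0 < rad / 2 by rewrite divr_gt0.
have := @has_ps_cauchy _ _ _ (rad / 2) 0 k hab s0.
rewrite -normc_eq0 => h; rewrite eq_le normc_ge0 andbT.
rewrite -(@ler_pM2r _ ((rad / 2) ^+ k)) ?exprn_gt0// mul0r; apply: h; first by lra.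
by move=> z _; rewrite normc0.
Qed.

Lemma holomorphic_has_ps F : (exists2 rho : R, 0 < rho &
   forall u, normc u < rho -> exists l, cdiff_at F u l) ->
  exists a, forall rho : R, (forall u, normc u < rho -> exists l, cdiff_at F u l) ->
    has_ps a rho F.
Proof.
move=> [rho0 rho00 hF0].
have r0 : 0 < rho0 / 2 by rewrite divr_gt0.
have [|a ha] := @holomorphic_has_ps_small F rho0 (rho0 / 2) hF0; first by lra.
exists a => rho hF z zrho.
pose r := (normc z + rho) / 2.
have [zr rrho] : normc z < r /\ r < rho by rewrite /r; split; lra.
have [b hb] := holomorphic_has_ps_small hF rrho.
suff -> : a = b by exact: hb.
apply: (@has_ps_unique _ _ (Num.min (rho0 / 2) r) F).
- by apply: has_psW ha; rewrite ge_min lexx.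
- by apply: has_psW hb; rewrite ge_min lexx orbT.
by rewrite lt_min r0 (le_lt_trans (normc_ge0 z)).
Qed.

End power_series.

(*@@P3b@@*)
Section interpolation.
Context {R : realType}.
Local Notation C := R[i].

Definition lagrange (k l : nat) : {poly C} :=
  (\prod_(i < k.+1 | i != l :> nat) (l%:R - i%:R))^-1 *:
  \prod_(i < k.+1 | i != l :> nat) ('X - (i%:R)%:P).

Lemma horner_lagrange k l j : (l <= k)%N -> (j <= k)%N ->
  (lagrange k l).[j%:R] = (j == l)%:R.
Proof.
move=> lk jk; rewrite hornerZ horner_prod.
under [X in _ * X]eq_bigr do rewrite !hornerE.
have [->|jl] := eqVneq j l.
  rewrite mulVf//; apply/prodf_neq0 => i il.
  by rewrite subr_eq0 eqr_nat eq_sym.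
rewrite [X in _ * X](bigD1 (Ordinal (jk : (j < k.+1)%N)))//= subrr mul0r mulr0//.
Qed.

Lemma size_lagrange k l : (l <= k)%N -> (size (lagrange k l) <= k.+1)%N.
Proof.
move=> lk; rewrite (leq_trans (size_scale_leq _ _))//.
rewrite size_prod_XsubC_cond || rewrite (_ : \prod_(i < k.+1 | _) _ =
  \prod_(x <- [seq i%:R | i <- [seq nat_of_ord i | i <- enum 'I_k.+1 & nat_of_ord i != l]]) ('X - x%:P)).
  rewrite size_prod_XsubC !size_map size_filter.
  rewrite -(addn1 (count _ _)) addn1 ltnS -ltnS.
  have := count_predC (fun i : 'I_k.+1 => nat_of_ord i != l) (enum 'I_k.+1).
  rewrite size_enum_ord => hc; rewrite -[X in (_ < X)%N]hc -[X in (X < _)%N]addn0 ltn_add2l.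
  rewrite -has_count; apply/hasP; exists (Ordinal (lk : (l < k.+1)%N)); rewrite ?mem_enum//=.
  by rewrite eqxx.
by rewrite !big_map big_filter big_enum_cond.
Qed.

Lemma lagrange_interpolation k (Q : {poly C}) z : (size Q <= k.+1)%N ->
  Q.[z] = \sum_(l < k.+1) (lagrange k l).[z] * Q.[l%:R].
Proof.
move=> sQ; pose D := Q - \sum_(l < k.+1) Q.[l%:R] *: lagrange k l.
suff : D == 0.
  rewrite subr_eq0 => /eqP {1}->; rewrite horner_sum; apply: eq_bigr => l _.
  by rewrite hornerZ mulrC.
apply/negPn/negP => D0.
have rD : all (root D) [seq (nat_of_ord i)%:R | i <- enum 'I_k.+1].
  apply/allP => _ /mapP[j _ ->]; rewrite rootE hornerD hornerN horner_sum.
  rewrite (bigD1 j)//= hornerZ horner_lagrange -1?ltnS// eqxx mulr1 big1 ?addr0 ?subrr//.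
  move=> i ij; rewrite hornerZ horner_lagrange -1?ltnS//.
  by case: eqP => [/ord_inj ji|_]; rewrite ?mulr0//; rewrite ji eqxx in ij.
have uD : uniq [seq (nat_of_ord i)%:R : C | i <- enum 'I_k.+1].
  rewrite map_inj_uniq ?enum_uniq// => i j /eqP; rewrite eqr_nat => /eqP.
  exact: ord_inj.
have := max_poly_roots D0 rD uD; rewrite size_map size_enum_ord ltnNge; apply/negP; rewrite negbK.
rewrite (leq_trans (size_polyD _ _))// geq_max sQ size_polyN.
apply: (leq_trans (size_sum _ _ _)); apply/bigmax_leqP => i _.
by rewrite (leq_trans (size_scale_leq _ _))// size_lagrange// -ltnS.
Qed.

Definition disc_approx (T : R) (A : C -> C) := forall e : R, 0 < e ->
  exists Q : {poly C}, forall z, normc z <= T -> normc (A z - Q.[z]) <= e.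

Lemma has_ps_disc_approx a rad F T : has_ps a rad F -> 0 <= T -> T < rad -> disc_approx T F.
Proof.
move=> hF T0 Trad e e0; pose s := (T + rad) / 2.
have [Ts srad] : T < s /\ s < rad by rewrite /s; split; lra.
have s0 : 0 < s by exact: le_lt_trans Ts.
have [K K0 hK] := has_ps_coef_bounded hF s0 srad.
have q0 : 0 <= T / s by rewrite divr_ge0// ltW.
have q1 : T / s < 1 by rewrite ltr_pdivrMr// mul1r.
have q1' : 0 < 1 - T / s by rewrite subr_gt0.
have : (T / s) ^+ n @[n --> \oo] --> (0 : R) by apply: cvg_expr; rewrite ger0_norm.
have K1 : 0 < (K + 1) / (1 - T / s) by rewrite divr_gt0// ltr_wpDl.
move=> /cvgrPdist_le/(_ _ (divr_gt0 e0 K1))[n _ hn]; have := hn n (leqnn n).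
rewrite /= sub0r normrN ger0_norm ?exprn_ge0// ler_pdivlMr// => h.
exists (\poly_(i < n) a i) => z zT.
have zs : normc z < s by exact: le_lt_trans Ts.
have -> : (\poly_(i < n) a i).[z] = psum a n z by rewrite horner_poly.
rewrite (le_trans (has_ps_tail n hF s0 hK zs (lt_trans zs srad)))// (le_trans _ h)//.
have zq : normc z / s <= T / s by rewrite ler_wpM2r// invr_ge0 ltW.
have zq0 : 0 <= normc z / s by rewrite divr_ge0 ?normc_ge0 ?ltW.
have zq1 : 0 < 1 - normc z / s by rewrite subr_gt0 (le_lt_trans zq).
have hV : (normc z / s) ^+ n / (1 - normc z / s) <= (T / s) ^+ n / (1 - T / s).
  apply: ler_pM; rewrite ?exprn_ge0 ?invr_ge0 ?(ltW zq1)//; first by rewrite lerXn2r.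
  by rewrite lef_pV2 ?posrE// lerD2l lerN2.
rewrite (le_trans (ler_wpM2l K0 hV))// mulrCA ler_wpM2l ?exprn_ge0//.
by rewrite ler_wpM2r ?invr_ge0 ?(ltW q1')// lerDl.
Qed.

Lemma disc_approx_sum n (A : nat -> C -> C) (c : nat -> C) T :
  (forall i, (i < n)%N -> disc_approx T (A i)) ->
  disc_approx T (fun z => \sum_(i < n) c i * A i z).
Proof.
elim: n => [|n ih] hA e e0.
  by exists 0 => z _; rewrite big_ord0 horner0 subrr normc0 ltW.
have e2 : 0 < e / 2 by rewrite divr_gt0.
have c1 : 0 < normc (c n) + 1 by rewrite ltr_wpDl// normc_ge0.
have [|Q hQ] := ih _ _ e2; first by move=> i h; apply: hA; exact: ltnW.
have [Q' hQ'] := hA n (ltnSn _) _ (divr_gt0 e2 c1).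
exists (Q + c n *: Q') => z zT; rewrite big_ord_recr/= !hornerE.
rewrite (_ : _ - _ = (\sum_(i < n) c i * A i z - Q.[z]) + c n * (A n z - Q'.[z])); last by ring.
rewrite (le_trans (ler_normcD _ _))// [e]splitr lerD ?hQ// normcM.
have := hQ' z zT; rewrite ler_pdivlMr// => h; rewrite (le_trans _ h)// mulrC ler_wpM2l ?normc_ge0//.
by rewrite lerDl.
Qed.

Lemma disc_approx_limit (A : C -> C) T :
  (forall e : R, 0 < e -> exists2 B : C -> C, disc_approx T B &
     forall z, normc z <= T -> normc (A z - B z) <= e) -> disc_approx T A.
Proof.
move=> h e e0; have e2 : 0 < e / 2 by rewrite divr_gt0.
have [B hB AB] := h _ e2; have [Q hQ] := hB _ e2.
exists Q => z zT; rewrite -(subrK (B z) (A z)) -addrA (le_trans (ler_normcD _ _))//.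
by rewrite [e]splitr lerD ?AB ?hQ.
Qed.

Lemma liouville_lagrange (A : C -> C) k (C0 : R) : 0 <= C0 ->
  (forall T, disc_approx T A) -> (forall z, normc (A z) <= C0 * (1 + normc z) ^+ k) ->
  forall z, A z = \sum_(l < k.+1) (lagrange k l).[z] * A l%:R.
Proof.
move=> C00 hA gA z.
pose T0 := normc z + k%:R + 1.
have T01 : 1 <= T0 by rewrite lerDr addr_ge0 ?normc_ge0.
have T0_0 : 0 < T0 by exact: lt_le_trans T01.
pose C1 := C0 * 2 ^+ k + 1.
have C10 : 0 < C1 by rewrite ltr_wpDl// mulr_ge0// exprn_ge0.
pose S := 1 + \sum_(l < k.+1) normc (lagrange k l).[z].
have S0 : 0 < S by rewrite ltr_wpDr// sumr_ge0// => l _; exact: normc_ge0.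
have main (e : R) : 0 < e -> e <= 1 -> exists2 Q : {poly C}, (size Q <= k.+1)%N &
   forall w, normc w <= T0 -> normc (A w - Q.[w]) <= 2 * e.
  move=> e0 e1; pose T := 2 * T0 + 2 * C1 * T0 ^+ k.+1 / e.
  have hT1 : 2 * T0 <= T.
    by rewrite lerDl divr_ge0 ?(ltW e0)// mulr_ge0 ?exprn_ge0 ?(ltW T0_0)// mulr_ge0// ltW.
  have hT2 : 2 * C1 * T0 ^+ k.+1 / e <= T by rewrite lerDr mulr_ge0// ltW.
  have T1 : 1 <= T by lra.
  have Tpos : 0 < T by lra.
  have [Q hQ] := hA T e e0.
  have cQ i : normc Q`_i * T ^+ i <= C1 * T ^+ k.
    have -> : normc Q`_i * T ^+ i = normc (\poly_(i < size Q) (Q`_i * T%:C%C ^+ i))`_i.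
      rewrite coef_poly; case: ltnP => [_|h].
        by rewrite normcM normcX normc_real gtr0_norm.
      by rewrite nth_default// normc0 mul0r.
    apply: cauchy_poly => w w1.
    have -> : (\poly_(i < size Q) (Q`_i * T%:C%C ^+ i)).[w] = Q.[T%:C%C * w].
      by rewrite horner_poly horner_coef; apply: eq_bigr => j _; rewrite exprMn mulrA.
    have nw : normc (T%:C%C * w) = T by rewrite normcM w1 mulr1 normc_real gtr0_norm.
    rewrite -[Q.[_]](subKr (A (T%:C%C * w))) (le_trans (ler_normcB _ _))//.
    rewrite /C1 mulrDl mul1r lerD//.
      rewrite (le_trans (gA _))// nw -mulrA -exprMn ler_wpM2l// lerXn2r ?nnegrE ?mulr_ge0 ?(ltW Tpos)//.
        by rewrite addr_ge0// ltW.
      by lra.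
    by rewrite (le_trans (hQ _ _)) ?nw// (le_trans e1)// exprn_ege1.
  exists (\poly_(i < k.+1) Q`_i); first exact: size_poly.
  move=> w wT0.
  have wT : normc w <= T by lra.
  rewrite (_ : _ - _ = (A w - Q.[w]) + (Q.[w] - (\poly_(i < k.+1) Q`_i).[w])); last by ring.
  rewrite (le_trans (ler_normcD _ _))// (_ : 2 * e = e + e); last by ring.
  rewrite lerD ?hQ//.
  have q0 : 0 <= T0 / T by rewrite divr_ge0 ?ltW.
  have q2 : T0 / T <= 2^-1 by rewrite ler_pdivrMr//; lra.
  have sQ : (size Q <= k.+1 + size Q)%N by rewrite leq_addl.
  rewrite (horner_coef_wide _ sQ) horner_poly big_split_ord/= addrAC subrr add0r.
  rewrite (le_trans (ler_normc_sum _ _ _))//.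
  apply: (@le_trans _ _ (\sum_(i < size Q) C1 * T ^+ k * (T0 / T) ^+ k.+1 * (T0 / T) ^+ i)).
    apply: ler_sum => i _; rewrite normcM normcX -mulrA -exprD expr_div_n mulrA.
    rewrite ler_pdivlMr ?exprn_gt0// mulrAC ler_pM ?mulr_ge0 ?exprn_ge0 ?normc_ge0 ?(ltW Tpos)//.
    by rewrite lerXn2r ?nnegrE ?normc_ge0 ?(ltW T0_0).
  rewrite -mulr_sumr.
  have h1 : \sum_(i < size Q) (T0 / T) ^+ i <= 2.
    rewrite (le_trans (sum_geometric_le _ q0 _))//; first by lra.
    by rewrite -[leRHS]invrK lef_pV2 ?posrE; lra.
  have h2 : C1 * T ^+ k * (T0 / T) ^+ k.+1 = C1 * T0 ^+ k.+1 / T.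
    rewrite expr_div_n [T ^+ k.+1]exprSr invfM.
    have Tk : T ^+ k != 0 by rewrite expf_neq0 ?gt_eqF.
    by move: Tk; move: (T ^+ k) (T0 ^+ k.+1) => x y x0; field; rewrite x0 gt_eqF.
  rewrite h2 (@le_trans _ _ (C1 * T0 ^+ k.+1 / T * 2))//.
    by rewrite ler_wpM2l// divr_ge0 ?(ltW Tpos)// mulr_ge0 ?exprn_ge0 ?ltW.
  rewrite mulrAC ler_pdivrMr//.
  by move: hT2; rewrite ler_pdivrMr//; lra.
apply/eqP; rewrite -subr_eq0 -normc_eq0 eq_le normc_ge0 andbT.
apply/ler_addgt0Pl => e e0; rewrite addr0.
pose e1 := Num.min 1 (e / (2 * S)).
have e10 : 0 < e1 by rewrite lt_min ltr01 divr_gt0// mulr_gt0.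
have e11 : e1 <= 1 by rewrite ge_min lexx.
have [Q sQ hQ] := main e1 e10 e11.
rewrite (_ : _ - _ = (A z - Q.[z]) - \sum_(l < k.+1) (lagrange k l).[z] * (A l%:R - Q.[l%:R])); last first.
  under [X in _ - _ - X]eq_bigr do rewrite mulrBr.
  by rewrite sumrB -(lagrange_interpolation z sQ); ring.
rewrite (@le_trans _ _ (2 * e1 * S))//; last first.
  have : e1 <= e / (2 * S) by rewrite ge_min lexx orbT.
  by rewrite ler_pdivlMr ?mulr_gt0//; lra.
rewrite (le_trans (ler_normcB _ _))// /S mulrDr mulr1 lerD//.
  by apply: hQ; rewrite /T0 -addrA lerDl addr_ge0.
rewrite (le_trans (ler_normc_sum _ _ _))// mulr_sumr ler_sum// => l _.
rewrite normcM mulrC ler_wpM2r ?normc_ge0// hQ// normc_nat /T0.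
have : l%:R <= k%:R :> R by rewrite ler_nat -ltnS.
by have := normc_ge0 z; lra.
Qed.

End interpolation.

(*@@P3c@@*)
Section slices.
Context {R : realType} {d : nat}.
Local Notation C := R[i].
Local Notation Cd := 'rV[R[i]]_d.

Lemma differentiable_line (m : Cd -> C) (q v : Cd) (t0 : C) :
  differentiable m (q + t0 *: v) -> exists l, cdiff_at (fun t => m (q + t *: v)) t0 l.
Proof.
move=> dm.
have dg : differentiable (fun t : C => q + t *: v) t0.
  apply: differentiableD; first exact: differentiable_cst.
  by apply: differentiableZl.
have := differentiable_comp dg dm.
move=> /derivable1_diffP/cvg_ex[l hl]; exists l => e e0.
move/cvgrPdist_le : hl => /(_ e%:C%C); rewrite ltcR => /(_ e0)[dd /= dd0 hd].
have ddE : dd = (complex.Re dd)%:C%C by rewrite RRe_real// gtr0_real.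
exists (complex.Re dd); first by rewrite -ltcR -ddE.
move=> w wd; have [->|wt] := eqVneq w t0.
  by rewrite !subrr mulr0 subrr normc0 mulr0.
have /hd : ball_ Num.norm 0 dd (w - t0).
  by rewrite /ball_/= sub0r normrN normc_norm ddE ltcR.
rewrite subr_eq0 => /(_ wt); rewrite /= [(w - t0) *: 1]mulr1 subrK normc_norm lecR.
set Y := m _ - m _ => h.
have w0 : w - t0 != 0 by rewrite subr_eq0.
rewrite (_ : Y - _ = - ((l - (w - t0)^-1 * Y) * (w - t0))); last by field.
by rewrite normcN normcM ler_wpM2r// normc_ge0.
Qed.


Definition snorm (z : Cd) : R := \sum_i normc (z ord0 i).

Lemma snorm_ge0 z : 0 <= snorm z.
Proof. by apply: sumr_ge0 => i _; exact: normc_ge0. Qed.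

Lemma enorm_ge0 (z : Cd) : 0 <= enorm z. Proof. exact: sqrtr_ge0. Qed.

Lemma sqr_enorm (z : Cd) : enorm z ^+ 2 = \sum_i normc (z ord0 i) ^+ 2.
Proof. by rewrite sqr_sqrtr// sumr_ge0// => i _; exact: sqr_ge0. Qed.

Lemma enormZ (a : C) (z : Cd) : enorm (a *: z) = normc a * enorm z.
Proof.
rewrite /enorm; under eq_bigr do rewrite mxE normcM exprMn.
by rewrite -mulr_sumr sqrtrM ?sqr_ge0// sqrtr_sqr ger0_norm ?normc_ge0.
Qed.

Lemma snormD z w : snorm (z + w) <= snorm z + snorm w.
Proof. by rewrite /snorm -big_split ler_sum// => i _; rewrite mxE ler_normcD. Qed.

Lemma snormZ (a : C) z : snorm (a *: z) = normc a * snorm z.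
Proof. by rewrite /snorm mulr_sumr; apply: eq_bigr => i _; rewrite mxE normcM. Qed.

Lemma enorm_le_snorm z : enorm z <= snorm z.
Proof.
rewrite -(@ler_pXn2r _ 2) ?nnegrE ?snorm_ge0 ?enorm_ge0// sqr_enorm expr2.
rewrite {1}/snorm mulr_suml ler_sum// => i _; rewrite expr2 ler_wpM2l ?normc_ge0//.
by rewrite /snorm (bigD1 i)//= lerDl sumr_ge0// => j _; exact: normc_ge0.
Qed.

Definition is_mpoly (f : Cd -> C) := exists P : mpoly.mpoly d C, forall z, f z = mpoly.meval (z ord0) P.

Lemma is_mpoly_cst c : is_mpoly (fun=> c).
Proof. by exists (mpoly.mpolyC d c) => z; rewrite mpoly.mevalC. Qed.

Lemma is_mpoly_coord i : is_mpoly (fun z => z ord0 i).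
Proof. by exists (mpoly.mpolyX C (mpoly.mnm1 i)) => z; rewrite mpoly.mevalXU. Qed.

Lemma is_mpolyD f g : is_mpoly f -> is_mpoly g -> is_mpoly (fun z => f z + g z).
Proof. by move=> [P hP] [Q hQ]; exists (P + Q) => z; rewrite mpoly.mevalD hP hQ. Qed.

Lemma is_mpolyM f g : is_mpoly f -> is_mpoly g -> is_mpoly (fun z => f z * g z).
Proof. by move=> [P hP] [Q hQ]; exists (P * Q) => z; rewrite mpoly.mevalM hP hQ. Qed.

Lemma is_mpoly_sum n (f : nat -> Cd -> C) : (forall i, (i < n)%N -> is_mpoly (f i)) ->
  is_mpoly (fun z => \sum_(i < n) f i z).
Proof.
elim: n => [|n ih] h.
  by under eq_fun do rewrite big_ord0; exact: is_mpoly_cst.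
under eq_fun do rewrite big_ord_recr/=; apply: is_mpolyD; last exact: h.
by apply: ih => i /ltnW; exact: h.
Qed.

Lemma is_mpolyX f n : is_mpoly f -> is_mpoly (fun z => f z ^+ n).
Proof.
move=> hf; elim: n => [|n ih]; first exact: is_mpoly_cst.
by under eq_fun do rewrite exprS; exact: is_mpolyM.
Qed.

Lemma is_mpoly_horner (Q : {poly C}) f : is_mpoly f -> is_mpoly (fun z => Q.[f z]).
Proof.
move=> hf; under eq_fun do rewrite horner_coef.
apply: (is_mpoly_sum (f := fun i z => Q`_i * f z ^+ i)) => i _.
by apply: is_mpolyM; [exact: is_mpoly_cst|exact: is_mpolyX].
Qed.

Definition upd (z : Cd) (j : 'I_d) (c : C) : Cd := \row_i (if i == j then c else z ord0 i).

Lemma updE z j c : upd z j c = upd z j 0 + c *: delta_mx ord0 j.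
Proof.
apply/rowP => i; rewrite !mxE eqxx/=; have [_|_] := eqVneq i j.
- by rewrite mulr1 add0r.
- by rewrite mulr0 addr0.
Qed.

Lemma upd_id z j : upd z j (z ord0 j) = z.
Proof. by apply/rowP => i; rewrite mxE; case: eqP => [->|]. Qed.

(* a function which is a polynomial of bounded degree in each variable is a polynomial *)
Lemma separately_poly_is_mpoly k (f : Cd -> C) :
  (forall z j c, f (upd z j c) =
     \sum_(l < k.+1) (lagrange k l).[c] * f (upd z j l%:R)) -> is_mpoly f.
Proof.
suff main n : forall f : Cd -> C, (forall z j c, f (upd z j c) =
     \sum_(l < k.+1) (lagrange k l).[c] * f (upd z j l%:R)) ->
   (forall z w : Cd, (forall i : 'I_d, (i < n)%N -> z ord0 i = w ord0 i) -> f z = f w) -> is_mpoly f.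
  move=> hf; apply: (main d) => // z w zw; congr f; apply/rowP => i; exact: zw.
elim: n => [|n ih] {}f hf hn.
  by exists (mpoly.mpolyC d (f 0)) => z; rewrite mpoly.mevalC; exact: hn.
have [dn|nd] := leqP d n.
  by apply: ih => // z w zw; apply: hn => i _; apply: zw; exact: leq_trans (ltn_ord i) dn.
pose j := Ordinal nd.
have -> : f = fun z => \sum_(l < k.+1) (lagrange k l).[z ord0 j] * f (upd z j l%:R).
  by apply/funext => z; rewrite -{1}(upd_id z j) hf.
apply: (is_mpoly_sum (f := fun l z => (lagrange k l).[z ord0 j] * f (upd z j l%:R))) => l _.
apply: is_mpolyM; first exact/is_mpoly_horner/is_mpoly_coord.
apply: ih => [z i c|z w zw].
  have [->|ij] := eqVneq i j.
    have e x : upd (upd z j x) j l%:R = upd z j l%:R.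
      by apply/rowP => a; rewrite !mxE; case: eqP.
    under eq_bigr do rewrite e.
    rewrite e -mulr_suml -[LHS]mul1r; congr (_ * _).
    have := lagrange_interpolation (k := k) (Q := 1) c; rewrite size_poly1 hornerC => -> //.
    by apply: eq_bigr => i' _; rewrite hornerC mulr1.
  have e x : upd (upd z i x) j l%:R = upd (upd z j l%:R) i x.
    apply/rowP => a; rewrite !mxE; case: eqP => [->|//]; case: eqP => // ji.
    by rewrite ji eqxx in ij.
  by rewrite e hf; apply: eq_bigr => i' _; rewrite e.
apply: hn => i iln; rewrite !mxE; case: eqP => // /eqP ij; apply: zw.
by move: iln; rewrite ltnS leq_eqVlt => /orP[/eqP h|//]; case/eqP: ij; exact: ord_inj.
Qed.

End slices.

(*@@P3d@@*)
Section homogeneous_expansion.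
Context {R : realType} {d : nat}.
Local Notation C := R[i].
Local Notation Cd := 'rV[R[i]]_d.
Variables (m : Cd -> C) (M : R).
Hypothesis mhol : holomorphic_on_ball m.
Hypothesis mM : forall z, unit_ball z -> normc (m z) <= M.

Lemma cdiff_line (q v : Cd) (t : C) : enorm (q + t *: v) < 1 ->
  exists l, cdiff_at (fun s => m (q + s *: v)) t l.
Proof. by move=> h; apply: differentiable_line; exact: mhol. Qed.

Lemma exists_homogeneous_parts : exists A : nat -> Cd -> C,
  forall z rho, rho * enorm z <= 1 -> has_ps (A^~ z) rho (fun t => m (t *: z)).
Proof.
have cd z (t : C) : normc t * enorm z < 1 -> exists l, cdiff_at (fun s => m (s *: z)) t l.
  move=> h; have [|l hl] := @cdiff_line 0 z t; first by rewrite add0r enormZ.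
  by exists l; move: hl; under eq_fun do rewrite add0r.
have hA z : exists a : nat -> C, forall rho, rho * enorm z <= 1 -> has_ps a rho (fun t => m (t *: z)).
  have [|a ha] := @holomorphic_has_ps R (fun t => m (t *: z)).
    exists (enorm z + 1)^-1; first by rewrite invr_gt0 ltr_wpDl// enorm_ge0.
    move=> u; have e1 : 0 < enorm z + 1 by rewrite ltr_wpDl// enorm_ge0.
    rewrite -[_^-1]div1r ltr_pdivlMr// => h; apply: cd.
    by have := normc_ge0 u; lra.
  exists a => rho hrho; apply: ha => u hu; apply: cd.
  have [->|ez] := eqVneq (enorm z) 0; first by rewrite mulr0.
  by rewrite (lt_le_trans _ hrho)// ltr_pM2r// lt_neqAle eq_sym ez enorm_ge0.
have [B hB] := choice hA; exists (fun k z => B z k) => z rho; exact: hB.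
Qed.

Variable A : nat -> Cd -> C.
Hypothesis hA : forall z rho, rho * enorm z <= 1 -> has_ps (A^~ z) rho (fun t => m (t *: z)).

Let inv_enorm (z : Cd) : 0 < (enorm z + 1)^-1 /\ (enorm z + 1)^-1 * enorm z <= 1.
Proof.
have e1 : 0 < enorm z + 1 by rewrite ltr_wpDl// enorm_ge0.
by rewrite invr_gt0 e1 mulrC ler_pdivrMr// mul1r lerDl ler01.
Qed.

Lemma homogeneous_partZ k (c : C) z : A k (c *: z) = c ^+ k * A k z.
Proof.
have [r0 hr] := inv_enorm z; have [r'0 hr'] := inv_enorm (c *: z).
set r := (_)^-1 in r0 hr; set r' := (_)^-1 in r'0 hr'.
pose s := Num.min r' (r / (normc c + 1)).
have c1 : 0 < normc c + 1 by rewrite ltr_wpDl// normc_ge0.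
have s0 : 0 < s by rewrite lt_min r'0 divr_gt0.
have h1 : has_ps (A^~ (c *: z)) s (fun t => m (t *: (c *: z))).
  by apply: has_psW (hA hr'); rewrite ge_min lexx.
have h2 : has_ps (fun k => c ^+ k * A k z) s (fun t => m (t *: (c *: z))).
  move=> t ts e e0; have [|N hN] := hA hr (z := z) (_ : normc (t * c) < r) e0.
    rewrite normcM; have : normc t < r / (normc c + 1).
      by rewrite (lt_le_trans ts)// ge_min lexx orbT.
    by rewrite ltr_pdivlMr//; have := normc_ge0 t; lra.
  exists N => n /hN; rewrite scalerA (_ : psum (A^~ z) n (t * c) = psum (fun k0 => c ^+ k0 * A k0 z) n t)//.
  by apply: eq_bigr => i _; rewrite exprMn; ring.
by have := has_ps_unique h1 h2 s0 => /(congr1 (fun f => f k)).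
Qed.

Lemma homogeneous_part_le k z s : 0 < s -> s * enorm z < 1 -> normc (A k z) * s ^+ k <= M.
Proof.
move=> s0 sz; have e0 := enorm_ge0 z.
have e1 : 0 < enorm z + 1 by rewrite ltr_wpDl.
pose rho := s + (1 - s * enorm z) / (enorm z + 1).
apply: (has_ps_cauchy (a := A^~ z) (rad := rho) (F := fun t => m (t *: z))) => //.
- apply: hA; rewrite /rho mulrDl -[X in _ <= X](subrKC (s * enorm z)) lerD2l.
  by rewrite mulrAC ler_pdivrMr// ler_wpM2l ?lerDl// subr_ge0 ltW.
- by rewrite /rho ltrDl divr_gt0// subr_gt0.
by move=> t ts; apply: mM; rewrite /unit_ball/= enormZ ts.
Qed.

Lemma disc_approx_homogeneous_part k (z v : Cd) T : disc_approx T (fun c => A k (z + c *: v)).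
Proof.
have [T0|T0] := ltP T 0.
  by move=> e e0; exists 0 => c cT; have := le_lt_trans cT T0; rewrite ltNge normc_ge0.
pose D := snorm z + (T + 1) * snorm v + 1.
have D1 : 1 <= D by rewrite lerDr addr_ge0 ?mulr_ge0 ?snorm_ge0// addr_ge0.
have D0 : 0 < D by exact: lt_le_trans D1.
pose s := (2 * D)^-1.
have s0 : 0 < s by rewrite invr_gt0 mulr_gt0.
have sD : 2 * s * D = 1 by rewrite /s; field; rewrite gt_eqF.
have small c : normc c < T + 1 -> 2 * s * enorm (z + c *: v) < 1.
  move=> cT; rewrite -[ltRHS]sD ltr_pM2l ?mulr_gt0// (le_lt_trans (enorm_le_snorm _))//.
  rewrite (le_lt_trans (snormD _ _))// snormZ /D ltr_pwDr// lerD2l ler_wpM2r ?snorm_ge0//.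
  exact: ltW.
have M0 : 0 <= M.
  by apply: le_trans (mM (z := 0) _); rewrite ?normc_ge0// /unit_ball/= -[0](scale0r z) enormZ normc0 mul0r.
apply: disc_approx_limit => e e0.
have sk0 : 0 < s ^+ k by rewrite exprn_gt0.
have [N [kN hN]] : exists N, (k < N)%N /\ M * (2^-1 ^+ N * 2) <= e * s ^+ k.
  have : (2^-1 : R) ^+ n @[n --> \oo] --> (0 : R) by apply: cvg_expr; rewrite ger0_norm//; lra.
  have x0 : 0 < e * s ^+ k / (2 * (M + 1)) by rewrite divr_gt0 ?mulr_gt0// ltr_wpDl.
  move=> /cvgrPdist_le/(_ _ x0)[N _ hN]; exists (maxn N k.+1); split; first exact: leq_maxr.
  have := hN _ (leq_maxl N k.+1); rewrite /= sub0r normrN ger0_norm ?exprn_ge0//.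
  rewrite ler_pdivlMr ?mulr_gt0 ?ltr_wpDl//.
  have : 0 <= (2^-1 : R) ^+ maxn N k.+1 by rewrite exprn_ge0.
  nra.
have [w pw] := @prim_root_exists R N (leq_ltn_trans (leq0n _) kN).
have Nn0 : (N%:R : C) != 0 by rewrite pnatr_eq0 -lt0n (leq_ltn_trans _ kN).
have sC : s%:C%C != 0 :> C by rewrite (fmorph_eq0 (@real_complex R)) gt_eqF.
pose co j := (N%:R * s%:C%C ^+ k)^-1 * (w ^+ j) ^- k : C.
pose f (j : nat) (c : C) := m (s%:C%C * w ^+ j *: (z + c *: v)).
exists (fun c => \sum_(j < N) co j * f j c).
  apply: disc_approx_sum => j jN.
  have fcd u : normc u < T + 1 -> exists l, cdiff_at (f j) u l.
    move=> uT; have fE c : s%:C%C * w ^+ j *: (z + c *: v) =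
        (s%:C%C * w ^+ j) *: z + c *: ((s%:C%C * w ^+ j) *: v).
      by rewrite scalerDr !scalerA [c * _]mulrC.
    have -> : f j = fun c => m ((s%:C%C * w ^+ j) *: z + c *: ((s%:C%C * w ^+ j) *: v)).
      by apply/funext => c; rewrite /f fE.
    apply: cdiff_line; rewrite -fE enormZ normcM (normc_prim_rootX _ pw) mulr1.
    rewrite normc_real gtr0_norm//; have := small u uT; have := enorm_ge0 (z + u *: v).
    by move=> e_ge0; have := mulr_ge0 (ltW s0) e_ge0; lra.
  have [|a ha] := @holomorphic_has_ps R (f j).
    by exists (T + 1) => //; rewrite ltr_wpDl.
  by apply: (has_ps_disc_approx (ha _ fcd) T0); rewrite ltrDl.
move=> c cT.
have cT1 : normc c < T + 1 by rewrite (le_lt_trans cT)// ltrDl.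
set u := z + c *: v.
have hu := small c cT1; rewrite -/u in hu.
have -> : A k u = \sum_(j < N) co j * psum (A^~ u) N (s%:C%C * w ^+ j).
  have := @horner_prim_root_mean R (\poly_(i < N) A i u) N w k s%:C%C pw (size_poly _ _) kN.
  rewrite coef_poly kN => h.
  have -> : A k u = (N%:R * s%:C%C ^+ k)^-1 * (N%:R * (A k u * s%:C%C ^+ k)).
    by field; rewrite Nn0 expf_neq0.
  rewrite -h mulr_sumr; apply: eq_bigr => j _.
  by rewrite /co horner_poly mulrAC -mulrA.
rewrite -sumrB (le_trans (ler_normc_sum _ _ _))//.
apply: (@le_trans _ _ (\sum_(j < N) (N%:R * s ^+ k)^-1 * (e * s ^+ k))).
  apply: ler_sum => j _; rewrite -mulrBr normcM.
  have -> : normc (co j) = (N%:R * s ^+ k)^-1.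
    rewrite /co normcM !normcV normcM normcX normc_nat normcX (normc_prim_rootX _ pw).
    by rewrite expr1n invr1 mulr1 normc_real gtr0_norm.
  rewrite ler_wpM2l ?invr_ge0 ?mulr_ge0 ?(ltW sk0)// normc_distC (le_trans _ hN)//.
  have nj : normc (s%:C%C * w ^+ j) = s.
    by rewrite normcM (normc_prim_rootX _ pw) mulr1 normc_real gtr0_norm.
  have s20 : 0 < 2 * s by rewrite mulr_gt0.
  have := @has_ps_tail R (A^~ u) (2 * s) (fun t => m (t *: u)) (2 * s) M (s%:C%C * w ^+ j) N (hA (ltW hu)) s20.
  rewrite nj (_ : s / (2 * s) = 2^-1); last by field; rewrite gt_eqF.
  rewrite (_ : (1 - 2^-1)^-1 = 2); last by field.
  by apply => [i||]; [exact: homogeneous_part_le|lra|lra].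
have NR0 : N%:R != 0 :> R by rewrite pnatr_eq0 -lt0n (leq_ltn_trans _ kN).
rewrite sumr_const card_ord -[leLHS]mulr_natl.
rewrite [leLHS](_ : _ = e)//.
move: (lt0r_neq0 sk0); move: (s ^+ k) => x x0; field.
by rewrite NR0 x0.
Qed.

Lemma homogeneous_part_is_mpoly k : is_mpoly (A k).
Proof.
apply: (@separately_poly_is_mpoly _ _ k) => z j c.
rewrite updE; under eq_bigr do rewrite updE.
set z0 := upd z j 0; set v := delta_mx _ _.
have Dv : 0 <= snorm z0 + snorm v + 1 by rewrite !addr_ge0// snorm_ge0.
have M0 : 0 <= M.
  by apply: le_trans (mM (z := 0) _); rewrite ?normc_ge0// /unit_ball/= -[0](scale0r z) enormZ normc0 mul0r.
apply: (@liouville_lagrange _ (fun c => A k (z0 + c *: v)) k (M * (2 * (snorm z0 + snorm v + 1)) ^+ k)).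
- by rewrite mulr_ge0// exprn_ge0// mulr_ge0.
- by move=> T; exact: disc_approx_homogeneous_part.
move=> u; pose D := 2 * (snorm z0 + snorm v + 1) * (1 + normc u).
have nu := normc_ge0 u; have nz := snorm_ge0 z0; have nv := snorm_ge0 v.
have D0 : 0 < D by rewrite /D mulr_gt0; lra.
have h : D^-1 * enorm (z0 + u *: v) < 1.
  rewrite mulrC ltr_pdivrMr// mul1r (le_lt_trans (enorm_le_snorm _))//.
  by rewrite (le_lt_trans (snormD _ _))// snormZ /D; nra.
have D0' : 0 < D^-1 by rewrite invr_gt0.
have := homogeneous_part_le k D0' h.
by rewrite exprVn ler_pdivrMr ?exprn_gt0// => h'; rewrite -mulrA -exprMn.
Qed.

End homogeneous_expansion.

(*@@P4a@@*)
Section measure_preserving.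
Context {R : realType}.

Definition preserves d (T : measurableType d) (m : set T -> \bar R) (f : T -> T) : Prop :=
  measurable_fun setT f /\ forall A, measurable A -> m (f @^-1` A) = m A.

Lemma preserves_comp d (T : measurableType d) (m : set T -> \bar R) (f g : T -> T) :
  preserves m f -> preserves m g -> preserves m (f \o g).
Proof.
move=> [mf hf] [mg hg]; split; first exact: measurableT_comp.
move=> A mA; rewrite comp_preimage hg ?hf//.
by rewrite -[X in measurable X]setTI; exact: mf.
Qed.

Lemma preserves_prod d1 d2 (T1 : measurableType d1) (T2 : measurableType d2)
    (m1 : {sigma_finite_measure set T1 -> \bar R})
    (m2 : {sigma_finite_measure set T2 -> \bar R}) (f : T1 -> T1) (g : T2 -> T2) :
  preserves m1 f -> preserves m2 g ->
  preserves (m1 \x m2)%E (fun p => (f p.1, g p.2)).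
Proof.
move=> [mf hf] [mg hg].
have mfg : measurable_fun setT (fun p : T1 * T2 => (f p.1, g p.2)).
  by apply/measurable_fun_pair; apply: measurableT_comp.
split => // A mA.
rewrite [RHS](@product_measure_unique _ _ _ _ _ _ _
  (measure_function_pushforward__canonical__measure_function_Measure (m1 \x m2)%E mfg))//.
move=> B D mB mD; rewrite /= /pushforward.
have -> : (fun p => (f p.1, g p.2)) @^-1` (B `*` D) = (f @^-1` B) `*` (g @^-1` D) by [].
have ? : measurable (f @^-1` B) by rewrite -[X in measurable X]setTI; exact: mf.
have ? : measurable (g @^-1` D) by rewrite -[X in measurable X]setTI; exact: mg.
by rewrite product_measure1E//; congr (_ * _)%E; [exact: hf|exact: hg].
Qed.

Let T : measurableType _ := measurableTypeR R.
Local Notation mu := (@lebesgue_measure R).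

Lemma measurable_translation (t : R) : measurable_fun setT (fun x : T => x + t : T).
Proof. exact: measurable_funD. Qed.

Lemma lebesgue_translation (t : R) : preserves mu (fun x : T => x + t : T).
Proof.
split => [|A mA]; first exact: measurable_translation.
rewrite [RHS](@lebesgue_measure_unique R
  (measure_function_pushforward__canonical__measure_function_Measure mu
    (measurable_translation t)))//.
move=> _ [[a b] _ <-]; rewrite /= /pushforward.
have -> : (fun x : R => x + t) @^-1` `]a, b] = `]a - t, b - t]%classic.
  by apply/seteqP; split => x /=; rewrite !in_itv/= ltrBlDr lerBrDr.
rewrite !lebesgue_measure_itv/= !lte_fin ltrD2r; case: ifP => // _.
by rewrite -!EFinD opprB addrA subrK.
Qed.

Definition yshear (b : R) (p : T * T) : T * T := (p.1, p.2 + b * p.1).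
Definition xshear (b : R) (p : T * T) : T * T := (p.1 + b * p.2, p.2).

Lemma measurable_yshear b : measurable_fun setT (yshear b).
Proof.
apply/measurable_fun_pair => //.
apply: measurable_funD => //; apply: measurable_funM => //.
Qed.

Lemma preserves_yshear b : preserves (mu \x mu)%E (yshear b).
Proof.
split => [|A mA]; first exact: measurable_yshear.
rewrite /product_measure1; apply: eq_integral => x _ /=.
have -> : xsection (yshear b @^-1` A) x = (fun y : T => y + b * x : T) @^-1` xsection A x.
  by apply/seteqP; split => y; rewrite /xsection/= !inE.
have [_ ->//] := lebesgue_translation (b * x).
exact: measurable_xsection.
Qed.

Definition tswap (p : T * T) : T * T := (p.2, p.1).

Lemma measurable_tswap : measurable_fun setT tswap.
Proof. by apply/measurable_fun_pair. Qed.

Lemma preserves_tswap : preserves (mu \x mu)%E tswap.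
Proof.
split => [|A mA]; first exact: measurable_tswap.
rewrite [RHS](@product_measure_unique _ _ _ _ _ _ _
  (measure_function_pushforward__canonical__measure_function_Measure (mu \x mu)%E
     measurable_tswap))//.
move=> B D mB mD; rewrite /= /pushforward.
have -> : tswap @^-1` (B `*` D) = D `*` B.
  by apply/seteqP; split => -[x y] [].
by rewrite product_measure1E// muleC.
Qed.

Lemma preserves_xshear b : preserves (mu \x mu)%E (xshear b).
Proof.
have -> : xshear b = tswap \o (yshear b \o tswap) by apply/funext => -[x y].
by do 2 (apply: preserves_comp; first by [exact: preserves_tswap|exact: preserves_yshear]);
  exact: preserves_tswap.
Qed.

Definition plane_rot (c s : R) (p : T * T) : T * T :=
  (c * p.1 - s * p.2, s * p.1 + c * p.2).

(* a rotation is a product of three shears *)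
Lemma preserves_plane_rot_neq0 c s : s != 0 -> c ^+ 2 + s ^+ 2 = 1 ->
  preserves (mu \x mu)%E (plane_rot c s).
Proof.
move=> s0 cs.
have -> : plane_rot c s = xshear ((c - 1) / s) \o (yshear s \o xshear ((c - 1) / s)).
  apply/funext => -[x y]; rewrite /plane_rot /xshear /yshear/=.
  have e2 : s * x + c * y = y + s * (x + (c - 1) / s * y) by field.
  rewrite -e2; congr pair; apply: (mulfI s0).
  have -> : s * (x + (c - 1) / s * y + (c - 1) / s * (s * x + c * y)) =
     s * c * x + (c ^+ 2 - 1) * y by field.
  by rewrite -cs; ring.
apply: preserves_comp; first exact: preserves_xshear.
by apply: preserves_comp; [exact: preserves_yshear|exact: preserves_xshear].
Qed.

Lemma preserves_plane_rot c s : c ^+ 2 + s ^+ 2 = 1 -> preserves (mu \x mu)%E (plane_rot c s).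
Proof.
move=> cs; have [s0|s0] := eqVneq s 0; last exact: preserves_plane_rot_neq0.
(* multiplication by c = (-1) or 1 is the composite of two quarter turns *)
have -> : plane_rot c s = plane_rot 0 (- c) \o plane_rot 0 1.
  apply/funext => -[x y]; rewrite /plane_rot/= s0; congr pair; ring.
have c2 : c ^+ 2 = 1 by rewrite -cs s0 expr0n addr0.
by apply: preserves_comp; apply: preserves_plane_rot_neq0;
  rewrite ?oner_eq0 ?oppr_eq0 ?sqrrN ?c2 ?expr0n ?expr1n ?add0r// -(sqrf_eq0 c) c2 oner_eq0.
Qed.

Lemma preserves_lebesgue_C (u : R[i]) : normc u = 1 ->
  preserves (@lebesgue_C R) (fun z => u * z).
Proof.
move=> u1; have cs : complex.Re u ^+ 2 + complex.Im u ^+ 2 = 1.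
  by rewrite -sqr_normc u1 expr1n.
have [mrot hrot] := preserves_plane_rot cs.
have E : (fun z => u * z) = @of_ReIm R \o (plane_rot (complex.Re u) (complex.Im u) \o @ReIm R).
  apply/funext => -[x y]; case: (u) => a b; rewrite /of_ReIm/=.
  by congr Complex; rewrite addrC.
split.
  rewrite E; apply: measurableT_comp; first exact: measurable_of_ReIm.
  apply: measurableT_comp => //; exact: measurable_ReIm.
move=> A mA; rewrite /lebesgue_C /pushforward E.
have -> : @of_ReIm R @^-1` ((@of_ReIm R \o (plane_rot (complex.Re u) (complex.Im u) \o @ReIm R)) @^-1` A)
  = plane_rot (complex.Re u) (complex.Im u) @^-1` (@of_ReIm R @^-1` A).
  by apply/seteqP; split => -[x y].
apply: hrot; rewrite -[X in measurable X]setTI.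
exact: measurable_of_ReIm.
Qed.

Definition torus_act n (th : 'I_n -> R[i]) (z : 'rV[R[i]]_n) : 'rV[R[i]]_n :=
  \row_i (th i * z ord0 i).

Lemma preimage_row_cons n (g : R[i] * 'rV[R[i]]_n -> R[i] * 'rV[R[i]]_n) A :
  @row_cons R n @^-1` ((@row_cons R n \o (g \o @row_uncons R n)) @^-1` A) =
  g @^-1` (@row_cons R n @^-1` A).
Proof.
apply/seteqP; split => p.
- change (A (row_cons (g (row_uncons (row_cons p)))) -> A (row_cons (g p))).
  by rewrite row_consK.
- change (A (row_cons (g p)) -> A (row_cons (g (row_uncons (row_cons p))))).
  by rewrite row_consK.
Qed.

Lemma preserves_lebesgue_Cn n (th : 'I_n -> R[i]) : (forall i, normc (th i) = 1) ->
  preserves (lebesgue_Cn R n) (torus_act th).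
Proof.
elim: n th => [|n ih] th th1.
  have -> : torus_act th = id.
    by apply/funext => z; apply/rowP => -[].
  by split.
pose th' i := th (lift ord0 i).
have [mp hp] := preserves_prod (preserves_lebesgue_C (th1 ord0)) (ih th' (fun i => th1 _)).
have E : torus_act th = @row_cons R n \o
    ((fun p => (th ord0 * p.1, torus_act th' p.2)) \o @row_uncons R n).
  apply/funext => z; apply/rowP => i; rewrite !mxE/=.
  by case: (unliftP ord0 i) => [j|] ->//=; rewrite !mxE.
split.
  rewrite E; apply: measurableT_comp; first exact: measurable_row_cons.
  apply: measurableT_comp => //; exact: measurable_row_uncons.
move=> A mA; rewrite /= /lebesgue_CS /pushforward E.
rewrite preimage_row_cons.
apply: hp; rewrite -[X in measurable X]setTI.
exact: measurable_row_cons.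
Qed.

End measure_preserving.

(*@@P4b@@*)
Section complex_measurability.
Context d (T : measurableType d) {R : realType}.
Local Notation C := R[i].
Implicit Types (D : set T) (f g : T -> C).

Lemma measurable_complexP D f :
  measurable_fun D (fun x => complex.Re (f x)) ->
  measurable_fun D (fun x => complex.Im (f x)) -> measurable_fun D f.
Proof.
move=> mr mi mD.
have mr' := (measurable_restrictT _ mD).1 mr; have mi' := (measurable_restrictT _ mD).1 mi.
have mf : measurable_fun setT (@of_ReIm R \o (fun x => (((fun x => complex.Re (f x)) \_ D) x,
    ((fun x => complex.Im (f x)) \_ D) x))).
  by apply: measurableT_comp; [exact: measurable_of_ReIm|exact: measurable_fun_pair].
suff : measurable_fun D f by apply.
apply: eq_measurable_fun (measurable_funTS mf) => x xD.
by rewrite /= !patchE xD; case: (f x).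
Qed.

Lemma measurable_complex_Re D f : measurable_fun D f ->
  measurable_fun D (fun x => complex.Re (f x)).
Proof. by move=> mf; apply: measurableT_comp mf; exact: measurable_Re. Qed.

Lemma measurable_complex_Im D f : measurable_fun D f ->
  measurable_fun D (fun x => complex.Im (f x)).
Proof. by move=> mf; apply: measurableT_comp mf; exact: measurable_Im. Qed.

Lemma measurable_complexD D f g : measurable_fun D f -> measurable_fun D g ->
  measurable_fun D (fun x => f x + g x).
Proof.
move=> mf mg; apply: measurable_complexP.
- under eq_fun do rewrite ReD.
  by apply: measurable_funD; exact: measurable_complex_Re.
- under eq_fun do rewrite ImD.
  by apply: measurable_funD; exact: measurable_complex_Im.
Qed.

Lemma measurable_complexM D f g : measurable_fun D f -> measurable_fun D g ->
  measurable_fun D (fun x => f x * g x).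
Proof.
move=> mf mg; apply: measurable_complexP.
- under eq_fun do rewrite complexReM.
  by apply: measurable_funB; apply: measurable_funM;
    (exact: measurable_complex_Re || exact: measurable_complex_Im).
- under eq_fun do rewrite complexImM.
  by apply: measurable_funD; apply: measurable_funM;
    (exact: measurable_complex_Re || exact: measurable_complex_Im).
Qed.

Lemma measurable_complexX D f n : measurable_fun D f -> measurable_fun D (fun x => f x ^+ n).
Proof.
move=> mf; elim: n => [|n ih]; first exact: measurable_cst.
by under eq_fun do rewrite exprS; exact: measurable_complexM.
Qed.

Lemma measurable_complex_sum D (I : Type) (r : seq I) (f : I -> T -> C) :
  (forall i, measurable_fun D (f i)) -> measurable_fun D (fun x => \sum_(i <- r) f i x).
Proof.
move=> mf; elim: r => [|i r ih].
  by under eq_fun do rewrite big_nil; exact: measurable_cst.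
by under eq_fun do rewrite big_cons; exact: measurable_complexD.
Qed.

Lemma measurable_complex_prod D (I : Type) (r : seq I) (f : I -> T -> C) :
  (forall i, measurable_fun D (f i)) -> measurable_fun D (fun x => \prod_(i <- r) f i x).
Proof.
move=> mf; elim: r => [|i r ih].
  by under eq_fun do rewrite big_nil; exact: measurable_cst.
by under eq_fun do rewrite big_cons; exact: measurable_complexM.
Qed.

Lemma measurable_conjc D f : measurable_fun D f -> measurable_fun D (fun x => conjc (f x)).
Proof.
move=> mf; apply: measurable_complexP.
- rewrite (_ : (fun _ => _) = fun x => complex.Re (f x)); first exact: measurable_complex_Re.
  by apply/funext => x; case: (f x).
- rewrite (_ : (fun _ => _) = fun x => - complex.Im (f x)); last first.
    by apply/funext => x; case: (f x).
  by apply: measurableT_comp => //; exact: measurable_complex_Im.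
Qed.

Lemma measurable_normc2 D f : measurable_fun D f -> measurable_fun D (fun x => normc (f x) ^+ 2).
Proof.
move=> mf; under eq_fun do rewrite sqr_normc.
by apply: measurable_funD; apply: measurable_funX;
  [exact: measurable_complex_Re|exact: measurable_complex_Im].
Qed.

End complex_measurability.

Section boxes.
Context {R : realType}.
Local Notation C := R[i].

Definition rect (a b c e : R) : set C :=
  [set z | a <= complex.Re z <= b /\ c <= complex.Im z <= e].

Lemma rectE a b c e : @of_ReIm R @^-1` rect a b c e = (`[a, b] `*` `[c, e])%classic.
Proof. by apply/seteqP; split => -[x y] /=; rewrite !in_itv. Qed.

Lemma measurable_rect a b c e : measurable (rect a b c e).
Proof.
rewrite (_ : rect a b c e = @ReIm R @^-1` (`[a, b] `*` `[c, e])%classic).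
  rewrite -[X in measurable X]setTI; apply: measurable_ReIm => //.
  by apply: measurableX; exact: measurable_itv.
by apply/seteqP; split => -[x y] /=; rewrite !in_itv.
Qed.

Lemma lebesgue_C_rect a b c e : a <= b -> c <= e ->
  lebesgue_C (rect a b c e) = ((b - a) * (e - c))%:E.
Proof.
move=> ab ce; rewrite /lebesgue_C /pushforward rectE.
rewrite product_measure1E; [|exact: measurable_itv|exact: measurable_itv].
have h (x y : R) : x <= y -> @lebesgue_measure R `[x, y]%classic = (y - x)%:E.
  rewrite lebesgue_measure_itv/= lte_fin le_eqVlt => /predU1P[->|->//].
  by rewrite ltxx subrr.
by rewrite EFinM; congr (_ * _)%E; exact: h.
Qed.

Definition pbox n (P : 'I_n -> set C) : set 'rV[C]_n := [set z | forall i, P i (z ord0 i)].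

Lemma measurable_pbox n (P : 'I_n -> set C) : (forall i, measurable (P i)) -> measurable (pbox P).
Proof.
move=> mP; rewrite (_ : pbox P = \bigcap_(i in [set: 'I_n]) (row_coor i @^-1` P i)).
  apply: fin_bigcap_measurable => // i _.
  by rewrite -[X in measurable X]setTI; exact: measurable_row_coor.
by apply/seteqP; split => z h i; [move=> _; exact: h|exact: h].
Qed.

Lemma lebesgue_Cn_pbox n (P : 'I_n -> set C) (v : 'I_n -> R) :
  (forall i, measurable (P i)) -> (forall i, lebesgue_C (P i) = (v i)%:E) ->
  lebesgue_Cn R n (pbox P) = (\prod_i v i)%:E.
Proof.
elim: n P v => [|n ih] P v mP hv.
  by rewrite big_ord0 /= diracE mem_set// => -[].
rewrite /= /lebesgue_CS /pushforward big_ord_recl.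
have -> : @row_cons R n @^-1` pbox P = P ord0 `*` pbox (fun i => P (lift ord0 i)).
  apply/seteqP; split => -[x z] /= h; rewrite /pbox/=.
    split; first by have := h ord0; rewrite mxE unlift_none.
    by move=> i; have := h (lift ord0 i); rewrite mxE liftK.
  case: h => h0 h i; rewrite mxE.
  by case: (unliftP ord0 i) => [j|] -> /=; [exact: h|].
rewrite product_measure1E//; last by apply: measurable_pbox => i.
by rewrite EFinM; congr (_ * _)%E; [exact: hv|exact: ih].
Qed.

End boxes.

Section sphere_measure_facts.
Context {R : realType} {d : nat}.
Local Notation C := R[i].
Local Notation Cd := 'rV[R[i]]_d.
Local Notation sigma := (@sphere_measure R d).

Lemma normc_coord_le (z : Cd) i : normc (z ord0 i) <= enorm z.
Proof.
rewrite -(@ler_pXn2r _ 2) ?nnegrE ?normc_ge0 ?enorm_ge0// sqr_enorm (bigD1 i)//= lerDl.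
by rewrite sumr_ge0// => j _; exact: sqr_ge0.
Qed.

Lemma measurable_unit_sphere : measurable (@unit_sphere R d).
Proof.
rewrite [X in measurable X](_ : _ = @enorm R d @^-1` [set 1]).
  by rewrite -[X in measurable X]setTI; apply: measurable_enorm => //; exact: measurable_set1.
by apply/seteqP; split => z.
Qed.

Lemma lebesgue_ball_fin : (lebesgue_Cn R d unit_ball < +oo)%E.
Proof.
have h : lebesgue_C (rect (-1) 1 (-1) 1) = (2 * 2 : R)%:E.
  by rewrite lebesgue_C_rect ?opprK//; lra.
have := lebesgue_Cn_pbox (n := d) (P := fun=> rect (-1) 1 (-1) 1) (v := fun=> 2 * 2) (fun=> measurable_rect _ _ _ _) (fun=> h).
move=> hb; apply: (@le_lt_trans _ _ (lebesgue_Cn R d (pbox (fun=> rect (-1) 1 (-1) 1)))).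
  apply: le_measure; rewrite ?inE.
  - exact: measurable_unit_ball.
  - by apply: measurable_pbox => i; exact: measurable_rect.
  move=> z zb i; rewrite /rect/= -!ler_norml; split.
    by rewrite (le_trans (ler_Re_normc _))// (le_trans (normc_coord_le _ _))// ltW.
  by rewrite (le_trans (ler_Im_normc _))// (le_trans (normc_coord_le _ _))// ltW.
by rewrite hb ltry.
Qed.

Lemma sphere_measure_le1 A : measurable A -> (sigma A <= 1)%E.
Proof.
move=> mA; rewrite /sphere_measure.
set v := fine _.
have v0 : 0 <= v by rewrite fine_ge0.
have vE : lebesgue_Cn R d unit_ball = v%:E.
  by rewrite fineK// ge0_fin_numE// lebesgue_ball_fin.
apply: (@le_trans _ _ ((v^-1)%:E * v%:E)%E).
  apply: lee_wpmul2l; first by rewrite lee_fin invr_ge0.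
  rewrite -vE le_measure// ?inE.
  - apply: measurableI; last exact: measurable_unit_ball.
    by rewrite -[X in measurable X]setTI; exact: measurable_direction.
  - exact: measurable_unit_ball.
rewrite -EFinM lee_fin; have [->|v_neq0] := eqVneq v 0; first by rewrite mulr0.
by rewrite mulVf.
Qed.

Lemma enorm_torus_act (th : 'I_d -> C) (z : Cd) : (forall i, normc (th i) = 1) ->
  enorm (torus_act th z) = enorm z.
Proof.
move=> th1; rewrite /enorm; congr Num.sqrt; apply: eq_bigr => i _.
by rewrite mxE normcM th1 mul1r.
Qed.

Lemma direction_torus_act (th : 'I_d -> C) (z : Cd) : (forall i, normc (th i) = 1) ->
  direction (torus_act th z) = torus_act th (direction z).
Proof.
by move=> th1; rewrite /direction enorm_torus_act//; apply/rowP => i; rewrite !mxE mulrCA.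
Qed.

Lemma preserves_sphere_measure (th : 'I_d -> C) : (forall i, normc (th i) = 1) ->
  preserves sigma (torus_act th).
Proof.
move=> th1; have [mt ht] := preserves_lebesgue_Cn th1; split => // A mA.
rewrite /sphere_measure; congr (_ * _)%E.
have -> : @direction R d @^-1` (torus_act th @^-1` A) `&` unit_ball =
   torus_act th @^-1` (@direction R d @^-1` A `&` unit_ball).
  apply/seteqP; split => z; rewrite /unit_ball /preimage /setI /mkset;
    by rewrite enorm_torus_act// direction_torus_act.
apply: ht; apply: measurableI; last exact: measurable_unit_ball.
by rewrite -[X in measurable X]setTI; exact: measurable_direction.
Qed.

End sphere_measure_facts.

(*@@P4c@@*)
Section monomial_norms.
Context {R : realType} {d : nat}.
Local Notation C := R[i].
Local Notation Cd := 'rV[R[i]]_d.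
Local Notation sigma := (@sphere_measure R d).

Definition mon (b : 'I_d -> nat) (z : Cd) : C := \prod_i z ord0 i ^+ b i.

Lemma measurable_mon b D : measurable_fun D (mon b).
Proof.
apply: measurable_complex_prod => i; apply: measurable_complexX.
exact: (measurable_funTS (measurable_row_coor i)).
Qed.

Lemma normc_prod (I : finType) (P : pred I) (f : I -> C) :
  normc (\prod_(i | P i) f i) = \prod_(i | P i) normc (f i).
Proof. by apply: (big_morph _ normcM normc1). Qed.

(* Chebyshev *)
Lemma L2_sqnorm_ge (f : Cd -> C) (t : R) (U : set Cd) : 0 <= t ->
  measurable_fun unit_sphere f -> measurable U -> U `<=` unit_ball ->
  (forall z, U z -> enorm z != 0 /\ t <= normc (f (direction z)) ^+ 2) ->
  ((t / fine (lebesgue_Cn R d unit_ball))%:E * lebesgue_Cn R d U <= L2_sqnorm f)%E.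
Proof.
move=> t0 mf mU Uball hU.
have mS := @measurable_unit_sphere R d.
pose A := unit_sphere `&` [set z | t <= normc (f z) ^+ 2].
have mf2 := measurable_normc2 mf.
have mA : measurable A.
  have -> : A = unit_sphere `&` (fun z => normc (f z) ^+ 2) @^-1` `[t, +oo[.
    by apply/seteqP; split => z [zS]; rewrite /preimage/= in_itv/= andbT.
  exact: mf2.
apply: (@le_trans _ _ (t%:E * sigma A)%E).
  rewrite EFinM -muleA; apply: lee_wpmul2l; first by rewrite lee_fin.
  rewrite /sphere_measure; apply: lee_wpmul2l.
    by rewrite lee_fin invr_ge0 fine_ge0.
  apply: le_measure; rewrite ?inE//.
    apply: measurableI; last exact: measurable_unit_ball.
    by rewrite -[X in measurable X]setTI; exact: measurable_direction.
  move=> z Uz; have [z0 hz] := hU z Uz; split; last exact: Uball.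
  split => //; rewrite /unit_sphere/= /direction enormZ normc_real ger0_norm ?invr_ge0 ?enorm_ge0//.
  by rewrite mulVf.
rewrite -integral_cst//.
apply: (@le_trans _ _ (\int[sigma]_(z in A) (normc (f z) ^+ 2)%:E)%E).
  apply: ge0_le_integral => //.
  - apply/measurable_EFinP; apply: measurable_funS mf2 => //.
    by move=> z [].
  - by move=> z [_ ?]; rewrite lee_fin.
apply: ge0_subset_integral => //.
- exact/measurable_EFinP.
- by move=> z _; rewrite lee_fin sqr_ge0.
- by move=> z [].
Qed.

Lemma bernoulli_sub (x : R) k : 0 <= x <= 1 -> 1 - k%:R * x <= (1 - x) ^+ k.
Proof.
move=> /andP[x0 x1]; elim: k => [|k ih]; first by rewrite mul0r subr0.
rewrite exprS -[k.+1]addn1 natrD; have k0 : 0 <= k%:R :> R by [].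
have := ler_wpM2l (_ : 0 <= 1 - x) ih; rewrite subr_ge0 => /(_ x1); apply: le_trans.
have : 0 <= k%:R * x * x by rewrite !mulr_ge0.
lra.
Qed.

Lemma monomial_norm_ge (i0 : 'I_d) (al : 'I_d -> nat) :
  exists2 kap : R, 0 < kap & exists N, forall n,
    ((kap / n.+1%:R ^+ N)%:E <= L2_sqnorm (mon (fun i => if i == i0 then n else al i)))%E.
Proof.
have d0 : (0 < d)%N by exact: leq_ltn_trans (leq0n _) (ltn_ord i0).
have dR : 1 <= d%:R :> R by rewrite ler1n.
pose vB := fine (lebesgue_Cn R d unit_ball).
have vBE : lebesgue_Cn R d unit_ball = vB%:E.
  by rewrite fineK// ge0_fin_numE// lebesgue_ball_fin.
pose s := (\sum_i al i)%N.
pose N := (2 * s + 2 * d)%N.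
have main n : let e : R := (48 * d%:R * n.+1%:R)^-1 in
   exists2 U : set Cd, measurable U /\ U `<=` unit_ball &
   [/\ ((e ^+ (2 * d))%:E <= lebesgue_Cn R d U)%E &
     forall z, U z -> enorm z != 0 /\
       2^-1 * e ^+ (2 * s) <= normc (mon (fun i => if i == i0 then n else al i) (direction z)) ^+ 2].
  move=> e.
  pose dl : R := (12 * n.+1%:R)^-1.
  have nR : 1 <= n.+1%:R :> R by rewrite ler1n.
  have dl0 : 0 < dl by rewrite invr_gt0 mulr_gt0.
  have dl1 : dl * n.+1%:R = 12^-1 by rewrite /dl; field; rewrite gt_eqF.
  have dl_le : dl <= 12^-1 by rewrite lef_pV2 ?posrE ?mulr_gt0//; lra.
  have eE : e * (4 * d%:R) = dl.
    by rewrite /e /dl; field; rewrite addrC natr1 !pnatr_eq0 (gtn_eqF d0).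
  have e0 : 0 < e by rewrite invr_gt0 !mulr_gt0// ltr0n.
  have e_dl : e <= dl by rewrite -eE ler_peMr ?(ltW e0)//; lra.
  pose P i := if i == i0 then rect (1 - 3 * dl) (1 - 2 * dl) 0 dl else rect e (2 * e) e (2 * e).
  have mP i : measurable (P i) by rewrite /P; case: ifP => _; exact: measurable_rect.
  pose v i : R := if i == i0 then dl * dl else e * e.
  have vP i : lebesgue_C (P i) = (v i)%:E.
    by rewrite /P /v; case: ifP => _; rewrite lebesgue_C_rect; (congr EFin; ring) || lra.
  have zi0 z : pbox P z -> [/\ 1 - 3 * dl <= normc (z ord0 i0) & normc (z ord0 i0) ^+ 2 <= (1 - 2 * dl) ^+ 2 + dl ^+ 2].
    move=> /(_ i0); rewrite /P eqxx => -[/andP[r1 r2] /andP[i1 i2]].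
    split; first by rewrite (le_trans r1)// (le_trans (ler_norm _))// ler_Re_normc.
    by rewrite sqr_normc lerD// lerXn2r ?nnegrE//; lra.
  have zi z i : i != i0 -> pbox P z -> [/\ e <= normc (z ord0 i) & normc (z ord0 i) ^+ 2 <= 8 * e ^+ 2].
    move=> ii0 /(_ i); rewrite /P (negbTE ii0) => -[/andP[r1 r2] /andP[i1 i2]].
    split; first by rewrite (le_trans r1)// (le_trans (ler_norm _))// ler_Re_normc.
    rewrite sqr_normc (_ : 8 * e ^+ 2 = (2 * e) ^+ 2 + (2 * e) ^+ 2); last by ring.
    by rewrite lerD// lerXn2r ?nnegrE//; lra.
  have zball z : pbox P z -> enorm z < 1.
    move=> Pz; have [_ h0] := zi0 z Pz.
    rewrite -(@ltr_pXn2r _ 2) ?nnegrE ?enorm_ge0// expr1n sqr_enorm (bigD1 i0)//=.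
    have : \sum_(i < d | i != i0) normc (z ord0 i) ^+ 2 <= 8 * e ^+ 2 * d%:R.
      rewrite (@le_trans _ _ (\sum_(i < d | i != i0) 8 * e ^+ 2))//.
        by apply: ler_sum => i /zi/(_ Pz)[].
      rewrite sumr_const -[leLHS]mulr_natr ler_wpM2l ?mulr_ge0 ?sqr_ge0 ?(ltW e0)// ler_nat.
      by rewrite (leq_trans (max_card _))// card_ord.
    rewrite (_ : 8 * e ^+ 2 * d%:R = 2 * e * dl); last by rewrite -eE; ring.
    have : e * dl <= dl * dl by rewrite ler_wpM2r// ltW.
    by move: h0; nra.
  have zpos z : pbox P z -> 0 < enorm z.
    move=> Pz; rewrite (lt_le_trans _ (normc_coord_le z i0))//.
    by have [h _] := zi0 z Pz; lra.
  exists (pbox P); first by split => //; exact: measurable_pbox.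
  split.
    rewrite (lebesgue_Cn_pbox mP vP) lee_fin.
    have -> : e ^+ (2 * d) = \prod_(i < d) (e * e) by rewrite prodr_const card_ord -expr2 exprM.
    apply: ler_prod => i _; rewrite mulr_ge0 ?(ltW e0)//= /v; case: ifP => _ //.
    by rewrite ler_pM ?(ltW e0).
  move=> z Pz; have z1 := zball z Pz; have z0 := zpos z Pz.
  split; first by rewrite gt_eqF.
  have dz i : normc (z ord0 i) <= normc (direction z ord0 i).
    rewrite mxE normcM normc_real ger0_norm ?invr_ge0 ?enorm_ge0//.
    by rewrite ler_peMl ?normc_ge0// invf_ge1// ltW.
  have [h0 _] := zi0 z Pz.
  have x01 : 0 <= 3 * dl <= 1 by apply/andP; split; lra.
  have x0 : 0 <= 1 - 3 * dl by lra.
  have lowb : (1 - 3 * dl) ^+ n * e ^+ s <=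
      normc (mon (fun i => if i == i0 then n else al i) (direction z)).
    rewrite /mon normc_prod (bigD1 i0)//= eqxx ler_pM ?exprn_ge0 ?(ltW e0)//.
      by rewrite normcX lerXn2r ?nnegrE ?normc_ge0// (le_trans h0).
    rewrite (@le_trans _ _ (\prod_(i < d | i != i0) e ^+ al i))//.
      rewrite prodrXr ler_wiXn2l ?(ltW e0)//; first by lra.
      by rewrite /s [leqRHS](bigD1 i0)//= leq_addl.
    apply: ler_prod => i ii0; rewrite exprn_ge0 ?(ltW e0)//= (negbTE ii0) normcX.
    rewrite lerXn2r ?nnegrE ?normc_ge0 ?(ltW e0)//.
    by have [h _] := zi z i ii0 Pz; rewrite (le_trans h).
  have low0 : 0 <= (1 - 3 * dl) ^+ n * e ^+ s by rewrite mulr_ge0 ?exprn_ge0 ?(ltW e0).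
  rewrite (@le_trans _ _ (((1 - 3 * dl) ^+ n * e ^+ s) ^+ 2))//; last first.
    by rewrite lerXn2r ?nnegrE ?normc_ge0.
  rewrite exprMn -!exprM [(s * 2)%N]mulnC ler_wpM2r ?exprn_ge0 ?(ltW e0)//.
  rewrite (le_trans _ (bernoulli_sub _ x01))// natrM.
  have : n%:R * dl <= 12^-1 by rewrite -dl1 mulrC ler_wpM2l ?(ltW dl0)// ler_nat.
  lra.
have vB0 : 0 < vB.
  have [U [mU Uball] [hU _]] := main 0%N.
  rewrite -lte_fin -vBE (@lt_le_trans _ _ (lebesgue_Cn R d U))//.
    rewrite (lt_le_trans _ hU)// lte_fin exprn_gt0// invr_gt0 !mulr_gt0//; lra.
  by apply: le_measure; rewrite ?inE//; exact: measurable_unit_ball.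
exists ((2 * vB)^-1 * (48 * d%:R) ^- N).
  by rewrite mulr_gt0 ?invr_gt0 ?exprn_gt0 ?mulr_gt0//; lra.
exists N => n; have [U [mU Uball] [hU hz]] := main n.
set e : R := (48 * d%:R * n.+1%:R)^-1 in hU hz.
have e0 : 0 <= e by rewrite invr_ge0 !mulr_ge0.
have t00 : 0 <= 2^-1 * e ^+ (2 * s) by rewrite mulr_ge0 ?exprn_ge0.
apply: (le_trans _ (L2_sqnorm_ge t00 (@measurable_mon _ unit_sphere) mU Uball hz)).
have t0 : 0 <= 2^-1 * e ^+ (2 * s) / vB.
  by rewrite divr_ge0 ?(ltW vB0)// mulr_ge0 ?exprn_ge0.
rewrite -/vB; apply: (@le_trans _ _ ((2^-1 * e ^+ (2 * s) / vB)%:E * (e ^+ (2 * d))%:E)%E); last first.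
  by apply: lee_wpmul2l; rewrite ?lee_fin.
rewrite -EFinM lee_fin (_ : _ * e ^+ _ = (2 * vB)^-1 * e ^+ N); last first.
  by rewrite /N exprD; move: (e ^+ _) (e ^+ _) => x y; field; rewrite gt_eqF.
rewrite (_ : e ^+ N = (48 * d%:R) ^- N * n.+1%:R ^- N) ?mulrA//.
by rewrite /e exprVn [X in X^-1 = _]exprMn invfM.
Qed.

End monomial_norms.

(*@@P5a@@*)
Lemma le_integral_EFin {R : realType} d (T : measurableType d)
    (mu : {measure set T -> \bar R}) (D : set T) (f g : T -> R) : measurable D ->
  measurable_fun D f -> measurable_fun D g -> (forall x, D x -> 0 <= f x) ->
  (forall x, D x -> f x <= g x) ->
  (\int[mu]_(x in D) (f x)%:E <= \int[mu]_(x in D) (g x)%:E)%E.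
Proof.
move=> mD mf mg f0 fg; apply: ge0_le_integral => //; try exact/measurable_EFinP.
Qed.

Section L2_space.
Context {R : realType} {d : nat}.
Local Notation C := R[i].
Local Notation Cd := 'rV[R[i]]_d.
Local Notation sigma := (@sphere_measure R d).
Local Notation S := (@unit_sphere R d).
Implicit Types (u v w : Cd -> C).

Let mS : measurable S. Proof. exact: measurable_unit_sphere. Qed.

Definition Bil u v : R := \int[sigma]_(z in S) complex.Re (u z * conjc (v z)).

Definition nrm u : R := Num.sqrt (Bil u u).

Lemma L2D u v : L2 u -> L2 v -> L2 (fun z => u z + v z).
Proof.
move=> [mu fu] [mv fv]; split; first exact: measurable_complexD.
have mu2 := measurable_normc2 mu; have mv2 := measurable_normc2 mv.
apply: (@le_lt_trans _ _ (\int[sigma]_(z in S) (2 * normc (u z) ^+ 2 + 2 * normc (v z) ^+ 2)%:E)%E).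
  apply: le_integral_EFin => //.
  - by apply: measurable_normc2; exact: measurable_complexD.
  - by apply: measurable_funD; exact: measurable_funM.
  - by move=> z _; rewrite sqr_ge0.
  move=> z _; rewrite (@le_trans _ _ ((normc (u z) + normc (v z)) ^+ 2))//.
    by rewrite lerXn2r ?nnegrE ?normc_ge0 ?addr_ge0 ?normc_ge0// ler_normcD.
  by have := sqr_ge0 (normc (u z) - normc (v z)); nra.
have z0 (f : Cd -> C) z : 0 <= 2 * normc (f z) ^+ 2 by rewrite mulr_ge0 ?sqr_ge0.
under eq_integral do rewrite EFinD.
rewrite ge0_integralD//=; first last.
- by apply/measurable_EFinP; exact: measurable_funM.
- by move=> z _; rewrite lee_fin.
- by apply/measurable_EFinP; exact: measurable_funM.
- by move=> z _; rewrite lee_fin.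
have half (f : Cd -> C) : measurable_fun S (fun z => normc (f z) ^+ 2) -> (L2_sqnorm f < +oo)%E ->
    (\int[sigma]_(z in S) (2 * normc (f z) ^+ 2)%:E < +oo)%E.
  move=> mf ff; under eq_integral do rewrite EFinM.
  rewrite ge0_integralZl//; first by apply: lte_mul_pinfty.
    exact/measurable_EFinP.
  by move=> z _; rewrite lee_fin sqr_ge0.
by apply: lte_add_pinfty; exact: half.
Qed.

Lemma L2_bounded_mul (f : Cd -> C) (K : R) u :
  measurable_fun S f -> (forall z, S z -> normc (f z) <= K) -> L2 u ->
  L2 (fun z => f z * u z) /\ (L2_sqnorm (fun z => f z * u z)%R <= (K ^+ 2)%:E * L2_sqnorm u)%E.
Proof.
move=> mf fK [mu fu].
have h : (L2_sqnorm (fun z => f z * u z)%R <= (K ^+ 2)%:E * L2_sqnorm u)%E.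
  rewrite /L2_sqnorm -ge0_integralZl ?lee_fin ?sqr_ge0//.
  - under [leRHS]eq_integral do rewrite -EFinM.
    apply: le_integral_EFin => //.
    + by apply: measurable_normc2; exact: measurable_complexM.
    + by apply: measurable_funM => //; exact: measurable_normc2.
    + by move=> z _; rewrite sqr_ge0.
    move=> z Sz; rewrite normcM exprMn ler_wpM2r ?sqr_ge0//.
    by rewrite lerXn2r ?nnegrE ?normc_ge0 ?fK// (le_trans _ (fK z Sz))// normc_ge0.
  - by apply/measurable_EFinP; exact: measurable_normc2.
  - by move=> z _; rewrite lee_fin sqr_ge0.
split => //; split; first exact: measurable_complexM.
by rewrite (le_lt_trans h)// lte_mul_pinfty// lee_fin sqr_ge0.
Qed.

Lemma L2Z (c : C) u : L2 u -> L2 (fun z => c * u z).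
Proof.
by move=> hu; have [] := @L2_bounded_mul (fun=> c) (normc c) u _ _ hu.
Qed.

Lemma L2B u v : L2 u -> L2 v -> L2 (fun z => u z - v z).
Proof.
move=> hu hv; have := L2D hu (L2Z (-1) hv).
by under eq_fun do rewrite mulN1r.
Qed.

Lemma L2_integrable u v : L2 u -> L2 v ->
  sigma.-integrable S (EFin \o (fun z => complex.Re (u z * conjc (v z)))).
Proof.
move=> [mu fu] [mv fv]; apply/integrableP; split.
  apply/measurable_EFinP; apply: measurable_complex_Re; apply: measurable_complexM => //.
  exact: measurable_conjc.
have mu2 := measurable_normc2 mu; have mv2 := measurable_normc2 mv.
apply: (@le_lt_trans _ _ (\int[sigma]_(z in S) (normc (u z) ^+ 2 + normc (v z) ^+ 2)%:E)%E).
  apply: le_integral_EFin => //.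
  - apply: measurableT_comp => //; apply: measurable_complex_Re.
    by apply: measurable_complexM => //; exact: measurable_conjc.
  - exact: measurable_funD.
  move=> z _; rewrite /= (le_trans (ler_Re_normc _))// normcM normcJ.
  by have := sqr_ge0 (normc (u z) - normc (v z)); have := sqr_ge0 (normc (u z) + normc (v z)); nra.
under eq_integral do rewrite EFinD.
rewrite ge0_integralD//=; first exact: lte_add_pinfty.
- by move=> z _; rewrite lee_fin sqr_ge0.
- exact/measurable_EFinP.
- by move=> z _; rewrite lee_fin sqr_ge0.
- exact/measurable_EFinP.
Qed.

Lemma BilDl u1 u2 v : L2 u1 -> L2 u2 -> L2 v ->
  Bil (fun z => u1 z + u2 z) v = Bil u1 v + Bil u2 v.
Proof.
move=> h1 h2 hv; rewrite /Bil -RintegralD//; try exact: L2_integrable.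
by apply: eq_Rintegral => z _; rewrite mulrDl ReD.
Qed.

Lemma BilC u v : Bil u v = Bil v u.
Proof.
apply: eq_Rintegral => z _; rewrite !Re_mulJ; ring.
Qed.

Lemma BilZl (a : R) u v : L2 u -> L2 v -> Bil (fun z => a%:C%C * u z) v = a * Bil u v.
Proof.
move=> hu hv; rewrite /Bil -RintegralZl//; last exact: L2_integrable.
by apply: eq_Rintegral => z _; rewrite -mulrA ReZ.
Qed.

Lemma BilDr u v1 v2 : L2 u -> L2 v1 -> L2 v2 ->
  Bil u (fun z => v1 z + v2 z) = Bil u v1 + Bil u v2.
Proof. by move=> *; rewrite BilC BilDl// !(BilC u). Qed.

Lemma BilZr (a : R) u v : L2 u -> L2 v -> Bil u (fun z => a%:C%C * v z) = a * Bil u v.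
Proof. by move=> *; rewrite BilC BilZl// BilC. Qed.

Lemma BilBl u1 u2 v : L2 u1 -> L2 u2 -> L2 v ->
  Bil (fun z => u1 z - u2 z) v = Bil u1 v - Bil u2 v.
Proof.
move=> h1 h2 hv; have := BilDl h1 (L2Z (-1)%:C%C h2) hv.
rewrite BilZl// mulN1r => <-; apply: eq_Rintegral => z _.
by rewrite rmorphN1 mulN1r.
Qed.

Lemma BilBr u v1 v2 : L2 u -> L2 v1 -> L2 v2 ->
  Bil u (fun z => v1 z - v2 z) = Bil u v1 - Bil u v2.
Proof. by move=> *; rewrite BilC BilBl// !(BilC u). Qed.

Lemma Bil_ge0 u : 0 <= Bil u u.
Proof.
apply: Rintegral_ge0 => z _; rewrite mulcJ /= sqr_ge0//.
Qed.

Lemma L2_sqnormE u : L2 u -> L2_sqnorm u = (Bil u u)%:E.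
Proof.
move=> [mu fu]; rewrite /Bil /Rintegral fineK; last first.
  rewrite ge0_fin_numE; last first.
    by apply: integral_ge0 => z _; rewrite mulcJ /= lee_fin sqr_ge0.
  by under eq_integral do rewrite mulcJ.
by apply: eq_integral => z _; rewrite mulcJ.
Qed.

Lemma nrm_ge0 u : 0 <= nrm u. Proof. exact: sqrtr_ge0. Qed.

Lemma sqr_nrm u : nrm u ^+ 2 = Bil u u.
Proof. by rewrite sqr_sqrtr// Bil_ge0. Qed.

Lemma Bil_quadratic u v (t : R) : L2 u -> L2 v ->
  Bil (fun z => u z + t%:C%C * v z) (fun z => u z + t%:C%C * v z) =
  Bil u u + 2 * t * Bil u v + t ^+ 2 * Bil v v.
Proof.
move=> hu hv; have hv' := L2Z t%:C%C hv; have hw := L2D hu hv'.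
rewrite BilDl// !BilDr// !BilZl// !BilZr// (BilC v u); ring.
Qed.

Lemma Bil_cauchy_schwarz u v : L2 u -> L2 v -> `|Bil u v| <= nrm u * nrm v.
Proof.
move=> hu hv; have q t : 0 <= Bil u u + 2 * t * Bil u v + t ^+ 2 * Bil v v.
  by rewrite -Bil_quadratic// Bil_ge0.
rewrite -(@ler_pXn2r _ 2) ?nnegrE ?mulr_ge0 ?nrm_ge0// exprMn !sqr_nrm.
rewrite real_normK ?num_real//.
have a0 := Bil_ge0 u; have c0 := Bil_ge0 v.
move: q a0 c0; set a := Bil u u; set b := Bil u v; set c := Bil v v => q a0 c0.
have [c_eq0|c_neq0] := eqVneq c 0.
  rewrite c_eq0 mulr0; have [->|b0] := eqVneq b 0; first by rewrite expr0n.
  have := q (- (a + 1) / (2 * b)); rewrite c_eq0 mulr0 addr0.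
  by rewrite (_ : 2 * _ * b = - (a + 1)); [lra|field].
have c_gt0 : 0 < c by rewrite lt_neqAle eq_sym c_neq0.
have := q (- b / c).
have -> : a + 2 * (- b / c) * b + (- b / c) ^+ 2 * c = (a * c - b ^+ 2) / c.
  by field.
by rewrite pmulr_lge0 ?invr_gt0// subr_ge0.
Qed.

Lemma nrmD u v : L2 u -> L2 v -> nrm (fun z => u z + v z) <= nrm u + nrm v.
Proof.
move=> hu hv; rewrite -(@ler_pXn2r _ 2) ?nnegrE ?addr_ge0 ?nrm_ge0// sqrrD !sqr_nrm.
rewrite BilDl//; last exact: L2D.
rewrite !BilDr// (BilC v u).
have := le_trans (ler_norm _) (Bil_cauchy_schwarz hu hv); lra.
Qed.

Lemma nrmZ (c : C) u : L2 u -> nrm (fun z => c * u z) = normc c * nrm u.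
Proof.
move=> hu; rewrite /nrm -[normc c](ger0_norm (normc_ge0 c)) -sqrtr_sqr -sqrtrM ?sqr_ge0//.
congr Num.sqrt; rewrite -BilZl//.
apply: eq_Rintegral => z _; rewrite mulcJ -mulrA mulcJ ReZ.
by rewrite [LHS]/= normcM [LHS]exprMn.
Qed.

Lemma nrmB u v : L2 u -> L2 v -> nrm (fun z => u z - v z) <= nrm u + nrm v.
Proof.
move=> hu hv; have := nrmD hu (L2Z (-1) hv); rewrite nrmZ// normcN normc1 mul1r.
by under [X in nrm X]eq_fun do rewrite mulN1r.
Qed.

Lemma nrm_distC u v : nrm (fun z => u z - v z) = nrm (fun z => v z - u z).
Proof.
congr Num.sqrt; apply: eq_Rintegral => z _.
by rewrite !mulcJ normc_distC.
Qed.

Lemma nrm_bounded_mul (f : Cd -> C) (K : R) u : 0 <= K ->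
  measurable_fun S f -> (forall z, S z -> normc (f z) <= K) -> L2 u ->
  nrm (fun z => f z * u z) <= K * nrm u.
Proof.
move=> K0 mf fK hu; have [hfu] := L2_bounded_mul mf fK hu.
rewrite (L2_sqnormE hfu) (L2_sqnormE hu) -EFinM lee_fin => h.
by rewrite -(@ler_pXn2r _ 2) ?nnegrE ?mulr_ge0 ?nrm_ge0// exprMn !sqr_nrm.
Qed.

End L2_space.

(*@@P5b@@*)
Lemma half_series_bound {R : realType} (x : nat -> R) (K : R) : 0 <= K ->
  (forall k, `|x k.+1 - x k| <= K * (2^-1) ^+ k) ->
  exists2 l, x @ \oo --> l & forall n, `|l - x n| <= 2 * K * (2^-1) ^+ n.
Proof.
move=> K0 hx.
have bnd n p : `|x (n + p)%N - x n| <= 2 * K * ((2^-1) ^+ n - (2^-1) ^+ (n + p)).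
  elim: p => [|p IH]; first by rewrite addn0 !subrr normr0 mulr0.
  rewrite addnS (le_trans (ler_distD (x (n + p)%N) _ _))// (le_trans (lerD (hx _) IH))//.
  rewrite exprS; move: (_ ^+ (n + p)) (_ ^+ n) => y y'; lra.
have bnd' n p : `|x (n + p)%N - x n| <= 2 * K * (2^-1) ^+ n.
  by rewrite (le_trans (bnd n p))// ler_wpM2l ?mulr_ge0// gerBl exprn_ge0.
have cx : cvgn (series (fun k => x k.+1 - x k)).
  apply: normed_cvg; apply: (@series_le_cvg _ _ (geometric K 2^-1)).
  - by move=> n; exact: normr_ge0.
  - by move=> n; rewrite /= mulr_ge0 ?exprn_ge0.
  - by move=> n; exact: hx.
  - by apply: is_cvg_geometric_series; rewrite ger0_norm ?invf_lt1 ?ltr1n.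
have xE : x = fun n => series (fun k => x k.+1 - x k) n + x 0%N.
  by apply/funext => n; rewrite seriesEnat /= telescope_sumr// subrK.
exists (limn (series (fun k => x k.+1 - x k)) + x 0%N).
  by rewrite {1}xE; apply: cvgD => //; exact: cvg_cst.
set l := _ + _ => n.
have xl : x @ \oo --> l by rewrite {1}xE; apply: cvgD => //; exact: cvg_cst.
have xl' : `|x p - x n| @[p --> \oo] --> `|l - x n|.
  by apply: cvg_norm; apply: cvgB => //; exact: cvg_cst.
apply: (ler_cvg_to xl' (@cvg_cst _ (2 * K * (2^-1) ^+ n) _ _ _)).
by exists n => // p /= np; rewrite -(subnKC np).
Qed.

Lemma measurable_complexB d (T : measurableType d) {R : realType} (D : set T)
    (f g : T -> R[i]) : measurable_fun D f -> measurable_fun D g ->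
  measurable_fun D (fun x => f x - g x).
Proof.
move=> mf mg; have -> : (fun x => f x - g x) = (fun x => f x + (-1) * g x).
  by apply/funext => x; rewrite mulN1r.
by apply: measurable_complexD => //; apply: measurable_complexM.
Qed.

Section completeness.
Context {R : realType} {d : nat}.
Local Notation C := R[i].
Local Notation Cd := 'rV[R[i]]_d.
Local Notation sigma := (@sphere_measure R d).
Local Notation S := (@unit_sphere R d).

Let mS : measurable S. Proof. exact: measurable_unit_sphere. Qed.

(** Riesz and Fischer: along a sequence whose consecutive distances decrease
    geometrically, the weighted square function [sq] is integrable, and where it
    is finite it controls the speed of pointwise convergence. *)
Lemma L2_complete (u : nat -> Cd -> C) : (forall k, L2 (u k)) ->
  (forall k, Bil (fun z => u k.+1 z - u k z) (fun z => u k.+1 z - u k z) <= (8^-1) ^+ k) ->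
  exists2 g, L2 g & forall n, nrm (fun z => g z - u n z) ^+ 2 <= 32 * (4^-1) ^+ n.
Proof.
move=> hu hB.
pose w k z := u k.+1 z - u k z.
have hw k : L2 (w k) by exact: L2B.
pose t k z := 4 ^+ k * normc (w k z) ^+ 2.
have t0 k z : 0 <= t k z by rewrite mulr_ge0 ?sqr_ge0// exprn_ge0.
have mt k : measurable_fun S (EFin \o t k).
  apply/measurable_EFinP; apply: measurable_funM => //.
  by apply: measurable_normc2; exact: (hw k).1.
pose sq z := (\sum_(0 <= k <oo) (t k z)%:E)%E.
have sq0 z : (0 <= sq z)%E by apply: nneseries_ge0 => k _ _; rewrite lee_fin.
have msq : measurable_fun S sq.
  have h0 k z : S z -> xpredT k -> (0 <= (t k z)%:E)%E by rewrite lee_fin.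
  exact: (ge0_emeasurable_sum h0 (fun k _ => mt k)).
have isq : (\int[sigma]_(z in S) sq z <= 2%:E)%E.
  rewrite integral_nneseries//; last by move=> k z _; rewrite lee_fin.
  apply: lime_le.
    by apply: is_cvg_nneseries => k _ _; apply: integral_ge0 => z _; rewrite lee_fin.
  apply: nearW => n.
  apply: (@le_trans _ _ (\sum_(0 <= k < n) ((2^-1) ^+ k)%:E)%E).
    apply: lee_sum => k _.
    under eq_integral do rewrite EFinM.
    rewrite ge0_integralZl ?lee_fin ?exprn_ge0//; last first.
    - by move=> z _; rewrite lee_fin sqr_ge0.
    - by apply/measurable_EFinP; apply: measurable_normc2; exact: (hw k).1.
    rewrite -/(L2_sqnorm (w k)) L2_sqnormE// -EFinM lee_fin.
    rewrite (le_trans (ler_wpM2l _ (hB k))) ?exprn_ge0// -exprMn.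
    by rewrite (_ : 4 * 8^-1 = 2^-1 :> R)//; field.
  rewrite sumEFin lee_fin.
  have -> : \sum_(0 <= k < n) (2^-1 : R) ^+ k = 2 * (1 - (2^-1) ^+ n).
    elim: n => [|n IH]; first by rewrite big_nil expr0 subrr mulr0.
    by rewrite big_nat_recr//= IH exprS; move: (_ ^+ n) => y; field.
  by rewrite ler_piMr// gerBl exprn_ge0.
pose E := S `&` [set z | (sq z < +oo)%E].
have mE : measurable E by exact: emeasurable_fun_infty_o.
pose v k z : C := (\1_E z : R)%:C%C * u k z.
have mv k : measurable_fun S (v k).
  apply: measurable_complexM; last exact: (hu k).1.
  apply: measurable_complexP; last exact: measurable_cst.
  by apply: measurable_indic.
have step z k : S z -> E z -> normc (u k.+1 z - u k z) <= Num.sqrt (fine (sq z)) * (2^-1) ^+ k.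
  move=> Sz [_ /= Ez].
  rewrite -(@ler_pXn2r _ 2) ?nnegrE ?normc_ge0 ?mulr_ge0 ?sqrtr_ge0 ?exprn_ge0//.
  rewrite exprMn sqr_sqrtr ?fine_ge0// -exprM mulnC exprM.
  rewrite (_ : (2^-1) ^+ 2 = 4^-1 :> R); last by field.
  rewrite exprVn ler_pdivlMr ?exprn_gt0// mulrC -lee_fin fineK ?ge0_fin_numE//.
  rewrite (le_trans _ (@nneseries_lim_ge _ _ xpredT 0 k.+1 _))//; last first.
    by move=> n _ _; rewrite lee_fin.
  by rewrite big_nat_recr//= leeDr// sume_ge0// => n _; rewrite lee_fin.
pose K z := Num.sqrt (fine (sq z)).
have vstep z k : S z -> normc (v k.+1 z - v k z) <= K z * (2^-1) ^+ k.
  move=> Sz; rewrite /v indicE -mulrBr normcM normc_real.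
  case: (boolP (z \in E)) => [/set_mem Ez|_].
    by rewrite normr1 mul1r; exact: step.
  by rewrite normr0 mul0r mulr_ge0 ?sqrtr_ge0 ?exprn_ge0.
have vsR z k : S z -> `|complex.Re (v k.+1 z) - complex.Re (v k z)| <= K z * (2^-1) ^+ k.
  by move=> Sz; rewrite -ReB (le_trans (ler_Re_normc _))// vstep.
have vsI z k : S z -> `|complex.Im (v k.+1 z) - complex.Im (v k z)| <= K z * (2^-1) ^+ k.
  by move=> Sz; rewrite -ImB (le_trans (ler_Im_normc _))// vstep.
have cvgRI z (Sz : S z) := (half_series_bound (sqrtr_ge0 _) (fun k => vsR z k Sz),
  half_series_bound (sqrtr_ge0 _) (fun k => vsI z k Sz)).
pose g z := Complex (limn (fun k => complex.Re (v k z))) (limn (fun k => complex.Im (v k z))).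
have mg : measurable_fun S g.
  apply: measurable_complexP.
  - apply: (@measurable_fun_cvg _ _ _ _ (fun k z => complex.Re (v k z))) => [k|z Sz].
      exact: measurable_complex_Re.
    by have [[l lE _] _] := cvgRI z Sz; rewrite /= (cvg_lim _ lE).
  - apply: (@measurable_fun_cvg _ _ _ _ (fun k z => complex.Im (v k z))) => [k|z Sz].
      exact: measurable_complex_Im.
    by have [_ [l lE _]] := cvgRI z Sz; rewrite /= (cvg_lim _ lE).
have gv z n : S z -> normc (g z - v n z) <= 4 * K z * (2^-1) ^+ n.
  move=> Sz; have [[l lE hl] [l' lE' hl']] := cvgRI z Sz.
  rewrite (le_trans (ler_normc_ReIm _))// ReB ImB /= (cvg_lim _ lE)// (cvg_lim _ lE')//.
  rewrite (_ : 4 * K z * _ = 2 * K z * (2^-1) ^+ n + 2 * K z * (2^-1) ^+ n).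
    by rewrite lerD.
  by move: (_ ^+ n) => y; ring.
have key n : (L2_sqnorm (fun z => g z - u n z)%R <= (32 * (4^-1) ^+ n)%:E)%E.
  have c0 : 0 <= 16 * (4^-1 : R) ^+ n by rewrite mulr_ge0 ?exprn_ge0.
  apply: (@le_trans _ _ (\int[sigma]_(z in S) ((16 * (4^-1) ^+ n)%:E * sq z))%E); last first.
    rewrite ge0_integralZl// (@le_trans _ _ ((16 * (4^-1) ^+ n)%:E * 2%:E)%E)//.
      by rewrite lee_wpmul2l// lee_fin.
    by rewrite -EFinM lee_fin; move: (_ ^+ n) => y; lra.
  apply: ge0_le_integral => //.
  - by move=> z _; rewrite lee_fin sqr_ge0.
  - apply/measurable_EFinP; apply: measurable_normc2.
    by apply: measurable_complexB => //; exact: (hu n).1.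
  - exact: measurable_funeM.
  move=> z Sz; have [fz|] := boolP (sq z < +oo)%E; last first.
    rewrite -leNgt leye_eq => /eqP ->; rewrite gt0_muley ?leey//.
  have vu : v n z = u n z by rewrite /v indicE mem_set// mul1r.
  have := gv z n Sz; rewrite vu => h.
  rewrite -[sq z]fineK ?ge0_fin_numE// -EFinM lee_fin.
  rewrite (@le_trans _ _ ((4 * K z * (2^-1) ^+ n) ^+ 2))//.
    by rewrite lerXn2r ?nnegrE ?normc_ge0// (le_trans _ h)// normc_ge0.
  rewrite !exprMn sqr_sqrtr ?fine_ge0// -exprM mulnC exprM.
  rewrite (_ : (2^-1) ^+ 2 = 4^-1 :> R); last by field.
  by rewrite le_eqVlt; apply/orP; left; apply/eqP; move: (4^-1 ^+ n) => y; ring.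
have hgu n : L2 (fun z => g z - u n z).
  split; first by apply: measurable_complexB => //; exact: (hu n).1.
  by rewrite (le_lt_trans (key n))// ltry.
have hg : L2 g.
  by have := L2D (hgu 0%N) (hu 0%N); under eq_fun do rewrite subrK.
exists g => // n; rewrite sqr_nrm -lee_fin -L2_sqnormE//.
Qed.
End completeness.

(*@@P5c@@*)
Section orthogonality.
Context {R : realType} {d : nat}.
Local Notation C := R[i].
Local Notation Cd := 'rV[R[i]]_d.
Local Notation sigma := (@sphere_measure R d).
Local Notation S := (@unit_sphere R d).
Implicit Types (u v w : Cd -> C).

Let mS : measurable S. Proof. exact: measurable_unit_sphere. Qed.

Lemma L2_bounded u (K : R) : 0 <= K -> measurable_fun S u ->
  (forall z, S z -> normc (u z) <= K) -> L2 u /\ nrm u <= K.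
Proof.
move=> K0 mu uK.
have h : (L2_sqnorm u <= (K ^+ 2)%:E)%E.
  apply: (@le_trans _ _ (\int[sigma]_(z in S) (cst (K ^+ 2) z)%:E)%E).
    apply: le_integral_EFin => //.
    - exact: measurable_normc2.
    - by move=> z _; rewrite sqr_ge0.
    by move=> z Sz; rewrite lerXn2r ?nnegrE ?normc_ge0// uK.
  rewrite [leLHS](integral_cst sigma mS (K ^+ 2)%:E) -[leRHS]mule1 lee_wpmul2l ?lee_fin ?sqr_ge0//.
  exact: sphere_measure_le1.
have hu : L2 u by split => //; rewrite (le_lt_trans h) ?ltry.
split=> //; rewrite -(@ler_pXn2r _ 2) ?nnegrE ?nrm_ge0// sqr_nrm.
by rewrite -lee_fin -L2_sqnormE.
Qed.

Lemma Bil_torus_opp (th : 'I_d -> C) u v : (forall i, normc (th i) = 1) ->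
  L2 u -> L2 v ->
  (forall z, S z -> u (torus_act th z) * conjc (v (torus_act th z)) = - (u z * conjc (v z))) ->
  Bil u v = 0.
Proof.
move=> th1 hu hv huv; have [mT pT] := preserves_sphere_measure th1.
pose f z := complex.Re (u z * conjc (v z)).
have fi := L2_integrable hu hv.
have ST : torus_act th @^-1` S = S.
  by apply/seteqP; split => z; rewrite /preimage/unit_sphere/= enorm_torus_act.
have fT z : S z -> f (torus_act th z) = - f z.
  by move=> Sz; rewrite /f huv//; case: (_ * _).
have mfi : measurable_fun setT ((EFin \o f) \_ S).
  apply/(measurable_restrictT _ mS); exact: (measurable_int _ fi).
have E : (\int[sigma]_(z in S) ((EFin \o f) \_ S) z =
          \int[sigma]_(z in S) (((EFin \o f) \_ S) \o torus_act th) z)%E.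
  transitivity (\int[measure_function_pushforward__canonical__measure_function_Measure
      sigma mT]_(z in S) ((EFin \o f) \_ S) z)%E.
    by apply: eq_measure_integral => A mA _; rewrite -[LHS]pT.
  rewrite integral_pushforward// ?ST//.
  apply: (eq_integrable _ (fun z => - (EFin \o f) z)%E) => //.
    move=> z; rewrite inE => Sz /=; rewrite patchT/= ?fT//.
    by apply: mem_set; rewrite -ST in Sz.
  exact: integrableN.
have : (\int[sigma]_(z in S) (EFin \o f) z = - \int[sigma]_(z in S) (EFin \o f) z)%E.
  rewrite -integralN; last exact: integrable_add_def.
  have -> : (\int[sigma]_(z in S) (EFin \o f) z = \int[sigma]_(z in S) ((EFin \o f) \_ S) z)%E.
    by apply: eq_integral => z Sz; rewrite patchT.
  rewrite E.
  apply: eq_integral => z; rewrite inE => Sz /=; rewrite patchT/= ?fT//.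
  by apply: mem_set; rewrite -ST in Sz.
move=> /(congr1 fine); rewrite fineN -/(Bil u v) => /eqP.
by rewrite -subr_eq0 opprK -mulr2n mulrn_eq0/= => /eqP.
Qed.

(** Functions of different weights under a circle of rotations are orthogonal:
    a suitable root of unity turns the integrand into its opposite. *)
Lemma Bil_weight0 (th : C -> 'I_d -> C) u v p q : (forall s i, normc s = 1 -> normc (th s i) = 1) ->
  L2 u -> L2 v -> p != q ->
  (forall s z, normc s = 1 -> u (torus_act (th s) z) = s ^+ p * u z) ->
  (forall s z, normc s = 1 -> v (torus_act (th s) z) = s ^+ q * v z) ->
  Bil u v = 0.
Proof.
move=> th1; wlog qp : u v p q / (q < p)%N.
  move=> H hu hv pq hp hq; have [pq'|qp|pq'] := ltngtP p q.
  - by rewrite BilC; apply: (H v u q p) => //; rewrite eq_sym.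
  - exact: (H u v p q).
  - by rewrite pq' eqxx in pq.
move=> hu hv _ hp hq; set k := (p - q)%N; have k0 : (0 < k)%N by rewrite subn_gt0.
have [s sP] : {s : C | (k * 2).-primitive_root s} by apply: prim_root_exists; rewrite muln_gt0 k0.
have s1 : normc s = 1 by apply: normc_prim_root sP.
have sk : s ^+ k = -1.
  have /eqP := prim_expr_order sP; rewrite exprM sqrf_eq1.
  move=> /orP[|/eqP//]; rewrite -(prim_order_dvd sP) => /dvdn_leq => /(_ k0).
  by rewrite -{2}[k]muln1 leq_pmul2l.
apply: (@Bil_torus_opp (th s)) => // [i|z _]; first exact: th1.
rewrite hp// hq// rmorphM/= -(subnK (ltnW qp)) -/k exprD sk.
rewrite mulN1r !mulNr; congr (- _).
rewrite mulrACA mulcJ normcX s1 !expr1n mul1r //.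
Qed.

End orthogonality.

(*@@P5d@@*)
Section monomial_coefficients.
Context {R : realType} {d : nat}.
Local Notation C := R[i].
Local Notation Cd := 'rV[R[i]]_d.
Local Notation sigma := (@sphere_measure R d).
Local Notation S := (@unit_sphere R d).
Implicit Types (u v w : Cd -> C) (b g : multinom d) (P : mpoly d C).

Lemma normc_mon_le1 (e : 'I_d -> nat) (z : Cd) : S z -> normc (mon e z) <= 1.
Proof.
move=> Sz; rewrite /mon normc_prod; apply: prodr_ile1 => i _.
by rewrite normc_ge0 normcX exprn_ile1 ?normc_ge0// -Sz normc_coord_le.
Qed.

Lemma L2_mon (e : 'I_d -> nat) : L2 (@mon R d e) /\ nrm (@mon R d e) <= 1.
Proof.
apply: L2_bounded => //; first exact: measurable_mon.
by move=> z Sz; exact: normc_mon_le1.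
Qed.

Lemma L2_0 : @L2 R d (fun=> 0).
Proof.
by apply: (proj1 (@L2_bounded _ _ _ 0 _ _ _)) => // z _; rewrite normc0.
Qed.

Lemma L2_sum (I : Type) (r : seq I) (f : I -> Cd -> C) : (forall i, L2 (f i)) ->
  L2 (fun z => \sum_(i <- r) f i z).
Proof.
move=> hf; elim: r => [|i r ih].
  by under eq_fun do rewrite big_nil; exact: L2_0.
by under eq_fun do rewrite big_cons; exact: L2D.
Qed.

Lemma Bil_suml (I : Type) (r : seq I) (f : I -> Cd -> C) v : (forall i, L2 (f i)) -> L2 v ->
  Bil (fun z => \sum_(i <- r) f i z) v = \sum_(i <- r) Bil (f i) v.
Proof.
move=> hf hv; elim: r => [|i r ih].
  rewrite big_nil; under [X in Bil X _]eq_fun do rewrite big_nil.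
  have := BilZl 0 hv hv; rewrite mul0r => <-.
  by apply: eq_Rintegral => z _; rewrite rmorph0 !mul0r.
rewrite big_cons -ih -BilDl//; last exact: L2_sum.
by apply: eq_Rintegral => z _; rewrite big_cons.
Qed.

Lemma meval_mon P (z : Cd) : meval (z ord0) P = \sum_(k <- msupp P) (mcoeff k P) * mon k z.
Proof. by []. Qed.

Lemma mon_mul b g (z : Cd) : mon b z * mon g z = @mon R d (mnm_add b g) z.
Proof. by rewrite /mon -big_split/=; apply: eq_bigr => i _; rewrite mnmDE exprD. Qed.

Lemma L2_meval P : L2 (fun z : Cd => meval (z ord0) P).
Proof.
under eq_fun do rewrite meval_mon.
by apply: L2_sum => k; apply: L2Z; exact: (L2_mon k).1.
Qed.

Lemma meval_bounded P : exists2 K : R, 0 <= K & forall z, S z -> normc (meval (z ord0) P) <= K.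
Proof.
exists (\sum_(k <- msupp P) normc (mcoeff k P)).
  by apply: sumr_ge0 => k _; exact: normc_ge0.
move=> z Sz; rewrite meval_mon (le_trans (ler_normc_sum _ _ _))//.
apply: ler_sum => k _; rewrite normcM ler_piMr ?normc_ge0//.
exact: normc_mon_le1.
Qed.

Definition mon_weight b : R := Bil (mon b) (mon b).

Lemma Bil_mon g b (a c : C) : Bil (fun z => a * mon g z) (fun z => c * mon b z) =
  if g == b then complex.Re (a * conjc c) * mon_weight b else 0.
Proof.
have hL e x : L2 (fun z => x * @mon R d e z) by apply: L2Z; exact: (L2_mon _).1.
case: eqVneq => [->|gb].
  rewrite /mon_weight -BilZl; [|exact: (L2_mon _).1|exact: (L2_mon _).1].
  apply: eq_Rintegral => z _; rewrite rmorphM/= mulrACA -[in RHS]mulrA !mulcJ.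
  by rewrite [in LHS]mulrC !ReZ [LHS]mulrC.
have [i gbi] : exists i, g i != b i.
  apply/existsP; rewrite -negb_forall; apply: contra gb => /forallP h.
  by apply/eqP/mnmP => i; exact/eqP/h.
pose th (s : C) j := if j == i then s else 1.
have thE (e : multinom d) (s : C) z : mon e (torus_act (th s) z) = s ^+ e i * @mon R d e z.
  rewrite /mon (bigD1 i)//= mxE /th eqxx exprMn -mulrA; congr (_ * _).
  rewrite [RHS](bigD1 i)//=; congr (_ * _); apply: eq_bigr => j /negbTE ji.
  by rewrite mxE ji mul1r.
apply: (@Bil_weight0 R d th _ _ (g i) (b i)) => //.
- by move=> s j s1; rewrite /th; case: ifP => // _; rewrite normc1.
- by move=> s z _; rewrite thE mulrCA.
- by move=> s z _; rewrite thE mulrCA.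
Qed.

Lemma Bil_meval_mon P g b (c : C) :
  Bil (fun z : Cd => meval (z ord0) P * mon g z) (fun z => c * mon b z) =
  if [forall i, (g i <= b i)%N] then complex.Re ((mcoeff (mnm_sub b g) P) * conjc c) * mon_weight b else 0.
Proof.
have hL (e : multinom d) x : L2 (fun z => x * @mon R d e z) by apply: L2Z; exact: (L2_mon _).1.
transitivity (\sum_(k <- msupp P) Bil (fun z => (mcoeff k P) * mon (mnm_add k g) z) (fun z => c * mon b z)).
  rewrite -Bil_suml//; apply: eq_Rintegral => z _; congr (complex.Re (_ * _)).
  by rewrite meval_mon mulr_suml; apply: eq_bigr => k _; rewrite -mulrA mon_mul.
under eq_bigr do rewrite Bil_mon.
case: ifPn => [gb|ngb]; last first.
  rewrite big1// => k _; case: eqP => // E; case/negP: ngb.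
  by apply/forallP => i; rewrite -E mnmDE leq_addl.
rewrite (eq_bigr (fun k => if k == mnm_sub b g
    then complex.Re ((mcoeff (mnm_sub b g) P) * conjc c) * mon_weight b else 0)); last first.
  move=> k _; rewrite -{1}(submK gb) eqm_add2r.
  by case: eqP => // ->.
rewrite -big_mkcond/= big_const_seq.
have := msupp_uniq P => /count_uniq_mem ->.
case: (boolP (_ \in _)) => [_|]; first by rewrite /= addr0.
by rewrite -mcoeff_eq0 => /eqP ->; rewrite mul0r mul0r.
Qed.

End monomial_coefficients.

(*@@P5e@@*)
Lemma measurable_complex_cvg d (T : measurableType d) {R : realType} (D : set T)
    (f : nat -> T -> R[i]) (g : T -> R[i]) : (forall n, measurable_fun D (f n)) ->
  (forall x, D x -> forall e : R, 0 < e ->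
     exists N, forall n, (N <= n)%N -> normc (g x - f n x) <= e) ->
  measurable_fun D g.
Proof.
move=> mf h; apply: measurable_complexP.
- apply: (@measurable_fun_cvg _ _ _ _ (fun n x => complex.Re (f n x))) => [n|x Dx].
    exact: measurable_complex_Re.
  apply/cvgrPdist_le => e e0; have [N hN] := h x Dx e e0.
  exists N => // n /= Nn; rewrite -ReB (le_trans (ler_Re_normc _))//; exact: hN.
- apply: (@measurable_fun_cvg _ _ _ _ (fun n x => complex.Im (f n x))) => [n|x Dx].
    exact: measurable_complex_Im.
  apply/cvgrPdist_le => e e0; have [N hN] := h x Dx e e0.
  exists N => // n /= Nn; rewrite -ImB (le_trans (ler_Im_normc _))//; exact: hN.
Qed.

Section multiplier.
Context {R : realType} {d : nat}.
Local Notation C := R[i].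
Local Notation Cd := 'rV[R[i]]_d.
Local Notation sigma := (@sphere_measure R d).
Local Notation S := (@unit_sphere R d).
Implicit Types (u v w : Cd -> C) (b g : multinom d) (P : mpoly d C).

Let mS : measurable S. Proof. exact: measurable_unit_sphere. Qed.

Lemma mon_weight_gt0 b : (0 < d)%N -> 0 < @mon_weight R d b.
Proof.
move=> d0; have [kap kap0 [N /(_ (b (Ordinal d0)))]] :=
  @monomial_norm_ge R d (Ordinal d0) b.
have -> : (fun i => if i == Ordinal d0 then b (Ordinal d0) else b i) = b.
  by apply/funext => i; case: eqP => // ->.
rewrite L2_sqnormE ?lee_fin; last exact: (L2_mon _).1.
by apply: lt_le_trans; rewrite divr_gt0// exprn_gt0.
Qed.

Variables (d0 : (0 < d)%N) (m : Cd -> C) (M : R).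
Hypothesis mhol : holomorphic_on_ball m.
Hypothesis mM : forall z, unit_ball z -> normc (m z) <= M.
Variable A : nat -> Cd -> C.
Hypothesis hA : forall z rho, rho * enorm z <= 1 -> has_ps (A^~ z) rho (fun t => m (t *: z)).
Variable Q : nat -> mpoly d C.
Hypothesis hQ : forall k z, A k z = meval (z ord0) (Q k).

Definition dilate r : Cd -> C := fun z => m (r%:C%C *: z).

Lemma unit_ball_dilate r z : 0 <= r < 1 -> S z -> unit_ball (r%:C%C *: z).
Proof.
move=> /andP[r0 r1] Sz; rewrite /unit_ball/= enormZ normc_real ger0_norm//.
by rewrite (Sz : enorm z = 1) mulr1.
Qed.

Let M0 : 0 <= M.
Proof.
apply: (le_trans (normc_ge0 (m 0))); apply: mM; rewrite /unit_ball/= /enorm big1 ?sqrtr0//.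
by move=> i _; rewrite mxE normc0 expr0n.
Qed.

Lemma dilate_approx r (e : R) : 0 <= r < 1 -> 0 < e -> exists K, forall n z, (K <= n)%N -> S z ->
  normc (dilate r z - \sum_(k < n) r%:C%C ^+ k * A k z) <= e.
Proof.
move=> /andP[r0 r1] e0; pose s := (1 + r) / 2.
have s0 : 0 < s by rewrite /s; lra.
have s1 : s < 1 by rewrite /s; lra.
have rs : r < s by rewrite /s; lra.
have q1 : r / s < 1 by rewrite ltr_pdivrMr// mul1r.
have q0 : 0 <= r / s by rewrite divr_ge0// ltW.
have [K _ hK] : \forall n \near \oo, M * ((r / s) ^+ n / (1 - r / s)) <= e.
  have : (r / s) ^+ n @[n --> \oo] --> 0 by apply: cvg_expr; rewrite ger0_norm.
  move=> /cvgrPdist_le /(_ (e * (1 - r / s) / (M + 1))).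
  have e'0 : 0 < e * (1 - r / s) / (M + 1).
    by rewrite divr_gt0 ?mulr_gt0 ?subr_gt0// ltr_wpDl.
  move=> /(_ e'0) [K _ hK]; exists K => // n /hK /=; rewrite sub0r normrN ger0_norm ?exprn_ge0// => h.
  rewrite mulrA ler_pdivrMr ?subr_gt0// mulrC.
  rewrite (le_trans (ler_wpM2r M0 h))// mulrAC ler_pdivrMr ?ltr_wpDl//.
  rewrite ler_wpM2l ?lerDl// mulr_ge0 ?(ltW e0)// subr_ge0 ltW//.
exists K => n z Kn Sz.
have nr : normc (r%:C%C : C) = r by rewrite normc_real ger0_norm.
have := @has_ps_tail R (A^~ z) 1 (fun t => m (t *: z)) s M r%:C%C n.
rewrite nr => h; rewrite /dilate; under eq_bigr do rewrite mulrC.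
apply: (le_trans (h _ s0 _ rs r1) (hK _ Kn)).
  by apply: hA; rewrite (Sz : enorm z = 1) mul1r.
move=> k; apply: (homogeneous_part_le mM hA) => //.
by rewrite (Sz : enorm z = 1) mulr1.
Qed.

Let L2_A k : L2 (A k).
Proof. by rewrite (_ : A k = fun z => meval (z ord0) (Q k)); [exact: L2_meval|exact/funext/hQ]. Qed.

Lemma L2_dilate r : 0 <= r < 1 -> L2 (dilate r).
Proof.
move=> r01; apply: (proj1 (L2_bounded M0 _ _)); last first.
  by move=> z Sz; apply: mM; exact: unit_ball_dilate.
apply: (@measurable_complex_cvg _ _ _ _ (fun n z => \sum_(k < n) r%:C%C ^+ k * A k z)) => [n|z Sz e e0].
  by apply: measurable_complex_sum => k; apply: measurable_complexM => //; exact: (L2_A _).1.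
by have [K hK] := dilate_approx r01 e0; exists K => n Kn; exact: hK.
Qed.

(** By rotation invariance a homogeneous polynomial of degree [k] is orthogonal
    to the monomials of all other degrees. *)
Lemma homogeneous_part_coef0 k b : mdeg b != k -> mcoeff b (Q k) = 0.
Proof.
move=> bk; set c := mcoeff b (Q k).
have LB : L2 (fun z : Cd => c * mon b z) by apply: L2Z; exact: (L2_mon b).1.
have := Bil_meval_mon (Q k) (@mnm0 d) b c.
have -> : [forall i, (@mnm0 d i <= b i)%N] by apply/forallP => i; rewrite mnm0E.
have -> : mnm_sub b (@mnm0 d) = b by apply/mnmP => i; rewrite mnmBE mnm0E subn0.
have -> : Bil (fun z : Cd => meval (z ord0) (Q k) * mon (@mnm0 d) z) (fun z => c * mon b z) =
          Bil (A k) (fun z => c * mon b z).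
  apply: eq_Rintegral => z _; rewrite hQ /mon [X in _ * X * _]big1 ?mulr1// => i _.
  by rewrite mnm0E.
have act s z : torus_act (fun=> s) z = s *: z :> Cd by apply/rowP => i; rewrite !mxE.
rewrite (@Bil_weight0 R d (fun s _ => s) _ _ k (mdeg b)) //; last 3 first.
- by rewrite eq_sym.
- by move=> s z _; rewrite act (homogeneous_partZ hA).
- move=> s z _; rewrite mulrCA; congr (_ * _); rewrite /mon mdegE -prodrXr -big_split/=.
  by apply: eq_bigr => i _; rewrite mxE exprMn.
rewrite mulcJ /= -/c => /esym/eqP; rewrite mulf_eq0 (gt_eqF (mon_weight_gt0 b d0)) orbF.
by rewrite sqrf_eq0 normc_eq0 => /eqP.
Qed.

Definition taylor g : C := mcoeff g (Q (mdeg g)).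

Lemma Bil_dilate_mon r g b (c : C) : 0 <= r < 1 ->
  Bil (fun z => dilate r z * mon g z) (fun z => c * mon b z) =
  if [forall i, (g i <= b i)%N]
  then r ^+ mdeg (mnm_sub b g) * complex.Re (taylor (mnm_sub b g) * conjc c) * mon_weight b else 0.
Proof.
move=> r01; set X := (RHS).
have hv : L2 (fun z : Cd => c * mon b z) by apply: L2Z; exact: (L2_mon b).1.
have hg := L2_dilate r01.
have hm (f : Cd -> C) : L2 f -> L2 (fun z => f z * mon g z).
  move=> hf; under eq_fun do rewrite mulrC.
  apply: (proj1 (@L2_bounded_mul _ _ _ 1 _ _ _ hf)); first exact: measurable_mon.
  by move=> z Sz; exact: normc_mon_le1.
pose s n z := \sum_(k < n) r%:C%C ^+ k * A k z.
have hs n : L2 (s n) by apply: L2_sum => k; exact: L2Z.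
have sE n : (mdeg (mnm_sub b g) < n)%N -> Bil (fun z => s n z * mon g z) (fun z => c * mon b z) = X.
  move=> bn.
  have -> : Bil (fun z => s n z * mon g z) (fun z => c * mon b z) =
      \sum_(k < n) Bil (fun z : Cd => (r ^+ k)%:C%C * (meval (z ord0) (Q k) * mon g z)) (fun z => c * mon b z).
    rewrite -Bil_suml//; last first.
      by move=> k; apply: L2Z; apply: hm; exact: L2_meval.
    apply: eq_Rintegral => z _; congr (complex.Re (_ * _)).
    rewrite /s mulr_suml; apply: eq_bigr => k _.
    by rewrite hQ rmorphXn mulrA.
  have term (k : 'I_n) : Bil (fun z : Cd => (r ^+ k)%:C%C * (meval (z ord0) (Q k) * mon g z))
      (fun z => c * mon b z) = r ^+ k * (if [forall i, (g i <= b i)%N]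
      then complex.Re (mcoeff (mnm_sub b g) (Q k) * conjc c) * mon_weight b else 0).
    by rewrite BilZl ?Bil_meval_mon//; apply: hm; exact: L2_meval.
  rewrite (eq_bigr _ (fun k _ => term k)).
  rewrite /X; case: ifP => _; last by rewrite big1// => k _; rewrite mulr0.
  rewrite (bigD1 (Ordinal bn))//= big1 ?addr0 ?mulrA//= => k kb.
  rewrite homogeneous_part_coef0 ?mul0r ?mulr0//.
  by apply: contra kb => /eqP E; apply/eqP/val_inj.
apply/eqP; rewrite -subr_eq0 -normr_le0; apply/ler_addgt0Pr => e e0; rewrite add0r.
have n0 := nrm_ge0 (fun z : Cd => c * mon b z).
have e'0 : 0 < e / (nrm (fun z : Cd => c * mon b z) + 1) by rewrite divr_gt0// ltr_wpDl.
have [K hK] := dilate_approx r01 e'0.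
pose n := maxn K (mdeg (mnm_sub b g)).+1.
rewrite -(sE n) ?leq_maxr// -BilBl//; try exact: hm.
rewrite (le_trans (Bil_cauchy_schwarz (L2B (hm _ _) (hm _ _)) hv))//.
have h : nrm (fun z => dilate r z * mon g z - s n z * mon g z) <=
    e / (nrm (fun z : Cd => c * mon b z) + 1).
  apply: (proj2 (L2_bounded (ltW e'0) _ _)).
    by apply: (proj1 (L2B _ _)); exact: hm.
  move=> z Sz; rewrite -mulrBl normcM.
  by rewrite (le_trans (ler_piMr _ (normc_mon_le1 g Sz))) ?normc_ge0// hK// leq_maxl.
rewrite (le_trans (ler_wpM2r n0 h))//.
rewrite mulrAC ler_pdivrMr ?ltr_wpDl// ler_wpM2l ?(ltW e0)//; lra.
Qed.
End multiplier.

(*@@P5f@@*)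
Lemma cvg_at_left_normc {R : realType} (f : R -> R[i]) (l : R[i]) (x e : R) :
  f r @[r --> x^'-] --> l -> 0 < e ->
  exists2 dl, 0 < dl & forall r, x - dl < r -> r < x -> normc (l - f r) <= e.
Proof.
move=> /cvgrPdist_le /(_ e%:C%C) h e0.
have /h[dl /= dl0 hdl] : 0 < e%:C%C :> R[i] by rewrite ltcR.
exists dl => // r xr rx; have /= := hdl r; rewrite -lecR; apply => //.
by rewrite gtr0_norm ?subr_gt0//; lra.
Qed.

Definition radius {R : realType} (k : nat) : R := 1 - k.+2%:R^-1.

Lemma radius_itv {R : realType} k : 0 <= (radius k : R) < 1.
Proof.
rewrite /radius subr_ge0 invf_le1// ler1n/= ltrBlDr ltrDl invr_gt0//.
Qed.

Lemma radius_cvg {R : realType} : (radius k : R) @[k --> \oo] --> (1 : R).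
Proof.
rewrite -[X in _ --> X]subr0; apply: cvgB; first exact: cvg_cst.
by have /= := @cvg_harmonic R; rewrite -(cvg_shiftS (@harmonic R)).
Qed.

Section boundary.
Context {R : realType} {d : nat}.
Local Notation C := R[i].
Local Notation Cd := 'rV[R[i]]_d.
Local Notation sigma := (@sphere_measure R d).
Local Notation S := (@unit_sphere R d).
Implicit Types (u v w h : Cd -> C) (b g : multinom d) (P : mpoly d C).

Let mS : measurable S. Proof. exact: measurable_unit_sphere. Qed.

Lemma H2_nrmP h : H2 h <-> L2 h /\ forall e : R, 0 < e -> exists P, nrm (fun z => h z - meval (z ord0) P) <= e.
Proof.
split=> -[hh H]; split => // e e0.
  have [P hP] := H (e ^+ 2) (exprn_gt0 _ e0); exists P.
  rewrite -(@ler_pXn2r _ 2) ?nnegrE ?nrm_ge0 ?(ltW e0)// sqr_nrm -lee_fin.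
  by rewrite -L2_sqnormE ?ltW//; apply: L2B => //; exact: L2_meval.
have e'0 : 0 < Num.min 1 e / 2 by rewrite divr_gt0// lt_min ltr01.
have [P hP] := H _ e'0.
exists P; rewrite L2_sqnormE ?lte_fin; last by apply: L2B => //; exact: L2_meval.
rewrite -sqr_nrm; have n0 := nrm_ge0 (fun z => h z - meval (z ord0) P).
have [m1 m2] : Num.min 1 e <= 1 /\ Num.min 1 e <= e by rewrite !ge_min !lexx orbT.
have m0 : 0 < Num.min 1 e by rewrite lt_min ltr01.
move: (Num.min 1 e) (nrm _) m0 m1 m2 hP n0 => x y; nra.
Qed.

Lemma H2_meval_mul P h : H2 h -> H2 (fun z => meval (z ord0) P * h z).
Proof.
move=> /H2_nrmP[hh H]; have [K K0 hK] := meval_bounded P.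
have mP := (L2_meval P).1.
apply/H2_nrmP; split; first exact: (L2_bounded_mul mP hK hh).1.
move=> e e0; have e'0 : 0 < e / (K + 1) by rewrite divr_gt0// ltr_wpDl.
have [Q hQ] := H _ e'0; exists (P * Q).
under [X in nrm X]eq_fun do rewrite mevalM -mulrBr.
rewrite (le_trans (nrm_bounded_mul K0 mP hK _))//; first by apply: L2B => //; exact: L2_meval.
rewrite (le_trans (ler_wpM2l K0 hQ))// mulrA ler_pdivrMr ?ltr_wpDl// mulrC.
by rewrite ler_wpM2l ?(ltW e0)// lerDl.
Qed.

Variables (d0 : (0 < d)%N) (m : Cd -> C) (M : R).
Hypothesis mhol : holomorphic_on_ball m.
Hypothesis mM : forall z, unit_ball z -> normc (m z) <= M.
Variable A : nat -> Cd -> C.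
Hypothesis hA : forall z rho, rho * enorm z <= 1 -> has_ps (A^~ z) rho (fun t => m (t *: z)).
Variable Q : nat -> mpoly d C.
Hypothesis hQ : forall k z, A k z = meval (z ord0) (Q k).
Variable ms : Cd -> C.
Hypothesis mms : measurable_fun S ms.
Hypothesis msM : forall z, S z -> normc (ms z) <= M.
Hypothesis ms_lim : {ae sigma, forall z, S z -> m (r%:C%C *: z) @[r --> (1 : R)^'-] --> ms z}.

Let M0 : 0 <= M.
Proof.
apply: (le_trans (normc_ge0 (m 0))); apply: mM; rewrite /unit_ball/= /enorm big1 ?sqrtr0//.
by move=> i _; rewrite mxE normc0 expr0n.
Qed.

Lemma L2_boundary : L2 ms. Proof. exact: (proj1 (L2_bounded M0 mms msM)). Qed.

Let L2_dil k : L2 (dilate m (radius k)).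
Proof. by apply: (L2_dilate mM hA hQ); exact: radius_itv. Qed.

Lemma nrm_dilate_cvg : nrm (fun z => dilate m (radius k) z - ms z) @[k --> \oo] --> 0.
Proof.
have Ld k : L2 (fun z => dilate m (radius k) z - ms z) by apply: L2B => //; exact: L2_boundary.
have M2 : 0 <= (2 * M) ^+ 2 by rewrite exprn_ge0// mulr_ge0.
have mf k : measurable_fun S (fun z => (normc (dilate m (radius k) z - ms z) ^+ 2)%:E).
  by apply/measurable_EFinP; apply: measurable_normc2; exact: (Ld k).1.
have ic : sigma.-integrable S (cst ((2 * M) ^+ 2)%:E).
  apply/integrableP; split; first exact: measurable_cst.
  under eq_integral do rewrite /= ger0_norm//.
  rewrite [ltLHS](integral_cst sigma mS ((2 * M) ^+ 2)%:E).
  rewrite lte_mul_pinfty ?lee_fin//.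
  by rewrite (le_lt_trans (sphere_measure_le1 mS)) ?ltry.
have ptw : {ae sigma, forall z, S z ->
    (normc (dilate m (radius k) z - ms z) ^+ 2)%:E @[k --> \oo] --> (cst 0%E z : \bar R)}.
  apply: filterS ms_lim => z /[swap] Sz /(_ Sz) hz.
  apply: cvg_EFin; first by apply: nearW.
  apply/cvgrPdist_le => e e0.
  have m0 : 0 < Num.min 1 e by rewrite lt_min ltr01.
  have [dl dl0 hdl] := cvg_at_left_normc hz m0.
  have /cvgrPdist_lt/(_ dl dl0)[N _ hN] := @radius_cvg R.
  exists N => // k /hN /=; have /andP[_ r1] := @radius_itv R k.
  rewrite gtr0_norm ?subr_gt0// => rdl; rewrite sub0r normrN ger0_norm ?sqr_ge0//.
  have {}hdl := hdl (radius k) _ r1; rewrite normc_distC.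
  have r2 : 1 - dl < (radius k : R) by lra.
  have {}hdl := hdl r2; rewrite /dilate.
  have [m1 m2] : Num.min 1 e <= 1 /\ Num.min 1 e <= e by rewrite !ge_min !lexx orbT.
  have n0 := normc_ge0 (ms z - m ((radius k)%:C%C *: z)).
  move: (Num.min 1 e) (normc _) m0 m1 m2 hdl n0 => x y; nra.
have bnd : {ae sigma, forall z n, S z ->
    (`|(normc (dilate m (radius n) z - ms z) ^+ 2)%:E| <= cst ((2 * M) ^+ 2)%:E z)%E}.
  apply: aeW => z n Sz; rewrite /= ger0_norm ?sqr_ge0// lee_fin.
  rewrite lerXn2r ?nnegrE ?normc_ge0 ?mulr_ge0// (le_trans (ler_normcB _ _))//.
  rewrite mulr2n mulrDl mul1r lerD ?msM// mM//.
  by apply: unit_ball_dilate => //; exact: radius_itv.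
have [_ _] := dominated_convergence mS mf (measurable_cst _) ptw ic bnd.
rewrite integral_cst// mul0e => h.
have {}h : Bil (fun z => dilate m (radius k) z - ms z) (fun z => dilate m (radius k) z - ms z)
     @[k --> \oo] --> 0.
  apply: fine_cvg; apply: cvg_trans h; apply: near_eq_cvg; apply: nearW => k.
  by apply: eq_integral => z _; rewrite mulcJ.
rewrite -[0]sqrtr0; apply: continuous_cvg h; exact: sqrt_continuous.
Qed.

Lemma Bil_boundary_mon g b (c : C) :
  Bil (fun z => ms z * mon g z) (fun z => c * mon b z) =
  if [forall i, (g i <= b i)%N]
  then complex.Re (taylor Q (mnm_sub b g) * conjc c) * mon_weight b else 0.
Proof.
have hv : L2 (fun z : Cd => c * mon b z) by apply: L2Z; exact: (L2_mon b).1.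
have hm (f : Cd -> C) : L2 f -> L2 (fun z => f z * mon g z) /\
    nrm (fun z => f z * mon g z) <= nrm f.
  move=> hf; under eq_fun do rewrite mulrC.
  have mg : measurable_fun S (@mon R d g) by exact: measurable_mon.
  have g1 z : S z -> normc (mon g z) <= 1 by exact: normc_mon_le1.
  split; first exact: (L2_bounded_mul mg g1 hf).1.
  by rewrite -[leRHS]mul1r; apply: nrm_bounded_mul.
pose x k := Bil (fun z => dilate m (radius k) z * mon g z) (fun z => c * mon b z).
have c1 : x @ \oo --> Bil (fun z => ms z * mon g z) (fun z => c * mon b z).
  apply/cvgrPdist_le => e e0.
  have n0 := nrm_ge0 (fun z : Cd => c * mon b z).
  have e'0 : 0 < e / (nrm (fun z : Cd => c * mon b z) + 1) by rewrite divr_gt0// ltr_wpDl.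
  have /cvgrPdist_le/(_ _ e'0)[N _ hN] := nrm_dilate_cvg.
  exists N => // k /hN /=; rewrite sub0r normrN ger0_norm ?nrm_ge0// => h.
  have Lb := L2_boundary.
  rewrite distrC /x -BilBl//; [|exact: (hm _ _).1|exact: (hm _ _).1].
  have LB : L2 (fun z => dilate m (radius k) z - ms z) by exact: L2B.
  under [X in Bil X _]eq_fun do rewrite -mulrBl.
  rewrite (le_trans (Bil_cauchy_schwarz (hm _ LB).1 hv))//.
  rewrite (le_trans (ler_wpM2r n0 (hm _ LB).2))// (le_trans (ler_wpM2r n0 h))//.
  by rewrite mulrAC ler_pdivrMr ?ltr_wpDl// ler_wpM2l ?(ltW e0)//; lra.
rewrite -(cvg_lim _ c1)//; apply: cvg_lim => //.
have -> : x = fun k => if [forall i, (g i <= b i)%N] then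
    radius k ^+ mdeg (mnm_sub b g) * complex.Re (taylor Q (mnm_sub b g) * conjc c) * mon_weight b
    else 0.
  by apply/funext => k; exact: (Bil_dilate_mon d0 mM hA hQ g b c (radius_itv k)).
case: ifP => _; last exact: cvg_cst.
set q := complex.Re _; set y := mon_weight b.
rewrite (_ : q * y = 1 * q * y); last by rewrite mul1r.
apply: cvgM; last exact: cvg_cst.
apply: cvgM; last exact: cvg_cst.
have h : radius k ^+ mdeg (mnm_sub b g) @[k --> \oo] --> (1 : R) ^+ mdeg (mnm_sub b g).
  exact: (cvg_comp _ _ radius_cvg (@exprn_continuous R _ 1)).
by move: h; rewrite expr1n.
Qed.

Lemma H2_boundary : H2 ms.
Proof.
apply/H2_nrmP; split => [|e e0]; first exact: L2_boundary.
have e2 : 0 < e / 2 by rewrite divr_gt0.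
have /cvgrPdist_le/(_ _ e2)[k _ /(_ _ (leqnn k))/=] := nrm_dilate_cvg.
rewrite sub0r normrN ger0_norm ?nrm_ge0// nrm_distC => hk.
have [K /(_ K _ (leqnn K)) hK] := dilate_approx mM hA (radius_itv k) e2.
exists (\sum_(i < K) (radius k)%:C%C ^+ i *: Q i).
set P := \sum_(i < K) _.
have PE (z : Cd) : meval (z ord0) P = \sum_(i < K) (radius k)%:C%C ^+ i * A i z.
  by rewrite /P raddf_sum/=; apply: eq_bigr => i _; rewrite mevalZ hQ.
have Lb := L2_boundary.
have LP : L2 (fun z : Cd => dilate m (radius k) z - meval (z ord0) P).
  by apply: L2B => //; exact: L2_meval.
have := @nrmD _ _ (fun z => ms z - dilate m (radius k) z) _ (L2B Lb (L2_dil k)) LP.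
under [X in nrm X <= _]eq_fun do rewrite addrA subrK.
move=> h; rewrite (le_trans h)// [leRHS]splitr lerD//.
apply: (proj2 (L2_bounded (ltW e2) LP.1 _)) => z Sz; rewrite PE; exact: hK.
Qed.

End boundary.

(*@@P5g@@*)
Section leading_slice.
Context {R : realType} {d : nat}.
Local Notation C := R[i].
Local Notation Cd := 'rV[R[i]]_d.
Local Notation S := (@unit_sphere R d).
Implicit Types (u v : Cd -> C) (b g k : multinom d) (P : mpoly d C).
Variable i0 : 'I_d.

Definition axis n : multinom d := mnm_muln (mnm1 i0) n.

Lemma axisE n i : axis n i = if i == i0 then n else 0%N.
Proof. by rewrite mulmnE mnm1E eq_sym; case: eqP; rewrite ?mul1n ?mul0n. Qed.

Definition off_axis g : nat := \sum_(i < d | i != i0) g i.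

Lemma Bil_coef_bound u b (x : C) : L2 u -> 0 < @mon_weight R d b ->
  (forall c, Bil u (fun z => c * mon b z) = complex.Re (x * conjc c) * mon_weight b) ->
  normc x <= nrm u / Num.sqrt (mon_weight b).
Proof.
move=> hu b0 hx; rewrite ler_pdivlMr ?sqrtr_gt0//.
have [->|x0] := eqVneq x 0; first by rewrite normc0 mul0r nrm_ge0.
have hm := (@L2_mon R d b).1.
have := Bil_cauchy_schwarz hu (L2Z x hm); rewrite hx mulcJ /= nrmZ// => /(le_trans (ler_norm _)).
have -> : nrm (@mon R d b) = Num.sqrt (mon_weight b) by [].
have s0 : 0 < Num.sqrt (@mon_weight R d b) by rewrite sqrtr_gt0.
have n0 : 0 < normc x by rewrite normc_gt0.
rewrite -[mon_weight b](sqr_sqrtr (ltW b0)); move: (Num.sqrt (mon_weight b)) s0 => s s0.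
by rewrite sqrtr_sqr (ger0_norm (ltW s0)) -exprMn expr2 ler_pM2r// mulr_gt0.
Qed.

Variables (ms : Cd -> C) (T : multinom d -> C).
Hypothesis Lms : forall P, L2 (fun z => ms z * meval (z ord0) P).
Hypothesis hB : forall g b c, Bil (fun z => ms z * mon g z) (fun z => c * mon b z) =
  if [forall i, (g i <= b i)%N]
  then complex.Re (T (mnm_sub b g) * conjc c) * mon_weight b else 0.
Hypothesis T_neq0 : exists g, T g != 0.

Lemma exists_leading_slice : exists al : multinom d, [/\ al i0 = 0%N,
  exists j, T (mnm_add al (axis j)) != 0 & forall g, T g != 0 -> (off_axis al <= off_axis g)%N].
Proof.
have ex : exists w, `[< exists2 g, T g != 0 & off_axis g = w >].
  by have [g hg] := T_neq0; exists (off_axis g); apply/asboolP; exists g.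
case: (ex_minnP ex) => w /asboolP[g Tg gw] wmin.
pose al := mnm_sub g (axis (g i0)).
have alE : mnm_add al (axis (g i0)) = g.
  apply/mnmP => i; rewrite mnmDE mnmBE axisE; case: eqP => [->|_].
    by rewrite subnn.
  by rewrite subn0 addn0.
exists al; split.
- by rewrite mnmBE axisE eqxx subnn.
- by exists (g i0); rewrite alE.
move=> g' Tg'; apply: leq_trans (wmin _ _); last by apply/asboolP; exists g'.
rewrite -gw; apply: leq_sum => i /negbTE ii0.
by rewrite mnmBE axisE ii0 subn0.
Qed.

Variable al : multinom d.
Hypothesis al0 : al i0 = 0%N.
Hypothesis al_min : forall g, T g != 0 -> (off_axis al <= off_axis g)%N.

Definition slice n : C := T (mnm_add al (axis n)).

Definition restriction P : {poly C} := \poly_(l < msize P) mcoeff (axis l) P.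

Lemma restrictionE P l : (restriction P)`_l = mcoeff (axis l) P.
Proof.
rewrite coef_poly; case: ltnP => // h; apply/esym/memN_msupp_eq0/msize_mdeg_ge.
by rewrite mdegE (bigD1 i0)//= axisE eqxx (leq_trans h)// leq_addr.
Qed.

(** By minimality of [al] only the monomials of [P] on the axis [i0] contribute
    to the coefficients of the product along the slice through [al]. *)
Lemma Bil_slice P n (c : C) :
  Bil (fun z => ms z * meval (z ord0) P) (fun z => c * mon (mnm_add al (axis n)) z) =
  complex.Re (conv slice (restriction P) n * conjc c) * mon_weight (mnm_add al (axis n)).
Proof.
set b := mnm_add al (axis n).
have hm e x : L2 (fun z => x * @mon R d e z) by apply: L2Z; exact: (L2_mon _).1.
pose F k := if [forall i, (k i <= b i)%N] then mcoeff k P * T (mnm_sub b k) else 0.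
have cM (x y : C) : conjc (x * y) = conjc x * conjc y by exact: rmorphM.
have step k : Bil (fun z => mcoeff k P * (ms z * mon k z)) (fun z => c * mon b z) =
    complex.Re (F k * conjc c) * mon_weight b.
  rewrite (_ : Bil _ _ = Bil (fun z => ms z * mon k z)
      (fun z => (conjc (mcoeff k P) * c) * mon b z)); last first.
    apply: eq_Rintegral => z _; congr complex.Re.
    by rewrite -(mulrA (conjc _)) (cM (conjc _)) conjcK [RHS]mulrCA [RHS]mulrA.
  rewrite hB /F; case: ifP => _; last by rewrite !mul0r.
  by rewrite cM conjcK mulrA [T _ * _]mulrC.
have Lk k : L2 (fun z => mcoeff k P * (ms z * mon k z)).
  apply: L2Z; have := Lms (mpolyX C k).
  by under eq_fun do rewrite mevalX.
transitivity (\sum_(k <- msupp P) Bil (fun z => mcoeff k P * (ms z * mon k z)) (fun z => c * mon b z)).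
  rewrite -Bil_suml//; apply: eq_Rintegral => z _; congr (complex.Re (_ * _)).
  by rewrite meval_mon mulr_sumr; apply: eq_bigr => k _; rewrite mulrCA.
under eq_bigr do rewrite step.
rewrite -mulr_suml -Re_sum -mulr_suml; congr (complex.Re (_ * _) * _).
have FE k : F k = \sum_(l < n.+1) (if k == axis l then mcoeff (axis l) P * slice (n - l) else 0).
  have [[l ->]|nk] := pselect (exists l : 'I_n.+1, k = axis l).
    rewrite (bigD1 l)//= eqxx big1 ?addr0 => [|l' ll']; last first.
      case: eqP => // /mnmP/(_ i0); rewrite !axisE eqxx => E.
      by case/negP: ll'; apply/eqP/val_inj.
    have ln : (l <= n)%N by rewrite -ltnS.
    rewrite /F ifT.
      congr (_ * T _); apply/mnmP => i; rewrite mnmBE !mnmDE !axisE.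
      by case: eqP => // _; rewrite ?addnBA// subn0.
    by apply/forallP => i; rewrite mnmDE !axisE; case: eqP => // _; rewrite (leq_trans ln)// leq_addl.
  rewrite big1 => [|l _]; last by case: eqP => // E; case: nk; exists l.
  rewrite /F; case: ifP => // /forallP kb.
  have [->|/al_min h] := eqVneq (T (mnm_sub b k)) 0; first by rewrite mulr0.
  case: nk.
  have kn : (k i0 < n.+1)%N by have := kb i0; rewrite mnmDE al0 axisE eqxx add0n ltnS.
  exists (Ordinal kn); apply/mnmP => i; rewrite axisE/=; case: eqP => [->//|/eqP ii0].
  have offb : off_axis b = off_axis al.
    by apply: eq_bigr => j /negbTE jj0; rewrite mnmDE axisE jj0 addn0.
  have : off_axis (mnm_sub b k) = (off_axis b - off_axis k)%N.
    rewrite /off_axis -sumnB//.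
    by apply: eq_bigr => j _; rewrite mnmBE.
  move=> E; rewrite E offb in h.
  have kle : (off_axis k <= off_axis b)%N by apply: leq_sum.
  have k0 : off_axis k = 0%N by rewrite offb in kle; lia.
  by move/eqP: k0; rewrite sum_nat_eq0 => /forallP/(_ i)/implyP/(_ ii0)/eqP.
rewrite (eq_bigr _ (fun k _ => FE k)) exchange_big/= /conv; apply: eq_bigr => l _.
rewrite restrictionE -big_mkcond/= big_const_seq (count_uniq_mem _ (msupp_uniq P)).
case: (boolP (_ \in _)) => [_|]; first by rewrite /= addr0.
by rewrite -mcoeff_eq0 => /eqP ->; rewrite mul0r.
Qed.

End leading_slice.

(*@@P5h@@*)
Section coefficient_bound.
Context {R : realType} {d : nat}.
Local Notation C := R[i].
Local Notation Cd := 'rV[R[i]]_d.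
Local Notation S := (@unit_sphere R d).
Implicit Types (u v : Cd -> C) (b g k : multinom d) (P : mpoly d C).
Variable i0 : 'I_d.

Lemma taylor_neq0 (m : Cd -> C) (A : nat -> Cd -> C) (Q : nat -> mpoly d C) :
  (forall z rho, rho * enorm z <= 1 -> has_ps (A^~ z) rho (fun t => m (t *: z))) ->
  (forall j z, A j z = meval (z ord0) (Q j)) ->
  (exists2 z, unit_ball z & m z <> 0) -> exists g, taylor Q g != 0.
Proof.
move=> hA hQ [z zB mz0]; have d0 : (0 < d)%N by case: (posnP d) => // d0; have := ltn_ord i0; rewrite [X in (_ < X)%N]d0.
apply: contrapT => nex; apply: mz0; apply/eqP; rewrite -normc_eq0 -normr_le0 ger0_norm ?normc_ge0//.
have Q0 (j : nat) : Q j = 0.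
  apply/mpolyP => b; rewrite mcoeff0.
  have [<-|bk] := eqVneq (mdeg b) j; last exact: (homogeneous_part_coef0 d0 hA hQ).
  by apply/eqP; apply: contrapT => /negP h; apply: nex; exists b.
have [rho rho1 hrho] : exists2 rho : R, 1 < rho & rho * enorm z <= 1.
  have [->|z0] := eqVneq (enorm z) 0; first by exists 2; rewrite ?mulr0// ltr1n.
  by exists (enorm z)^-1; rewrite ?mulVf// invf_gt1// lt_neqAle eq_sym z0 enorm_ge0.
apply/ler_addgt0Pr => e e0; rewrite add0r.
have n1 : normc (1 : C) < rho by rewrite normc1.
have [N /(_ N (leqnn N))] := hA z rho hrho 1 n1 e e0.
rewrite scale1r /psum big1 ?subr0// => k _.
by rewrite hQ Q0 meval0 mul0r.
Qed.

Variables (ms : Cd -> C) (T : multinom d -> C).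
Hypothesis Lms : forall P, L2 (fun z => ms z * meval (z ord0) P).
Hypothesis hB : forall g b c, Bil (fun z => ms z * mon g z) (fun z => c * mon b z) =
  if [forall i, (g i <= b i)%N]
  then complex.Re (T (mnm_sub b g) * conjc c) * mon_weight b else 0.
Hypothesis T_neq0 : exists g, T g != 0.

Lemma multiple_coef_bound : exists A B K : R, [/\ 0 <= A, 0 <= B, 0 <= K &
  forall P (Lam : R), 0 < Lam -> nrm (fun z => ms z * meval (z ord0) P) <= Lam ->
  forall n, normc (mcoeff (axis i0 n) P) <=
    K * Lam * expR (Num.sqrt (n + 4)%:R * (A + B * ln (Num.sqrt (n + 4)%:R)))].
Proof.
have d0 : (0 < d)%N by case: (posnP d) => // d0; have := ltn_ord i0; rewrite [X in (_ < X)%N]d0.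
have [al [al0 slice0 al_min]] := exists_leading_slice i0 T_neq0.
have [kap kap0 [N hN]] := @monomial_norm_ge R d i0 al.
pose b n := mnm_add al (axis i0 n).
have wpos n : 0 < @mon_weight R d (b n) by exact: mon_weight_gt0.
have wge n : kap / n.+1%:R ^+ N <= @mon_weight R d (b n).
  have := hN n; rewrite L2_sqnormE ?lee_fin; last exact: (L2_mon _).1.
  rewrite (_ : (fun i => if i == i0 then n else al i) = b n)//.
  apply/funext => i; rewrite mnmDE axisE; case: eqP => [->|]; first by rewrite al0.
  by rewrite addn0.
have sk0 : 0 < Num.sqrt kap by rewrite sqrtr_gt0.
have wV n : (Num.sqrt (@mon_weight R d (b n)))^-1 <= n.+1%:R ^+ N / Num.sqrt kap.
  set X : R := n.+1%:R ^+ N; have X1 : 1 <= X by rewrite exprn_ege1// ler1n.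
  have X0 : 0 < X by exact: lt_le_trans X1.
  rewrite ler_pdivlMr// mulrC ler_pdivrMr ?sqrtr_gt0//.
  rewrite -(@ler_pXn2r _ 2) ?nnegrE ?mulr_ge0 ?sqrtr_ge0 ?(ltW X0)//.
  rewrite exprMn !sqr_sqrtr ?(ltW (wpos n)) ?(ltW kap0)//.
  have := wge n; rewrite ler_pdivrMr// => h; rewrite (le_trans h)// mulrC ler_wpM2r ?(ltW (wpos n))//.
  by rewrite expr2 ler_peMl ?(ltW X0).
have Lmon : L2 (fun z => ms z * mon (@mnm0 d) z).
  by have := Lms (mpolyX C (@mnm0 d)); under eq_fun do rewrite mevalX.
pose C0 := nrm (fun z => ms z * mon (@mnm0 d) z) / Num.sqrt kap.
have C00 : 0 <= C0 by rewrite divr_ge0 ?nrm_ge0// ltW.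
have [|A [B [A0 B0 hAB]]] := @quotient_coef_bound R (slice i0 T al) N C0 C00 slice0.
  move=> n; have := @Bil_coef_bound R d _ (b n) (slice i0 T al n) Lmon (wpos n).
  move=> h; rewrite (le_trans (h _))//.
    move=> c; rewrite hB ifT; last by apply/forallP => i; rewrite mnm0E.
    by congr (complex.Re (T _ * _) * _); apply/mnmP => i; rewrite mnmBE mnm0E subn0.
  by rewrite /C0 mulrAC -mulrA ler_wpM2l ?nrm_ge0.
exists A, B, (Num.sqrt kap)^-1; split => //.
move=> P Lam Lam0 hP n; rewrite -(restrictionE i0 P n) [_^-1 * Lam]mulrC.
apply: hAB; first by rewrite divr_gt0.
move=> l; have := @Bil_coef_bound R d _ (b l) _ (Lms P) (wpos l) (Bil_slice Lms hB al0 al_min P l).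
move=> h; rewrite (le_trans h)// mulrAC -mulrA.
apply: (@le_trans _ _ (Lam / Num.sqrt (mon_weight (b l)))).
  by rewrite ler_wpM2r ?invr_ge0 ?sqrtr_ge0.
by rewrite ler_wpM2l ?(ltW Lam0).
Qed.

End coefficient_bound.

(*@@P6a@@*)
Lemma near_eq_differentiable {K : numFieldType} {V W : normedModType K} (f g : V -> W) (x : V) :
  (\forall y \near x, f y = g y) -> differentiable f x -> differentiable g x.
Proof.
move=> fg df.
have gE : g \o shift x = cst (g x) + 'd f x +o_ 0 id.
  apply/eqaddoP => e e0.
  have /eqaddoP/(_ e e0) := diff_locally df.
  have fgx : f x = g x by exact: nbhs_singleton fg.
  have : \forall h \near 0, f (h + x) = g (h + x).
    by move: fg; rewrite (near_shift 0)/= subr0.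
  apply: filterS2 => h fgh.
  by rewrite /= !fctE /= fgh fgx.
have dE : 'd g x = 'd f x :> (V -> W) by apply: diff_unique gE; exact: diff_continuous.
by apply/diff_locallyP; rewrite dE; split => //; exact: diff_continuous.
Qed.

Section power_series.
Context {R : realType}.
Local Notation C := R[i].
Implicit Types (a : nat -> C) (z w v : C).

Definition summable_by a (L : R) := forall D, \sum_(n < D) normc (a n) <= L.

Definition csum a w : C :=
  Complex (limn (fun n => complex.Re (psum a n w))) (limn (fun n => complex.Im (psum a n w))).

(** Weierstrass: uniform convergence on the closed disc. *)
Lemma csum_approx a L : summable_by a L -> forall e : R, 0 < e ->
  exists N, forall n w, (N <= n)%N -> normc w <= 1 -> normc (csum a w - psum a n w) <= e.
Proof.
move=> aL; pose sg n := \sum_(k < n) normc (a k).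
have sgS n : sg n.+1 = sg n + normc (a n) by rewrite /sg big_ord_recr.
have nd : nondecreasing_seq sg.
  by apply/nondecreasing_seqP => n; rewrite sgS lerDl normc_ge0.
have cs : cvgn sg by apply: nondecreasing_is_cvgn => //; exists L => _ [n _ <-]; exact: aL.
have diff n p w : normc w <= 1 -> normc (psum a (n + p) w - psum a n w) <= sg (n + p)%N - sg n.
  move=> w1; elim: p => [|p ih]; first by rewrite addn0 !subrr normc0.
  rewrite addnS sgS /psum big_ord_recr/= -/(psum a _ _) addrAC (le_trans (ler_normcD _ _))//.
  rewrite [leRHS]addrAC lerD// normcM ler_piMr ?normc_ge0// normcX.
  by rewrite exprn_ile1// normc_ge0.
have cRI w : normc w <= 1 ->
    (fun n => complex.Re (psum a n w)) @ \oo --> complex.Re (csum a w) /\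
    (fun n => complex.Im (psum a n w)) @ \oo --> complex.Im (csum a w).
  move=> w1.
  have cc (F : C -> R) : (forall x, `|F x| <= normc x) -> F 0 = 0 -> {morph F : x y / x + y} ->
      cvgn (fun n => F (psum a n w)).
    move=> F1 F0 FD.
    have -> : (fun n => F (psum a n w)) = series (fun k => F (a k * w ^+ k)).
      by apply/funext => n; rewrite seriesEnat /= big_mkord; apply: (big_morph F).
    apply: normed_cvg; apply: (@series_le_cvg _ _ (fun k => normc (a k))).
    - by move=> n; exact: normr_ge0.
    - by move=> n; exact: normc_ge0.
    - move=> n; rewrite (le_trans (F1 _))// normcM ler_piMr ?normc_ge0// normcX.
      by rewrite exprn_ile1// normc_ge0.
    - have -> : series (fun k => normc (a k)) = sg; last exact: cs.
      by apply/funext => n; rewrite seriesEnat /= big_mkord.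
  by split; apply: cc => //; [exact: ler_Re_normc|exact: ReD|exact: ler_Im_normc|exact: ImD].
have tail n w : normc w <= 1 -> normc (csum a w - psum a n w) <= limn sg - sg n.
  move=> w1; have [cR cI] := cRI w w1; apply/ler_addgt0Pr => e e0.
  have e2 : 0 < e / 2 by rewrite divr_gt0.
  have /cvgrPdist_le/(_ _ e2)[N1 _ h1] := cR; have /cvgrPdist_le/(_ _ e2)[N2 _ h2] := cI.
  pose p := maxn N1 N2.
  have := h1 (n + p)%N; have := h2 (n + p)%N => /=.
  rewrite (leq_trans (leq_maxl N1 N2)) ?leq_addl// (leq_trans (leq_maxr N1 N2)) ?leq_addl//.
  move=> /(_ isT) I /(_ isT) RR.
  have le1 : normc (csum a w - psum a (n + p) w) <= e.
    by rewrite (le_trans (ler_normc_ReIm _))// ReB ImB [leRHS]splitr lerD.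
  have := diff n p w w1; have := nondecreasing_cvgn_le nd cs (n + p)%N => l1 l2.
  have := ler_normcD (csum a w - psum a (n + p) w) (psum a (n + p) w - psum a n w).
  by rewrite addrA subrK; lra.
move=> e e0; have /cvgrPdist_le/(_ e e0)[N _ hN] := cs.
exists N => n w Nn w1; rewrite (le_trans (tail n w w1))//.
by rewrite (le_trans (ler_norm _))//; exact: hN.
Qed.

Lemma normc_csum_le a L w : summable_by a L -> normc w <= 1 -> normc (csum a w) <= L.
Proof.
move=> aL w1; apply/ler_addgt0Pr => e e0.
have [N /(_ N w (leqnn N) w1) hN] := csum_approx aL e0.
rewrite -(subrK (psum a N w) (csum a w)) (le_trans (ler_normcD _ _))// addrC lerD//.
rewrite (le_trans _ (aL N))// /psum (le_trans (ler_normc_sum _ _ _))//; apply: ler_sum => k _.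
by rewrite normcM ler_piMr ?normc_ge0// normcX exprn_ile1// normc_ge0.
Qed.

Lemma csum_unique a L w (l : C) : summable_by a L -> normc w <= 1 ->
  (forall e : R, 0 < e -> exists N, forall n, (N <= n)%N -> normc (l - psum a n w) <= e) ->
  l = csum a w.
Proof.
move=> aL w1 hl; apply/eqP; rewrite -subr_eq0 -normc_eq0 -normr_le0 ger0_norm ?normc_ge0//.
apply/ler_addgt0Pr => e e0; rewrite add0r; have e2 : 0 < e / 2 by rewrite divr_gt0.
have [N hN] := hl _ e2; have [N' hN'] := csum_approx aL e2.
have h1 := hN (maxn N N') (leq_maxl _ _); have h2 := hN' (maxn N N') w (leq_maxr _ _) w1.
have := ler_normcB (l - psum a (maxn N N') w) (csum a w - psum a (maxn N N') w).
rewrite opprB addrA subrK; lra.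
Qed.

Lemma power_taylor2 n w v : normc w <= 1 -> normc v <= 1 ->
  normc (w ^+ n - v ^+ n - n%:R * v ^+ n.-1 * (w - v)) <= n%:R ^+ 2 * normc (w - v) ^+ 2.
Proof.
move=> w1 v1; set dl := normc (w - v); have dl0 : 0 <= dl by exact: normc_ge0.
elim: n => [|n ih]; first by rewrite !expr0 subrr mul0r mul0r subr0 normc0 expr0n mul0r.
have -> : w ^+ n.+1 - v ^+ n.+1 - n.+1%:R * v ^+ n * (w - v) =
  w * (w ^+ n - v ^+ n - n%:R * v ^+ n.-1 * (w - v)) + n%:R * v ^+ n.-1 * ((w - v) * (w - v)).
  case: n {ih} => [|n] /=; first by rewrite !expr0 !expr1; ring.
  by rewrite !exprS -(natr1 n.+1) -(natr1 n); move: (w ^+ n) (v ^+ n) => x y; ring.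
rewrite (le_trans (ler_normcD _ _))// !normcM normc_nat -/dl.
have h1 : normc w * normc (w ^+ n - v ^+ n - n%:R * v ^+ n.-1 * (w - v)) <= n%:R ^+ 2 * dl ^+ 2.
  by rewrite (le_trans _ ih)// ler_piMl ?normc_ge0.
have h2 : n%:R * normc (v ^+ n.-1) * (dl * dl) <= n%:R * dl ^+ 2.
  by rewrite -expr2 ler_wpM2r ?sqr_ge0// ler_piMr// normcX exprn_ile1// normc_ge0.
rewrite (le_trans (lerD h1 h2))// -mulrDl ler_wpM2r ?sqr_ge0// -natr1.
by rewrite sqrrD expr1n mulr1; have := ler0n R n; lra.
Qed.

(** Second order Taylor estimate, uniform on the closed disc. *)
Lemma csum_taylor2 a L L1 L2 w v : summable_by a L ->
  summable_by (fun n => n.+1%:R * a n.+1) L1 -> summable_by (fun n => n%:R ^+ 2 * a n) L2 ->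
  normc w <= 1 -> normc v <= 1 ->
  normc (csum a w - csum a v - csum (fun n => n.+1%:R * a n.+1) v * (w - v)) <=
    L2 * normc (w - v) ^+ 2.
Proof.
move=> aL aL1 aL2 w1 v1; set a' := fun n => _.
have dl2 : normc (w - v) <= 2.
  by rewrite (le_trans (ler_normcB _ _))// (le_trans (lerD w1 v1))// -natrD.
apply/ler_addgt0Pr => e e0; have e4 : 0 < e / 4 by rewrite divr_gt0.
have [N hN] := csum_approx aL e4; have [N' hN'] := csum_approx aL1 e4.
pose n := maxn N N'.
have hw := hN n.+1 w (leq_trans (leq_maxl _ _) (leqnSn _)) w1.
have hv := hN n.+1 v (leq_trans (leq_maxl _ _) (leqnSn _)) v1.
have hv' := hN' n v (leq_maxr _ _) v1.
have main : normc (psum a n.+1 w - psum a n.+1 v - psum a' n v * (w - v)) <= L2 * normc (w - v) ^+ 2.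
  have -> : psum a n.+1 w - psum a n.+1 v - psum a' n v * (w - v) =
      \sum_(k < n.+1) a k * (w ^+ k - v ^+ k - k%:R * v ^+ k.-1 * (w - v)).
    have -> : psum a' n v = \sum_(k < n.+1) a k * (k%:R * v ^+ k.-1).
      rewrite big_ord_recl/= mul0r mulr0 add0r; apply: eq_bigr => k _.
      by rewrite /a' mulrAC mulrC.
    rewrite /psum mulr_suml -!sumrB; apply: eq_bigr => k _.
    by rewrite !mulrBr !mulrA.
  rewrite (le_trans (ler_normc_sum _ _ _))// (le_trans _ (ler_wpM2r (sqr_ge0 _) (aL2 n.+1)))//.
  rewrite mulr_suml; apply: ler_sum => k _; rewrite !normcM -expr2 normc_nat.
  by rewrite [leRHS]mulrAC [leRHS]mulrC ler_wpM2l ?normc_ge0// power_taylor2.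
set X := _ - _ - _.
have -> : X = (csum a w - psum a n.+1 w) - (csum a v - psum a n.+1 v) -
   (csum a' v - psum a' n v) * (w - v) + (psum a n.+1 w - psum a n.+1 v - psum a' n v * (w - v)).
  by rewrite /X; ring.
rewrite (le_trans (ler_normcD _ _))// addrC lerD//.
rewrite (le_trans (ler_normcB _ _))// (le_trans (lerD (ler_normcB _ _) (lexx _)))//.
have : normc ((csum a' v - psum a' n v) * (w - v)) <= e / 4 * 2.
  by rewrite normcM ler_pM ?normc_ge0.
move: hw hv; lra.
Qed.

End power_series.

(*@@P6b@@*)
Lemma decay_summable {R : realType} (a : nat -> R[i]) (eps c : R) : 0 < eps -> 0 < c ->
  (fun n => normc (a n)) =O_\oo (fun n => expR (- c * n%:R `^ (2^-1 + eps))) ->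
  exists L : R, [/\ summable_by a L, summable_by (fun n => n.+1%:R * a n.+1) L &
    summable_by (fun n => n%:R ^+ 2 * a n) L].
Proof.
move=> e0 c0 /(@sum_decay_bounded _ a eps c 4 0 e0 c0) [//|//|M M0 hM].
have ge n : (n%:R ^+ 2 : R) <= expR (Num.sqrt (n + 4)%:R * (4 + 0 * ln (Num.sqrt (n + 4)%:R))).
  set s := Num.sqrt _; have s0 : 0 <= s by exact: sqrtr_ge0.
  rewrite mul0r addr0 mulrC expRM_natl; apply: (@le_trans _ _ (s ^+ 4)); last first.
    by rewrite lerXn2r ?nnegrE ?expR_ge0// (le_trans _ (expR_ge1Dx s))// lerDr.
  rewrite (_ : 4 = 2 * 2)%N// exprM sqr_sqrtr// lerXn2r ?nnegrE// ler_nat leq_addr//.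
have ge1 n : 1 <= expR (Num.sqrt (n + 4)%:R * (4 + 0 * ln (Num.sqrt (n + 4)%:R))) :> R.
  by rewrite -expR0 ler_expR mul0r addr0 mulr_ge0 ?sqrtr_ge0.
exists M; split=> D.
- by rewrite (le_trans _ (hM D))//; apply: ler_sum => n _; rewrite ler_peMr ?normc_ge0.
- rewrite (le_trans _ (hM D.+1))// big_ord_recl/= -[leLHS]add0r lerD//.
    by rewrite mulr_ge0 ?normc_ge0 ?expR_ge0.
  apply: ler_sum => n _; rewrite normcM normc_nat mulrC ler_wpM2l ?normc_ge0//.
  rewrite (le_trans _ (ge n.+1))// expr2 ler_peMl// ler1n//.
- rewrite (le_trans _ (hM D))//; apply: ler_sum => n _.
  by rewrite normcM mulrC ler_wpM2l ?normc_ge0// -natrX normc_nat natrX.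
Qed.

Section slice_function.
Context {R : realType} {d : nat}.
Local Notation C := R[i].
Local Notation Cd := 'rV[R[i]]_d.
Local Notation S := (@unit_sphere R d).
Variable i0 : 'I_d.
Variables (a : nat -> C) (L : R).
Hypotheses (aL : summable_by a L) (aL1 : summable_by (fun n => n.+1%:R * a n.+1) L)
  (aL2 : summable_by (fun n => n%:R ^+ 2 * a n) L).
Let D w := csum (fun n => n.+1%:R * a n.+1) w.

Lemma differentiable_csum (w : C) : normc w < 1 -> differentiable (csum a) w.
Proof.
move=> w1; apply/derivable1_diffP/cvg_ex; exists (D w).
apply/cvgrPdist_le => e e0.
have eE : e = (complex.Re e)%:C%C by rewrite RRe_real// gtr0_real.
set x := complex.Re e in eE; have x0 : 0 < x by rewrite -ltcR -eE.
have L0 : 0 <= L by have := aL 0%N; rewrite big_ord0.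
pose dl := Num.min (1 - normc w) (x / (L + 1)).
have dl0 : 0 < dl by rewrite lt_min subr_gt0 w1 divr_gt0// ltr_wpDl.
exists dl%:C%C; first by rewrite /= ltcR.
move=> h /=; rewrite sub0r normrN normc_norm ltcR => hdl h0.
have [d1 d2] : dl <= 1 - normc w /\ dl <= x / (L + 1) by rewrite !ge_min !lexx orbT.
have hw : normc (h + w) <= 1 by rewrite (le_trans (ler_normcD _ _))//; lra.
have := csum_taylor2 aL aL1 aL2 hw (ltW w1); rewrite addrK -/(D w) => T.
rewrite [h *: 1]mulr1 normc_norm eE lecR.
set X := csum a _ - csum a _ in T *; rewrite (_ : D w - _ = - (h^-1 * (X - D w * h))); last first.
  by rewrite [h^-1 *: _]/(h^-1 * _) mulrBr [D w * h]mulrC mulKf// opprB.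
rewrite normcN normcM normcV mulrC ler_pdivrMr ?normc_gt0// (le_trans T)//.
rewrite expr2 mulrA ler_wpM2r ?normc_ge0//.
move: (le_trans (ltW hdl) d2); rewrite ler_pdivlMr ?ltr_wpDl// => h1.
have := normc_ge0 h; move: h1; move: (normc h) => y; lra.
Qed.

Definition slice_fun (z : Cd) : C := csum a (z ord0 i0).

Lemma slice_fun_eq (f : Cd -> C) :
  (forall z : Cd, unit_ball z -> series (fun n => a n * z ord0 i0 ^+ n) @ \oo --> f z) ->
  forall z, unit_ball z -> f z = slice_fun z.
Proof.
move=> hf z zB; have z1 : normc (z ord0 i0) <= 1.
  by rewrite (le_trans (normc_coord_le z i0))// ltW.
apply: (csum_unique aL z1) => e e0.
have e0' : 0 < e%:C%C :> C by rewrite ltcR.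
have /cvgrPdist_le/(_ _ e0')[N _ hN] := hf z zB.
exists N => n /hN /=; rewrite normc_norm lecR.
by rewrite seriesEnat /= big_mkord.
Qed.

Lemma unit_ball_nbhs (z : Cd) : unit_ball z -> \forall y \near z, unit_ball y.
Proof.
move=> zB; have e0 := enorm_ge0 z.
have z1 : enorm z ^+ 2 < 1 by rewrite expr_lt1.
pose dl := (1 - enorm z ^+ 2) / (3 * d%:R + 1).
have d0 : 0 <= d%:R :> R by [].
have dl0 : 0 < dl by rewrite divr_gt0 ?subr_gt0//; lra.
have dle : dl * (3 * d%:R + 1) = 1 - enorm z ^+ 2 by rewrite divfK// gt_eqF//; lra.
have dl1 : dl <= 1 by have := sqr_ge0 (enorm z); nra.
apply/nbhs_ballP; exists dl%:C%C; first by rewrite /= ltcR.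
move=> y zy; rewrite /unit_ball/= -(@expr_lt1 _ 2)// ?enorm_ge0//.
apply: (@le_lt_trans _ _ (enorm z ^+ 2 + 3 * d%:R * dl)); last by move: dle dl0; nra.
rewrite !sqr_enorm (_ : 3 * d%:R * dl = \sum_(i < d) 3 * dl); last first.
  by rewrite sumr_const card_ord -mulr_natr; ring.
rewrite -big_split/=; apply: ler_sum => i _.
have zi : normc (z ord0 i) <= 1 by rewrite (le_trans (normc_coord_le z i))// ltW.
have /ltW : normc (y ord0 i - z ord0 i) < dl.
  by rewrite normc_distC -ltcR -normc_norm; exact: (zy.2 ord0 i).
have := ler_normcD (y ord0 i - z ord0 i) (z ord0 i); rewrite subrK.
have := normc_ge0 (y ord0 i); have := normc_ge0 (z ord0 i).
move: zi (ltW dl0) dl1; move: (normc (y ord0 i)) (normc (z ord0 i)) (normc (y ord0 i - z ord0 i)) => p q r.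
move=> q1 dl00 dl1' q0 p0 pr rd.
have pq : p <= q + dl by lra.
apply: (@le_trans _ _ ((q + dl) ^+ 2)); first by rewrite lerXn2r ?nnegrE// addr_ge0.
nra.
Qed.

Lemma holomorphic_slice_fun (f : Cd -> C) : (forall z, unit_ball z -> f z = slice_fun z) ->
  holomorphic_on_ball f.
Proof.
move=> fE z zB.
have z1 : normc (z ord0 i0) < 1 by rewrite (le_lt_trans (normc_coord_le z i0)).
apply: (@near_eq_differentiable _ _ _ slice_fun).
  by apply: filterS (unit_ball_nbhs zB) => y /fE ->.
apply: (@differentiable_comp _ _ _ _ (fun w : Cd => w ord0 i0) (csum a)).
  exact: differentiable_coord.
exact: differentiable_csum.
Qed.

Lemma mon_axis n (z : Cd) : mon (axis i0 n) z = z ord0 i0 ^+ n.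
Proof.
rewrite /mon (bigD1 i0)//= axisE eqxx big1 ?mulr1// => i /negbTE ii0.
by rewrite axisE ii0.
Qed.

Let pol n : mpoly d C := \sum_(k < n) a k *: mpolyX C (axis i0 k).

Let polE n (z : Cd) : meval (z ord0) (pol n) = psum a n (z ord0 i0).
Proof.
rewrite /pol raddf_sum/=; apply: eq_bigr => k _.
by rewrite mevalZ mevalX -mon_axis.
Qed.

Let coord1 (z : Cd) : S z -> normc (z ord0 i0) <= 1.
Proof. by move=> Sz; rewrite -(Sz : enorm z = 1) normc_coord_le. Qed.

Lemma L2_slice_fun : L2 slice_fun.
Proof.
have L0 : 0 <= L by have := aL 0%N; rewrite big_ord0.
apply: (proj1 (L2_bounded L0 _ _)) => [|z Sz].
  apply: (@measurable_complex_cvg _ _ _ _ (fun n (z : Cd) => meval (z ord0) (pol n))).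
    by move=> n; exact: (L2_meval (pol n)).1.
  move=> z Sz e e0; have [N hN] := csum_approx aL e0.
  by exists N => n Nn; rewrite polE; apply: hN => //; exact: coord1.
by apply: (normc_csum_le aL); exact: coord1.
Qed.

Lemma nrm_slice_fun_approx (e : R) : 0 < e -> exists N, forall n, (N <= n)%N ->
  nrm (fun z => slice_fun z - meval (z ord0) (pol n)) <= e.
Proof.
move=> e0; have [N hN] := csum_approx aL e0; exists N => n Nn.
apply: (proj2 (L2_bounded (ltW e0) _ _)) => [|z Sz].
  by apply: (proj1 (L2B L2_slice_fun _)); exact: L2_meval.
by rewrite polE; apply: hN => //; exact: coord1.
Qed.

Lemma H2_slice_fun : H2 slice_fun.
Proof.
apply/H2_nrmP; split; first exact: L2_slice_fun.
by move=> e /nrm_slice_fun_approx[N /(_ N (leqnn N)) h]; exists (pol N).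
Qed.

Lemma csum_lipschitz w v : normc w <= 1 -> normc v <= 1 ->
  normc (csum a w - csum a v) <= 3 * L * normc (w - v).
Proof.
move=> w1 v1; have T := csum_taylor2 aL aL1 aL2 w1 v1.
have hD : normc (D v * (w - v)) <= L * normc (w - v).
  by rewrite normcM ler_wpM2r ?normc_ge0// (normc_csum_le aL1).
have L0 : 0 <= L by have := aL 0%N; rewrite big_ord0.
have dl2 : normc (w - v) <= 2.
  by rewrite (le_trans (ler_normcB _ _))// (le_trans (lerD w1 v1))// -natrD.
have := ler_normcD (csum a w - csum a v - D v * (w - v)) (D v * (w - v)).
rewrite subrK => h; rewrite (le_trans h)// (le_trans (lerD T hD))//.
have h2 : L * normc (w - v) ^+ 2 <= L * (2 * normc (w - v)).
  by rewrite ler_wpM2l// expr2 ler_wpM2r// normc_ge0.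
by move: h2; move: (normc (w - v)) => y; lra.
Qed.

Lemma H2_holomorphic_slice_fun (f : Cd -> C) : (forall z, unit_ball z -> f z = slice_fun z) ->
  H2_holomorphic f slice_fun.
Proof.
move=> fE; split; [exact: holomorphic_slice_fun|exact: H2_slice_fun|].
have L0 : 0 <= L by have := aL 0%N; rewrite big_ord0.
have bnd r : 0 <= r < 1 ->
    (L2_sqnorm (fun z => f (r%:C%C *: z) - slice_fun z)%R <= ((3 * L * (1 - r)) ^+ 2)%:E)%E.
  move=> r01; have /andP[r0 r1] := r01.
  have nr : normc (r%:C%C : C) = r by rewrite normc_real ger0_norm.
  have rz z : S z -> normc (r%:C%C * z ord0 i0) <= 1.
    by move=> Sz; rewrite normcM nr mulr_ile1 ?normc_ge0 ?(ltW r1) ?coord1.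
  have fr z : S z -> f (r%:C%C *: z) = csum a (r%:C%C * z ord0 i0).
    by move=> Sz; rewrite fE ?/slice_fun ?mxE//; exact: unit_ball_dilate.
  have K0 : 0 <= 3 * L * (1 - r) by rewrite !mulr_ge0// subr_ge0 ltW.
  pose g (z : Cd) := csum a (r%:C%C * z ord0 i0) - slice_fun z.
  have mg : measurable_fun S g.
    apply: measurable_complexB; last exact: L2_slice_fun.1.
    apply: (@measurable_complex_cvg _ _ _ _ (fun n (z : Cd) => \sum_(k < n) (a k * r%:C%C ^+ k) * mon (axis i0 k) z)).
      move=> n; apply: measurable_complex_sum => k; apply: measurable_complexM => //.
      exact: measurable_mon.
    move=> z Sz e e0; have [N hN] := csum_approx aL e0; exists N => n Nn.
    have := hN n _ Nn (rz z Sz); congr (normc (_ - _) <= _); apply: eq_bigr => k _.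
    by rewrite exprMn mon_axis mulrA.
  have gb z : S z -> normc (g z) <= 3 * L * (1 - r).
    move=> Sz; rewrite (le_trans (csum_lipschitz (rz z Sz) (coord1 Sz)))//.
    rewrite ler_wpM2l ?mulr_ge0// -{2}[z ord0 i0]mul1r -mulrBl normcM.
    rewrite -(rmorph1 (@real_complex R)) -rmorphB normc_real ler0_norm ?subr_le0 ?(ltW r1)//.
    by rewrite opprB ler_piMr ?subr_ge0 ?(ltW r1)// coord1.
  have [Lg hg] := L2_bounded K0 mg gb.
  rewrite (_ : L2_sqnorm _ = L2_sqnorm g); last first.
    by apply: eq_integral => z; rewrite inE => Sz; rewrite fr.
  by rewrite L2_sqnormE// lee_fin -sqr_nrm lerXn2r ?nnegrE ?nrm_ge0.
apply: (@squeeze_cvge _ _ _ _ (cst 0%E) _ (fun r => ((3 * L * (1 - r)) ^+ 2)%:E)).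
- near=> r; rewrite bnd ?andbT; last by apply/andP; split; near: r;
    [exact: nbhs_left_ge|exact: nbhs_left_lt].
  by apply: integral_ge0 => z _; rewrite lee_fin sqr_ge0.
- exact: cvg_cst.
- apply: cvg_EFin; first by apply: nearW.
  apply: cvg_at_left_filter.
  have -> : (0 : R) = (3 * L * (1 - 1)) ^+ 2 by rewrite subrr mulr0 expr0n.
  apply: (cvg_comp _ (fun y => y ^+ 2)); last exact: exprn_continuous.
  apply: cvgM; first exact: cvg_cst.
  by apply: cvgB; [exact: cvg_cst|exact: cvg_id].
Unshelve. all: by end_near. Qed.

(** The pairing with [slice_fun] only sees the coefficients of [P] on the axis. *)
Lemma Bil_meval_slice_fun_le P (B : R) :
  (forall n, \sum_(k < n) normc (mcoeff (axis i0 k) P) * normc (a k) <= B) ->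
  `|Bil (fun z => meval (z ord0) P) slice_fun| <= B.
Proof.
move=> hB; have LP := L2_meval P; have n0 := nrm_ge0 (fun z : Cd => meval (z ord0) P).
apply/ler_addgt0Pr => e e0.
have e'0 : 0 < e / (nrm (fun z : Cd => meval (z ord0) P) + 1) by rewrite divr_gt0// ltr_wpDl.
have [n /(_ n (leqnn n)) hn] := nrm_slice_fun_approx e'0.
have Lp := L2_meval (pol n); have Lh := L2_slice_fun.
rewrite -(subrK (Bil (fun z => meval (z ord0) P) (fun z => meval (z ord0) (pol n))) (Bil _ slice_fun)).
rewrite (le_trans (ler_normD _ _))// addrC lerD//.
  have -> : Bil (fun z => meval (z ord0) P) (fun z => meval (z ord0) (pol n)) =
     \sum_(k < n) complex.Re (mcoeff (axis i0 k) P * conjc (a k)) * mon_weight (axis i0 k).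
    rewrite BilC.
    transitivity (\sum_(k < n) Bil (fun z => a k * mon (axis i0 k) z) (fun z => meval (z ord0) P)).
      rewrite -Bil_suml//; last by move=> k; apply: L2Z; exact: (L2_mon _).1.
      apply: eq_Rintegral => z _; congr (complex.Re (_ * _)); rewrite polE.
      by apply: eq_bigr => k _; rewrite mon_axis.
    apply: eq_bigr => k _; rewrite BilC.
    have := Bil_meval_mon P (@mnm0 d) (axis i0 k) (a k).
    rewrite ifT; last by apply/forallP => i; rewrite mnm0E.
    rewrite (_ : mnm_sub _ _ = axis i0 k); last by apply/mnmP => i; rewrite mnmBE mnm0E subn0.
    move=> <-; apply: eq_Rintegral => z _; congr (complex.Re (_ * _)).
    by rewrite /mon [X in _ * X]big1 ?mulr1// => i _; rewrite mnm0E.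
  rewrite (le_trans _ (hB n))// (le_trans (ler_norm_sum _ _ _))//; apply: ler_sum => k _.
  have w0 := Bil_ge0 (@mon R d (axis i0 k)).
  rewrite normrM (ger0_norm w0) (@le_trans _ _ `|complex.Re (mcoeff (axis i0 k) P * conjc (a k))|)//.
    rewrite ler_piMr// /mon_weight -sqr_nrm exprn_ile1 ?nrm_ge0//.
    exact: (L2_mon _).2.
  by rewrite (le_trans (ler_Re_normc _))// normcM normcJ.
rewrite -BilBr// (le_trans (Bil_cauchy_schwarz LP (L2B Lh Lp)))//.
rewrite (le_trans (ler_wpM2l n0 hn))// mulrA ler_pdivrMr ?ltr_wpDl// mulrC.
by rewrite ler_wpM2l ?(ltW e0)// lerDl.
Qed.

End slice_function.

(*@@P7a@@*)
Lemma geometric_le0 {R : realType} (x K : R) : (forall k, x <= K * (4^-1) ^+ k) -> x <= 0.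
Proof.
move=> h; have c0 : (4^-1 : R) ^+ k @[k --> \oo] --> 0.
  by apply: cvg_expr; rewrite ger0_norm ?invf_lt1 ?ltr1n.
have c1 : K * (4^-1) ^+ k @[k --> \oo] --> K * 0 by apply: cvgM => //; exact: cvg_cst.
rewrite mulr0 in c1; apply: (ler_cvg_to (@cvg_cst _ x _ _ _) c1).
by apply: nearW.
Qed.

Section minimisation.
Context {R : realType} {d : nat}.
Local Notation C := R[i].
Local Notation Cd := 'rV[R[i]]_d.
Local Notation sigma := (@sphere_measure R d).
Local Notation S := (@unit_sphere R d).
Implicit Types (u v w g : Cd -> C) (P : mpoly d C).

Let mS : measurable S. Proof. exact: measurable_unit_sphere. Qed.

Lemma H2_nrm_closed g : L2 g -> (forall e : R, 0 < e -> exists2 u, H2 u & nrm (fun z => g z - u z) <= e) -> H2 g.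
Proof.
move=> Lg H; apply/H2_nrmP; split => // e e0; have e2 : 0 < e / 2 by rewrite divr_gt0.
have [u /H2_nrmP[Lu hu] gu] := H _ e2; have [P hP] := hu _ e2; exists P.
have := nrmD (L2B Lg Lu) (L2B Lu (L2_meval P)).
under [X in nrm X <= _]eq_fun do rewrite addrA subrK.
by move=> h; rewrite (le_trans h)// [leRHS]splitr lerD.
Qed.

Variables (ms h : Cd -> C) (M K : R).
Hypothesis M0 : 0 <= M.
Hypothesis msM : forall z, S z -> normc (ms z) <= M.
Hypothesis H2ms : H2 ms.
Hypothesis Lh : L2 h.
Hypothesis K0 : 0 <= K.
Local Notation U P := (fun z => ms z * meval (z ord0) P).
Hypothesis hK : forall P, `|Bil (fun z => meval (z ord0) P) h| <= K * nrm (U P).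

Let mms : measurable_fun S ms. Proof. exact: H2ms.1.1. Qed.

Let LU P : L2 (U P). Proof. exact: (L2_bounded_mul mms msM (L2_meval P)).1. Qed.

Let H2U P : H2 (U P).
Proof. by have := H2_meval_mul P H2ms; under eq_fun do rewrite mulrC. Qed.

Let J P := Bil (U P) (U P) - 2 * Bil (fun z => meval (z ord0) P) h.

Let JD P Q (t : R) : J (P + t%:C%C *: Q) = J P + 2 * t * (Bil (U P) (U Q) - Bil (fun z => meval (z ord0) Q) h)
   + t ^+ 2 * Bil (U Q) (U Q).
Proof.
have UE : U (P + t%:C%C *: Q) = (fun z => ms z * meval (z ord0) P + t%:C%C * (ms z * meval (z ord0) Q)).
  by apply/funext => z; rewrite mevalD mevalZ mulrDr mulrCA.
have PE : (fun z : Cd => meval (z ord0) (P + t%:C%C *: Q)) =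
    (fun z => meval (z ord0) P + t%:C%C * meval (z ord0) Q).
  by apply/funext => z; rewrite mevalD mevalZ.
rewrite /J UE PE Bil_quadratic//; have LP := L2_meval P; have LQ := L2_meval Q.
rewrite (BilDl LP (L2Z t%:C%C LQ) Lh) (BilZl t LQ Lh).
move: (Bil (U P) (U P)) (Bil (U P) (U Q)) (Bil (U Q) (U Q)) => x y z.
by move: (Bil _ h) (Bil (fun z => meval (z ord0) Q) h) => x' y'; ring.
Qed.

(** The functional [J] is bounded below, its minimising sequences are Cauchy for
    the norm of [U P] by the parallelogram law, and the limit satisfies the
    Euler equation. *)
Lemma exists_adjoint_preimage_meval : exists2 g, H2 g &
  forall P, Bil (U P) g = Bil (fun z => meval (z ord0) P) h.
Proof.
have Jlb P : - K ^+ 2 <= J P.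
  rewrite /J -sqr_nrm; have := le_trans (ler_norm _) (hK P).
  by have := sqr_ge0 (nrm (U P) - K); move: (nrm _) (Bil _ _) => x y; nra.
have [I [Ilb hI]] : exists I, (forall P, I <= J P) /\ forall e : R, 0 < e -> exists P, J P < I + e.
  have hs : has_inf (range J).
    by split; [exists (J 0), 0|exists (- K ^+ 2) => _ [P _ <-]; exact: Jlb].
  exists (inf (range J)); split => [P|e e0].
    by apply: ge_inf; [exact: hs.2|exists P].
  by have [_ [P _ <-] hP] := inf_adherent e0 hs; exists P.
pose ee k : R := (8^-1) ^+ k / 4.
have ee0 k : 0 < ee k by rewrite divr_gt0// exprn_gt0.
have /choice[p hp] : forall k, exists P, J P < I + ee k by move=> k; exact: hI.
pose u k := U (p k).
have midE P Q : Bil (fun z => ms z * meval (z ord0) P - ms z * meval (z ord0) Q)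
     (fun z => ms z * meval (z ord0) P - ms z * meval (z ord0) Q) =
     2 * J P + 2 * J Q - 4 * J (P + (2^-1)%:C%C *: (Q - P)).
  pose X := (P + (2^-1)%:C%C *: (Q - P)).
  have J1 := JD X (P - Q) 2^-1; have J2 := JD X (P - Q) (- 2^-1).
  have c2 : (2^-1 : R)%:C%C + (2^-1)%:C%C = 1 :> C.
    by rewrite -rmorphD/= -[X in X%:C%C](_ : 1 = _) ?rmorph1//; field.
  have P1 : X + (2^-1)%:C%C *: (P - Q) = P.
    by rewrite /X -addrA -scalerDr addrA subrK subrr scaler0 addr0.
  have P2 : X + (- 2^-1)%:C%C *: (P - Q) = Q.
    rewrite /X rmorphN scaleNr -scalerN opprB -addrA -scalerDl c2 scale1r.
    by rewrite addrC subrK.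
  rewrite P1 in J1; rewrite P2 in J2; rewrite -/X J1 J2.
  have -> : (fun z => ms z * meval (z ord0) P - ms z * meval (z ord0) Q) = U (P - Q).
    by apply/funext => z; rewrite mevalB mulrBr.
  by move: (J X) (Bil (U X) _) (Bil (U _) (U _)) (Bil _ h) => x y z t; field.
have ucauchy k : Bil (fun z => u k.+1 z - u k z) (fun z => u k.+1 z - u k z) <= (8^-1) ^+ k.
  rewrite /u midE.
  have := Ilb (p k.+1 + (2^-1)%:C%C *: (p k - p k.+1)).
  have := hp k; have := hp k.+1; rewrite /ee exprS.
  have : 0 < (8^-1 : R) ^+ k by rewrite exprn_gt0.
  move: (J _) (J _) (J _) (_ ^+ k) => x y z t; lra.
have [g Lg hg] := L2_complete (fun k => LU (p k)) ucauchy.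
have H2g : H2 g.
  apply: H2_nrm_closed => // e e0.
  have [k hk] : exists k, 32 * (4^-1 : R) ^+ k <= e ^+ 2.
    apply: contrapT => nk; have : e ^+ 2 <= 0.
      apply: (@geometric_le0 _ _ 32) => k; rewrite leNgt; apply/negP => hlt.
      by apply: nk; exists k; exact: ltW.
    by rewrite leNgt exprn_gt0.
  exists (u k); first exact: H2U.
  by rewrite -(@ler_pXn2r _ 2) ?nnegrE ?nrm_ge0 ?(ltW e0)// (le_trans (hg k)).
exists g => // P.
set B := Bil (U P) (U P); have B0 : 0 <= B by exact: Bil_ge0.
apply/eqP; rewrite -subr_eq0 -sqrf_eq0 eq_le sqr_ge0 andbT.
apply: (@geometric_le0 _ _ (100 * (B + 1))) => k.
pose dk := Bil (u k) (U P) - Bil (fun z => meval (z ord0) P) h.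
have var t : - ee k <= 2 * t * dk + t ^+ 2 * B.
  have := Ilb (p k + t%:C%C *: P); rewrite JD -/dk -/B; have := hp k; lra.
have dk2 : dk ^+ 2 <= ee k * (B + 1).
  have B1 : 0 < B + 1 by lra.
  have := var (- dk / (B + 1)).
  have -> : 2 * (- dk / (B + 1)) * dk + (- dk / (B + 1)) ^+ 2 * B =
     - (dk ^+ 2 / (B + 1)) - dk ^+ 2 / (B + 1) ^+ 2 by field; rewrite gt_eqF.
  have : 0 <= dk ^+ 2 / (B + 1) ^+ 2 by rewrite divr_ge0 ?sqr_ge0.
  move=> h1 h2; rewrite -ler_pdivrMr//; lra.
have gk : (Bil (U P) g - Bil (u k) (U P)) ^+ 2 <= 32 * (4^-1) ^+ k * B.
  rewrite (BilC (u k)) -BilBr//; last exact: LU.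
  rewrite -[_ ^+ 2]real_normK ?num_real//.
  have := Bil_cauchy_schwarz (LU P) (L2B Lg (LU (p k))) => cs.
  apply: (@le_trans _ _ ((nrm (U P) * nrm (fun z => g z - u k z)) ^+ 2)).
    by rewrite lerXn2r ?nnegrE ?mulr_ge0 ?nrm_ge0.
  by rewrite exprMn sqr_nrm -/B [leLHS]mulrC ler_wpM2r// hg.
have e84 : ee k <= (4^-1) ^+ k.
  rewrite /ee (@le_trans _ _ ((8^-1 : R) ^+ k))//.
    by rewrite ler_pdivrMr// ler_peMr ?exprn_ge0// ler1n.
  by rewrite lerXn2r ?nnegrE// lef_pV2 ?posrE// ler_nat.
have -> : Bil (U P) g - Bil (fun z => meval (z ord0) P) h = (Bil (U P) g - Bil (u k) (U P)) + dk.
  by rewrite /dk; ring.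
have t0 : 0 <= (4^-1 : R) ^+ k by rewrite exprn_ge0.
have e84' : ee k * (B + 1) <= (4^-1) ^+ k * (B + 1) by rewrite ler_wpM2r// addr_ge0.
have := le_trans dk2 e84'; have := mulr_ge0 t0 B0; clear var dk2 e84 e84'; move: gk t0 B0.
clearbody dk; move: (_ - Bil (u k) _) ((4^-1) ^+ k) B => x t b xb t0 b0 tb0 yb.
have := sqr_ge0 (x - dk); nra.
Qed.

Lemma exists_adjoint_preimage : exists2 g, H2 g &
  forall v, H2 v -> Bil (fun z => ms z * v z) g = Bil v h.
Proof.
have [g H2g hg] := exists_adjoint_preimage_meval; exists g => // v /H2_nrmP[Lv hv].
have Lg := H2g.1; have Lmv := (L2_bounded_mul mms msM Lv).1.
apply/eqP; rewrite -subr_eq0 -normr_le0; apply/ler_addgt0Pr => e e0; rewrite add0r.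
have n0 := nrm_ge0 g; have n1 := nrm_ge0 h.
pose q := M * nrm g + nrm h + 1.
have q0 : 0 < q by rewrite ltr_wpDl// addr_ge0// mulr_ge0.
have [P hP] := hv _ (divr_gt0 e0 q0); have LP := L2_meval P.
have LvP := L2B Lv LP.
have -> : Bil (fun z => ms z * v z) g - Bil v h =
    Bil (fun z => ms z * (v z - meval (z ord0) P)) g - Bil (fun z => v z - meval (z ord0) P) h.
  rewrite (_ : (fun z => ms z * (v z - _)) = (fun z => ms z * v z - ms z * meval (z ord0) P)); last first.
    by apply/funext => z; rewrite mulrBr.
  by rewrite !BilBl// hg; ring.
rewrite (le_trans (ler_normB _ _))//.
have L1 := (L2_bounded_mul mms msM LvP).1.
rewrite (le_trans (lerD (Bil_cauchy_schwarz L1 Lg) (Bil_cauchy_schwarz LvP Lh)))//.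
have h1 := nrm_bounded_mul M0 mms msM LvP.
move: hP; rewrite ler_pdivlMr// => hP; rewrite (le_trans _ hP)//.
have := ler_wpM2r n0 h1; have := nrm_ge0 (fun z => v z - meval (z ord0) P).
rewrite /q; move: (nrm (fun z => v z - _)) (nrm (fun z => ms z * _)) => x y; nra.
Qed.

Lemma Bil_L2_inner v w : L2_inner v w =
  Complex (Bil v w) (Bil v (fun z => Complex 0 1 * w z)).
Proof.
congr Complex; apply: eq_Rintegral => z _.
by case: (v z) (w z) => a b [x y] /=; ring.
Qed.

Lemma exists_toeplitz_preimage : H2 h ->
  exists2 g, H2 g & H2_projection (fun z => conjc (ms z) * g z) h.
Proof.
move=> H2h; have [g H2g hg] := exists_adjoint_preimage; exists g => //; split => // v Hv.
have Lg := H2g.1.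
have mcs : measurable_fun S (fun z => conjc (ms z)) by exact: measurable_conjc.
have csM z : S z -> normc (conjc (ms z)) <= M by move=> Sz; rewrite normcJ msM.
have Lcg := (L2_bounded_mul mcs csM Lg).1.
have zero w : H2 w -> Bil ((fun z => conjc (ms z) * g z) \- h) w = 0.
  move=> Hw; have Lw := Hw.1.
  rewrite [LHS](BilBl Lcg Lh Lw) (BilC h) -hg//.
  apply/eqP; rewrite subr_eq0; apply/eqP; rewrite BilC.
  apply: eq_Rintegral => z _; congr complex.Re.
  by rewrite rmorphM/= conjcK mulrA; congr (_ * _); rewrite mulrC.
rewrite Bil_L2_inner !zero//.
have := H2_meval_mul (mpolyC d (Complex 0 1)) Hv.
by under eq_fun do rewrite mevalC.
Qed.

End minimisation.

(*@@P7b@@*)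
Lemma L2_inner_ae {R : realType} {d : nat} (u u' v : 'rV[R[i]]_d -> R[i]) :
  measurable_fun unit_sphere u -> measurable_fun unit_sphere u' ->
  measurable_fun unit_sphere v ->
  {ae @sphere_measure R d, forall z, unit_sphere z -> u z = u' z} ->
  L2_inner u v = L2_inner u' v.
Proof.
move=> mu mu' mv uu'; have mS := @measurable_unit_sphere R d.
have mw (w : 'rV[R[i]]_d -> R[i]) : measurable_fun unit_sphere w ->
    measurable_fun unit_sphere (fun z => w z * conjc (v z)).
  by move=> mw; apply: measurable_complexM => //; exact: measurable_conjc.
congr Complex; congr fine; apply: ae_eq_integral => //.
- by apply/measurable_EFinP; apply: measurable_complex_Re; exact: mw.
- by apply/measurable_EFinP; apply: measurable_complex_Re; exact: mw.
- by apply: filterS uu' => z h Sz; rewrite /= h.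
- by apply/measurable_EFinP; apply: measurable_complex_Im; exact: mw.
- by apply/measurable_EFinP; apply: measurable_complex_Im; exact: mw.
- by apply: filterS uu' => z h Sz; rewrite /= h.
Qed.

Lemma bounded_boundary_function {R : realType} {d : nat} (m ms : 'rV[R[i]]_d -> R[i]) (M : R) :
  (forall z, unit_ball z -> normc (m z) <= M) -> boundary_function m ms ->
  exists ms', [/\ boundary_function m ms', forall z, unit_sphere z -> normc (ms' z) <= M &
    {ae @sphere_measure R d, forall z, unit_sphere z -> ms z = ms' z}].
Proof.
move=> mM [mms hms]; have mS := @measurable_unit_sphere R d.
have M0 : 0 <= M.
  apply: (le_trans (normc_ge0 (m 0))); apply: mM; rewrite /unit_ball/= /enorm big1 ?sqrtr0//.
  by move=> i _; rewrite mxE normc0 expr0n.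
pose E := unit_sphere `&` (fun z => normc (ms z) ^+ 2) @^-1` `]-oo, M ^+ 2].
have mE : measurable E by apply: measurable_normc2.
have EE z : unit_sphere z -> (E z <-> normc (ms z) <= M).
  move=> Sz; rewrite /E /preimage/= in_itv/=.
  by rewrite ler_pXn2r ?nnegrE ?normc_ge0//; split=> [[]|].
pose ms' z : R[i] := (\1_E z : R)%:C%C * ms z.
have ms'E z : E z -> ms' z = ms z by move=> Ez; rewrite /ms' indicE mem_set// mul1r.
have ms'N z : ~ E z -> ms' z = 0 by move=> Ez; rewrite /ms' indicE memNset// mul0r.
have lim_le z : unit_sphere z -> m (r%:C%C *: z) @[r --> (1 : R)^'-] --> ms z -> E z.
  move=> Sz hz; apply/EE => //; apply/ler_addgt0Pr => e e0.
  have [dl dl0 hdl] := cvg_at_left_normc hz e0.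
  pose r := Num.max 0 (1 - dl / 2).
  have [r0 r1 r2] : [/\ 0 <= r, r < 1 & 1 - dl < r].
    by rewrite /r lt_max le_max lexx gt_max ltr01/=; split => //; lra.
  have /= h := hdl r r2 r1; have rB : unit_ball (r%:C%C *: z).
    by apply: unit_ball_dilate => //; rewrite r0.
  have := ler_normcD (ms z - m (r%:C%C *: z)) (m (r%:C%C *: z)); rewrite subrK.
  by have := mM _ rB; lra.
exists ms'; split; [split|..].
- apply: measurable_complexM => //.
  by apply: measurable_complexP; [exact: measurable_indic|exact: measurable_cst].
- by apply: filterS hms => z hz Sz; rewrite ms'E; [exact: hz|exact: (lim_le _ Sz (hz Sz))].
- move=> z Sz; have [Ez|nEz] := pselect (E z); first by rewrite ms'E//; exact/EE.
  by rewrite ms'N// normc0.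
- by apply: filterS hms => z hz Sz; rewrite ms'E//; exact: (lim_le _ Sz (hz Sz)).
Qed.

Theorem theorem2p1 (R : realType) (d : nat) (hd : (0 < d)%N)
    (a : nat -> R[i]) (eps c : R) (heps : 0 < eps) (hc : 0 < c)
    (ha : (fun n => Normc.normc (a n)) =O_\oo
          (fun n => expR (- c * n%:R `^ (2^-1 + eps))))
    (f : 'rV[R[i]]_d -> R[i])
    (hf : forall z : 'rV[R[i]]_d, unit_ball z ->
          series (fun n => a n * z ord0 (Ordinal hd) ^+ n) @ \oo --> f z)
    (m : 'rV[R[i]]_d -> R[i]) (hm : Hinfty m)
    (hm0 : exists2 z, unit_ball z & m z <> 0)
    (mstar : 'rV[R[i]]_d -> R[i]) (hmstar : boundary_function m mstar) :
  in_toeplitz_range mstar f.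
Proof.
set i0 := Ordinal hd in hf.
have [mhol [M mM]] := hm.
have M0 : 0 <= M by case: hm0 => z zB _; exact: le_trans (normc_ge0 (m z)) (mM z zB).
have [ms [[mms mslim] msM msE]] := bounded_boundary_function mM hmstar.
have [A hA] := exists_homogeneous_parts mhol.
have /choice[Q hQ] k : is_mpoly (A k) := homogeneous_part_is_mpoly mhol mM hA k.
have H2ms : H2 ms := H2_boundary mM hA hQ mms msM mslim.
have Lms P : L2 (fun z : 'rV[R[i]]_d => ms z * meval (z ord0) P).
  exact: (L2_bounded_mul mms msM (L2_meval P)).1.
have hB := Bil_boundary_mon hd mM hA hQ mms msM mslim.
have T0 := taylor_neq0 i0 hA hQ hm0.
have [B [G [K [B0 G0 K0 hK]]]] := multiple_coef_bound i0 Lms hB T0.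
have [L [aL aL1 aL2]] := decay_summable heps hc ha.
have [W W0 hW] := sum_decay_bounded heps hc B0 G0 ha.
have Lh := L2_slice_fun i0 aL; have fE := slice_fun_eq aL hf.
have pair (P : mpoly d R[i]) : `|Bil (fun z => meval (z ord0) P) (slice_fun i0 a)| <=
    K * W * nrm (fun z => ms z * meval (z ord0) P).
  set N := nrm _; have N0 : 0 <= N by exact: nrm_ge0.
  have KW : 0 <= K * W by exact: mulr_ge0.
  apply/ler_addgt0Pr => e e0; pose Lam := N + e / (K * W + 1).
  have q0 : 0 < e / (K * W + 1) by rewrite divr_gt0// ltr_wpDl.
  have Lam0 : 0 < Lam by rewrite ltr_wpDl.
  have NLam : N <= Lam by rewrite lerDl ltW.
  apply: (@le_trans _ _ (K * W * Lam)).
    apply: (Bil_meval_slice_fun_le aL) => n.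
    rewrite [leRHS]mulrAC; apply: le_trans (ler_wpM2l (mulr_ge0 K0 (ltW Lam0)) (hW n)).
    rewrite mulr_sumr; apply: ler_sum => k _; rewrite [leRHS]mulrCA [leRHS]mulrC.
    by rewrite mulrC mulrC ler_wpM2r ?normc_ge0//; exact: hK.
  rewrite /Lam mulrDr lerD2l mulrA ler_pdivrMr ?ltr_wpDl// mulrC.
  by rewrite ler_wpM2l ?(ltW e0)// lerDl.
have H2h := H2_slice_fun i0 aL.
have [g H2g [_ hg]] := exists_toeplitz_preimage M0 msM H2ms Lh pair H2h.
exists g, (slice_fun i0 a); split; last exact: (H2_holomorphic_slice_fun aL aL1 aL2 fE).
split => //; split => // v Hv; rewrite -[RHS](hg v Hv).
have mcg (w : 'rV[R[i]]_d -> R[i]) : measurable_fun unit_sphere w ->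
    measurable_fun unit_sphere (fun z => conjc (w z) * g z - slice_fun i0 a z).
  move=> mw; apply: measurable_complexB; last exact: Lh.1.
  by apply: measurable_complexM; [exact: measurable_conjc|exact: H2g.1.1].
apply: L2_inner_ae; [exact: mcg hmstar.1|exact: mcg|exact: Hv.1.1|].
by apply: filterS msE => z h Sz /=; rewrite h.
Qed.
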